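(* Let $\Omega',\Omega\subset\mathbb{R}^d$ be open and let $T\in\mathscr{E}'(\mathbb{R}^d)$. The following are equivalent: 1. $N_T\in L(\mathscr{E}'(\Omega'),\mathscr{E}'(\Omega))$, i.e. $S\mapsto T\star S$ maps $\mathscr{E}'(\Omega')$ into $\mathscr{E}'(\Omega)$ and is continuous linear. 2. $N_T\in L(C'(\Omega'),\mathscr{E}'(\Omega))$, i.e. $S\mapsto T\star S$ maps $C'(\Omega')$ into $\mathscr{E}'(\Omega)$ and is continuous linear. 3. $\operatorname{supp} T\subset V(\Omega',\Omega)$.
   Context: For $x,y\in\mathbb{R}^d$, $xy=(x_1y_1,\dots,x_dy_d)$. For $U\subset\mathbb{R}^d$ open, $\mathscr{E}'(U)$ is the strong dual of the Fréchet space $C^\infty(U)$, i.e. the distributions with compact support contained in $U$, regarded as a subset of $\mathscr{E}'(\mathbb{R}^d)$. $C'(U)$ is the strong dual of the Fréchet space $C(U)$ (compactly supported complex Radon measures in $U$), also regarded as a subset of $\mathscr{E}'(\mathbb{R}^d)$. For $T,S\in\mathscr{E}'(\mathbb{R}^d)$ the multiplicative convolution $T\star S\in\mathscr{E}'(\mathbb{R}^d)$ is defined by $(T\star S)f=T_x(S_y f(xy))$ for $f\in C^\infty(\mathbb{R}^d)$, and $N_T$ denotes the map $S\mapsto T\star S$. $L(E,F)$ is the space of continuous linear maps $E\to F$. For $X,Y\subset\mathbb{R}^d$, $V(X,Y)=\{\eta\in\mathbb{R}^d:\eta X\subset Y\}$, where $\eta X=\{\eta x:x\in X\}$. *)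

(* Defs.v *)
From HB Require Import structures.
From mathcomp Require Import all_boot all_order all_algebra.
From mathcomp Require Import all_classical all_reals all_analysis.
From mathcomp Require Import complex.

Set Implicit Arguments.
Unset Strict Implicit.
Unset Printing Implicit Defensive.

Import Order.TTheory GRing.Theory Num.Theory.
Import numFieldNormedType.Exports.

Local Open Scope classical_set_scope.
Local Open Scope ring_scope.

Section StrongDual.
Context {K : numFieldType}.

(* Boundedness in the sense of von Neumann: every neighbourhood of 0
   absorbs B. *)
Definition tvs_bounded (E : preTopologicalLmodType K) (B : set E) : Prop :=
  forall V : set E, nbhs 0 V ->
    exists2 r : K, 0 < r &
      forall l : K, r <= `|l| -> B `<=` [set l *: v | v in V].

Definition lincont (E F : preTopologicalLmodType K) : {pred E -> F} :=
  mem [set u : E -> F | linear u /\ continuous u].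
Arguments lincont : clear implicits.

Record dual (E : preTopologicalLmodType K) :=
  Dual { dual_fun :> E -> K^o ; _ : dual_fun \in lincont E K^o }.

HB.instance Definition _ (E : preTopologicalLmodType K) :=
  [isSub for @dual_fun E].
HB.instance Definition _ (E : preTopologicalLmodType K) :=
  [Choice of dual E by <:].

Lemma lincont_submod_closed (E : preTopologicalLmodType K) :
  submod_closed (lincont E K^o).
Proof.
split=> [|a u v /set_mem[lu cu] /set_mem[lv cv]]; apply/mem_set; split.
- by move=> b x y /=; rewrite scaler0 addr0.
- by move=> x; exact: cvg_cst.
- move=> b x y /=; rewrite !fctE lu lv !scalerDr !scalerA [b * a]mulrC.
  by rewrite addrACA.
- move=> x; apply: cvgD; last exact: cv.
  by apply: cvgZl_tmp; exact: cu.
Qed.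

HB.instance Definition _ (E : preTopologicalLmodType K) :=
  GRing.isSubmodClosed.Build K (E -> K^o) (lincont E K^o)
    (lincont_submod_closed E).
HB.instance Definition _ (E : preTopologicalLmodType K) :=
  [SubChoice_isSubLmodule of dual E by <:].

(* The strong topology: uniform convergence on the bounded subsets of E. *)
HB.instance Definition _ (E : preTopologicalLmodType K) :=
  Uniform.copy (dual E)
    (initial_topology
       (@dual_fun E : dual E -> {family @tvs_bounded E, E -> K^o})).

Lemma transpose_subproof (E F : preTopologicalLmodType K) (A : E -> F)
    (hA : A \in lincont E F) (u : dual F) : u \o A \in lincont E K^o.
Proof.
case: u => u /= /set_mem[lu cu]; move/set_mem : hA => [lA cA].
apply/mem_set; split; first by move=> a x y /=; rewrite lA lu.
by move=> x; apply: continuous_comp; [exact: cA|exact: cu].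
Qed.

Definition transpose (E F : preTopologicalLmodType K) (A : E -> F)
  (hA : A \in lincont E F) (u : dual F) : dual E :=
  Dual (transpose_subproof hA u).

End StrongDual.

Arguments lincont {K} E F.

Section Spaces.
Context {R : realType} {d : nat}.

Local Notation Rd := 'rV[R]_d.
(* R[i]^o is R[i] seen as a normed module over itself *)
Local Notation C := (R[i]^o).
Local Notation cre := (@complex.Re R : C -> R).
Local Notation cim := (@complex.Im R : C -> R).

(* Partial derivatives of complex-valued functions, taken on the real and
   imaginary parts, since the library derivatives need a target that is a
   normed module over R. *)
Definition cderivable (f : Rd -> C) (x : Rd) (i : 'I_d) : Prop :=
  derivable (cre \o f) x (delta_mx 0 i) /\
  derivable (cim \o f) x (delta_mx 0 i).

Definition cpartial (i : 'I_d) (f : Rd -> C) : Rd -> C := fun x =>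
  Complex ('D_(delta_mx 0 i) (cre \o f) x)
          ('D_(delta_mx 0 i) (cim \o f) x).

Definition iter_partial (s : seq 'I_d) (f : Rd -> C) : Rd -> C :=
  foldr cpartial f s.

Definition smooth_on (U : set Rd) (f : Rd -> C) : Prop :=
  forall s : seq 'I_d, {within U, continuous (iter_partial s f)} /\
    forall (x : Rd) (i : 'I_d), U x -> cderivable (iter_partial s f) x i.

(* Functions on U are encoded as functions on the whole space that vanish
   outside U (f \_ U = f), so that Leibniz equality is equality on U. *)
Definition smooth_pred (U : set Rd) : {pred Rd -> C} :=
  mem [set f : Rd -> C | smooth_on U f /\ f \_ U = f].

Definition cont_pred (U : set Rd) : {pred Rd -> C} :=
  mem [set f : Rd -> C | {within U, continuous f} /\ f \_ U = f].

Record Cinf (U : set Rd) (oU : open U) :=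
  MkCinf { Cinf_fun :> Rd -> C ; _ : Cinf_fun \in smooth_pred U }.

Record C0 (U : set Rd) (oU : open U) :=
  MkC0 { C0_fun :> Rd -> C ; _ : C0_fun \in cont_pred U }.

Section Structures.
Variables (U : set Rd) (oU : open U).

HB.instance Definition _ := [isSub for @Cinf_fun U oU].
HB.instance Definition _ := [Choice of Cinf oU by <:].
HB.instance Definition _ := [isSub for @C0_fun U oU].
HB.instance Definition _ := [Choice of C0 oU by <:].

Lemma restrict_lin (a : R[i]) (f g : Rd -> C) :
  f \_ U = f -> g \_ U = g -> (a *: f + g) \_ U = a *: f + g.
Proof.
move=> fU gU; rewrite -[in RHS]fU -[in RHS]gU; apply/funext => x.
by rewrite !fctE /patch; case: ifPn => // _; rewrite scaler0 addr0.
Qed.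

Lemma within_lin (a : R[i]) (f g : Rd -> C) :
  {within U, continuous f} -> {within U, continuous g} ->
  {within U, continuous (a *: f + g)}.
Proof.
move=> cf cg x; apply: cvgD; last exact: cg.
by apply: cvgZl_tmp; exact: cf.
Qed.

Lemma within_cst0 : {within U, continuous (0 : Rd -> C)}.
Proof. by move=> x; exact: cvg_cst. Qed.

Lemma restrict0 : (0 : Rd -> C) \_ U = 0.
Proof. by apply/funext => x; rewrite /patch; case: ifP. Qed.

Lemma cont_submod_closed : submod_closed (cont_pred U).
Proof.
split=> [|a f g /set_mem[cf fU] /set_mem[cg gU]]; apply/mem_set; split.
- exact: within_cst0.
- exact: restrict0.
- exact: within_lin.
- exact: restrict_lin.
Qed.

Lemma near_eq_on (f g : Rd -> C) (x : Rd) :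
  {in U, f =1 g} -> U x -> \forall y \near x, f y = g y.
Proof.
move=> fg Ux; apply: filterS (open_nbhs_nbhs (conj oU Ux)) => y Uy.
exact/fg/mem_set.
Qed.

Lemma eq_cpartial (f g : Rd -> C) (i : 'I_d) :
  {in U, f =1 g} -> {in U, cpartial i f =1 cpartial i g}.
Proof.
move=> fg x /set_mem /(near_eq_on fg) nfg.
by congr Complex; apply: near_eq_derive; apply: filterS nfg => y /= ->.
Qed.

Lemma eq_cderivable (f g : Rd -> C) (i : 'I_d) (x : Rd) : U x ->
  {in U, f =1 g} -> cderivable f x i -> cderivable g x i.
Proof.
move=> Ux /near_eq_on /(_ Ux) nfg [dr di].
by split; [apply: near_eq_derivable dr|apply: near_eq_derivable di];
  apply: filterS nfg => y /= ->.
Qed.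

Lemma eq_iter_partial (s : seq 'I_d) (f g : Rd -> C) :
  {in U, f =1 g} -> {in U, iter_partial s f =1 iter_partial s g}.
Proof. by move=> fg; elim: s => //= i s; exact: eq_cpartial. Qed.

Lemma eq_smooth_on (f g : Rd -> C) :
  {in U, f =1 g} -> smooth_on U f -> smooth_on U g.
Proof.
move=> fg sf s; have [cf df] := sf s; have fgs := eq_iter_partial s fg.
split; first exact: subspace_eq_continuous cf.
by move=> x i Ux; apply: eq_cderivable (df x i Ux).
Qed.

Lemma Re_lin (a : R[i]) (f g : Rd -> C) :
  cre \o (a *: f + g) =
  cre a \*: (cre \o f)
    + (- cim a) \*: (cim \o f) + (cre \o g).
Proof.
apply/funext => x; rewrite !fctE /= /GRing.scale /=.
by case: a (f x) (g x) => [a b] [p q] [r t] /=; rewrite mulNr.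
Qed.

Lemma Im_lin (a : R[i]) (f g : Rd -> C) :
  cim \o (a *: f + g) =
  cre a \*: (cim \o f)
    + cim a \*: (cre \o f) + (cim \o g).
Proof.
apply/funext => x; rewrite !fctE /= /GRing.scale /=.
by case: a (f x) (g x) => [a b] [p q] [r t].
Qed.

Lemma derivable_lin3 (p q : R) (F G H : Rd -> R) (x v : Rd) :
  derivable F x v -> derivable G x v -> derivable H x v ->
  derivable (p \*: F + q \*: G + H) x v /\
  'D_v (p \*: F + q \*: G + H) x =
    p * 'D_v F x + q * 'D_v G x + 'D_v H x.
Proof.
move=> dF dG dH.
have dpF : derivable (p \*: F) x v := derivableZ dF.
have dqG : derivable (q \*: G) x v := derivableZ dG.
have dFG : derivable (p \*: F + q \*: G) x v := derivableD dpF dqG.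
split; first exact: (derivableD dFG dH).
by rewrite (deriveD dFG dH) (deriveD dpF dqG) (deriveZ _ dF) (deriveZ _ dG).
Qed.

Lemma cderivable_lin (a : R[i]) (f g : Rd -> C) (x : Rd) (i : 'I_d) :
  cderivable f x i -> cderivable g x i -> cderivable (a *: f + g) x i.
Proof.
move=> [fr fi] [gr gi]; split.
  by rewrite Re_lin; case: (derivable_lin3 (cre a) (- cim a) fr fi gr).
by rewrite Im_lin; case: (derivable_lin3 (cre a) (cim a) fi fr gi).
Qed.

Lemma cpartial_lin (a : R[i]) (f g : Rd -> C) (x : Rd) (i : 'I_d) :
  cderivable f x i -> cderivable g x i ->
  cpartial i (a *: f + g) x = a *: cpartial i f x + cpartial i g x.
Proof.
move=> [fr fi] [gr gi]; rewrite /cpartial Re_lin Im_lin.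
have [_ ->] := derivable_lin3 (cre a) (- cim a) fr fi gr.
have [_ ->] := derivable_lin3 (cre a) (cim a) fi fr gi.
by case: a => p q; rewrite mulNr.
Qed.

Lemma iter_partial_lin (a : R[i]) (f g : Rd -> C) (s : seq 'I_d) :
  smooth_on U f -> smooth_on U g ->
  {in U, iter_partial s (a *: f + g) =1
         a *: iter_partial s f + iter_partial s g}.
Proof.
move=> sf sg; elim: s => [//|i s IHs] x xU /=.
rewrite (eq_cpartial i IHs xU) cpartial_lin//.
- by case: (sf s) => _; apply; exact: set_mem.
- by case: (sg s) => _; apply; exact: set_mem.
Qed.

Lemma smooth_lin (a : R[i]) (f g : Rd -> C) :
  smooth_on U f -> smooth_on U g -> smooth_on U (a *: f + g).
Proof.
move=> sf sg s; have lin := iter_partial_lin a s sf sg.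
have [cf df] := sf s; have [cg dg] := sg s; split.
  apply: (@subspace_eq_continuous _ U _
    (a *: iter_partial s f + iter_partial s g)); last exact: within_lin.
  by move=> x xU; exact/esym/lin.
move=> x i Ux.
have h : cderivable (a *: iter_partial s f + iter_partial s g) x i.
  by apply: cderivable_lin; [exact: df|exact: dg].
by apply: eq_cderivable h => // y yU; exact/esym/lin.
Qed.

Lemma smooth0 : smooth_on U 0.
Proof.
have cp0 (i : 'I_d) : cpartial i 0 = 0.
  apply/funext => x; rewrite /cpartial.
  by congr Complex; exact: derive_cst.
have ip0 s : iter_partial s 0 = 0 by elim: s => //= i s ->; exact: cp0.
move=> s; rewrite ip0; split; first exact: within_cst0.
by move=> x i Ux; split; exact: derivable_cst.
Qed.

Lemma smooth_submod_closed : submod_closed (smooth_pred U).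
Proof.
split=> [|a f g /set_mem[sf fU] /set_mem[sg gU]]; apply/mem_set; split.
- exact: smooth0.
- exact: restrict0.
- exact: smooth_lin.
- exact: restrict_lin.
Qed.

HB.instance Definition _ :=
  GRing.isSubmodClosed.Build R[i] (Rd -> C) (smooth_pred U) smooth_submod_closed.
HB.instance Definition _ := [SubChoice_isSubLmodule of Cinf oU by <:].
HB.instance Definition _ :=
  GRing.isSubmodClosed.Build R[i] (Rd -> C) (cont_pred U) cont_submod_closed.
HB.instance Definition _ := [SubChoice_isSubLmodule of C0 oU by <:].

Definition compacts_in : set (set Rd) := [set L | compact L /\ L `<=` U].

HB.instance Definition _ := Uniform.copy (C0 oU)
  (initial_topology (@C0_fun U oU : C0 oU -> {family compacts_in, Rd -> C})).

Definition jet (f : Cinf oU) :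
    prod_topology (fun _ : seq 'I_d => {family compacts_in, Rd -> C}) :=
  fun s => iter_partial s f.

HB.instance Definition _ := Uniform.copy (Cinf oU) (initial_topology jet).

End Structures.

Lemma jet_continuous (U : set Rd) (oU : open U) (s : seq 'I_d) :
  continuous (fun f : Cinf oU =>
    iter_partial s f : {family compacts_in U, Rd -> C}).
Proof.
move=> f; apply: (@continuous_comp _ _ _ (@jet U oU) (fun g => g s)).
  exact: initial_continuous.
exact: (@proj_continuous {classic seq 'I_d}
  (fun _ => {family compacts_in U, Rd -> C}) s).
Qed.

Lemma prod_continuous (X : topologicalType) (I : Type)
    (T : I -> topologicalType) (A : X -> prod_topology T) :
  (forall i, continuous (fun x => A x i)) -> continuous A.
Proof.
move=> h x; apply/(@cvg_sup (prod_topology T) I) => i.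
apply: (@continuous_comp_initial _ X (T i) (fun f : prod_topology T => f i) A).
exact: h.
Qed.

Lemma family_continuous (X : topologicalType) (U : set Rd)
    (A : X -> {family compacts_in U, Rd -> C}) :
  (forall (x : X) (L : set Rd) (E : set (C * C)),
    compacts_in U L -> entourage E ->
    \forall y \near x, forall t : Rd, L t -> E (A x t, A y t)) ->
  continuous A.
Proof.
move=> h x; apply/fam_cvgP => L UL P.
move=> /uniform_nbhs[E [entE EP]]; apply: filterS (h x L E UL entE).
by move=> y hy; exact: EP.
Qed.

Lemma smooth_sub (U V : set Rd) (f : Rd -> C) :
  U `<=` V -> smooth_on V f -> smooth_on U f.
Proof.
move=> UV sf s; have [cf df] := sf s; split.
  exact: continuous_subspaceW cf.
by move=> x i /UV; exact: df.
Qed.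

Section Restriction.
Variables (U : set Rd) (oU : open U).

Lemma restrict_smooth (f : Cinf (@openT Rd)) : f \_ U \in smooth_pred U.
Proof.
case: f => f /= /set_mem[sf _]; apply/mem_set; split.
  apply: (@eq_smooth_on U oU f) (smooth_sub _ sf) => // x xU.
  by rewrite /patch xU.
by apply/funext => x; rewrite /patch; case: ifP => // ->.
Qed.

Lemma restrict_cont (f : Cinf (@openT Rd)) : f \_ U \in cont_pred U.
Proof.
have /set_mem[sf fU] := restrict_smooth f; apply/mem_set; split=> //.
by have [] := sf [::].
Qed.

Definition restrict_Cinf (f : Cinf (@openT Rd)) : Cinf oU :=
  MkCinf oU (restrict_smooth f).

Definition restrict_C0 (f : Cinf (@openT Rd)) : C0 oU :=
  MkC0 oU (restrict_cont f).

Lemma restrict_fun_lin (a : R[i]) (f g : Rd -> C) :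
  (a *: f + g) \_ U = a *: (f \_ U) + g \_ U.
Proof.
apply/funext => x; rewrite !fctE /patch.
by case: ifP => // _; rewrite scaler0 addr0.
Qed.

Lemma near_jet (f : Cinf (@openT Rd)) (s : seq 'I_d) (L : set Rd)
    (E : set (C * C)) : compact L -> entourage E ->
  nbhs f [set g : Cinf (@openT Rd) | forall t : Rd, L t ->
    E (iter_partial s f t, iter_partial s g t)].
Proof.
move=> cL entE; have cLT : compacts_in setT L by split.
exact: (@jet_continuous setT openT s f _ (fam_nbhs (iter_partial s f) entE cLT)).
Qed.

Lemma restrict_Cinf_lincont :
  restrict_Cinf \in lincont (Cinf (@openT Rd)) (Cinf oU).
Proof.
apply/mem_set; split.
  by move=> a f g; apply: val_inj => /=; exact: restrict_fun_lin.
apply/continuous_comp_initial; apply: prod_continuous => s.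
apply: family_continuous => f L E [cL LU] entE.
apply: filterS (near_jet f s cL entE) => g fg t Lt /=.
have tU : t \in U by exact/mem_set/LU.
have resE (k : Cinf (@openT Rd)) :
    iter_partial s (k \_ U) t = iter_partial s k t.
  by apply: (eq_iter_partial oU s _ tU) => x xU; rewrite /patch xU.
rewrite /jet /= !resE; exact: fg.
Qed.

Lemma restrict_C0_lincont :
  restrict_C0 \in lincont (Cinf (@openT Rd)) (C0 oU).
Proof.
apply/mem_set; split.
  by move=> a f g; apply: val_inj => /=; exact: restrict_fun_lin.
apply/continuous_comp_initial; apply: family_continuous => f L E [cL LU] entE.
apply: filterS (near_jet f [::] cL entE) => g fg t Lt /=.
by rewrite /patch mem_set; [exact: fg|exact: LU].
Qed.

Definition emb_distr : dual (Cinf oU) -> dual (Cinf (@openT Rd)) :=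
  transpose restrict_Cinf_lincont.

Definition emb_measure : dual (C0 oU) -> dual (Cinf (@openT Rd)) :=
  transpose restrict_C0_lincont.

End Restriction.

Local Notation E' := (dual (Cinf (@openT Rd))).

Definition hadamard (x y : Rd) : Rd := map2_mx *%R x y.

(* The smooth function g on the whole space as an element of Cinf; the value
   for non-smooth g is irrelevant. *)
Definition to_Cinf (g : Rd -> C) : Cinf (@openT Rd) := insubd 0 g.

(* For f smooth, both functions to which to_Cinf is applied are smooth. *)
Definition mconv (T S : E') (f : Cinf (@openT Rd)) : R[i] :=
  T (to_Cinf (fun x => S (to_Cinf (fun y => f (hadamard x y))))).

(* N_T, i.e. S |-> mconv T S, belongs to L(E, F), where E and F are regarded
   as subsets of E' through the injections iE and iF. *)
Definition conv_in_L (E F : preTopologicalLmodType R[i])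
    (iE : E -> E') (iF : F -> E') (T : E') : Prop :=
  exists2 N : E -> F, N \in lincont E F &
    forall S : E, iF (N S) =1 mconv T (iE S).

Definition tsupport (f : Rd -> C) : set Rd := closure [set x | f x != 0].

Definition vanishes_on (T : E') (W : set Rd) : Prop :=
  forall f : Cinf (@openT Rd),
    compact (tsupport f) -> tsupport f `<=` W -> T f = 0.

Definition distr_supp (T : E') : set Rd :=
  ~` \bigcup_(W in [set W : set Rd | open W /\ vanishes_on T W]) W.

Definition dilation_set (X Y : set Rd) : set Rd :=
  [set eta | hadamard eta @` X `<=` Y].

End Spaces.

Arguments emb_distr {R d U} oU _.
Arguments emb_measure {R d U} oU _.

(* Main.v *)
Require Import Defs.
From HB Require Import structures.
From mathcomp Require Import all_boot all_order all_algebra.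
From mathcomp Require Import all_classical all_reals all_analysis.
From mathcomp Require Import complex ring lra finmap.

Set Implicit Arguments.
Unset Strict Implicit.
Unset Printing Implicit Defensive.

Import Order.TTheory GRing.Theory Num.Theory.
Import numFieldNormedType.Exports.
Import Normc.
Local Open Scope classical_set_scope.
Local Open Scope ring_scope.

(** The two directions rest on different ideas.

    Necessity.  Measures embed continuously in distributions, by transposition of
    the inclusion of C^infinity in C, so the first property gives the second one
    ([conv_measure_of_conv]).  Now test the second property on point masses:
    the convolution of T with the Dirac mass at x is the dilation of T by x.
    Suppose that eta lies in supp T, x in Omega', but eta x not in Omega.  When
    all the coordinates of x are nonzero the dilation is invertible, and its
    support contains eta x, which would be enough; in general x is approached
    by points x_n of Omega' whose coordinates are nonzero.  Functions phi_n
    living in the ball of radius 1/n around eta with T phi_n = n are transported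
    by the inverse of the dilation by x_n to functions psi_n that live closer
    and closer to eta x.  Since this point is outside Omega, the restrictions of
    the psi_n to Omega are eventually zero near any compact subset of Omega, so
    they form a bounded set.  The measures delta_(x_n) / n tend strongly to 0,
    hence so would their images, uniformly on that bounded set; but the image of
    the n-th one takes the value 1 at psi_n ([support_of_conv]).

    Sufficiency.  The map S |-> T * S is the transpose of the operator
    M f (y) = T_eta f(eta y), so it suffices to see that M is continuous from
    C^infinity(Omega) to C^infinity(Omega') ([local_mult_op_lincont]), as
    transposes are strongly continuous ([transpose_lincont]).  The support
    condition says precisely that, for y in Omega', the function f(eta y) of eta
    is defined near supp T.  For y in a compact set K the product (supp T) K is
    a compact subset of Omega, because distributions on the whole space have
    compact support ([compact_distr_supp]); multiplying f by a cutoff equal to 1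
    near this product ([cutoff]) turns it into a function on the whole space
    without changing M f near K, since T only sees germs along its support
    ([dual_local]).  On the whole space M is handled by differentiation under T
    ([smooth_partial_apply]) and by the chain rule ([subst_seminorms]).

    That the transpose of M is the convolution amounts to
    T_x (S_y f(x y)) = S_y (T_x f(x y)) ([fubini]).  Both sides are continuous
    in f, and they agree on monomials because these are multiplicative; and
    polynomials are dense in C^infinity, for the convergence of all derivatives
    on compact sets.  The density is obtained one variable at a time from
    Bernstein polynomials ([bernstein_cvg]): their derivatives are Bernstein
    polynomials of difference quotients, so they converge too. *)

(** * The modulus and the topology of the complex numbers *)

Section Modulus.
Context {R : realType}.
Local Notation C := (R[i]^o).
Implicit Types z w : C.

Lemma normc_norm z : `|z| = (normc z)%:C%C.
Proof. by case: z => a b; rewrite normc_def. Qed.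

Lemma normc_ge0 z : 0 <= normc z.
Proof. by case: z => a b; exact: sqrtr_ge0. Qed.

Lemma normcD z w : normc (z + w) <= normc z + normc w.
Proof. exact: (@le_normcD R z w). Qed.

Lemma normcNE z : normc (- z) = normc z.
Proof. exact: (@normcN R z). Qed.

Lemma normcB z w : normc (z - w) = normc (w - z).
Proof. by rewrite -normcNE opprB. Qed.

Lemma normc_dist z w u : normc (z - u) <= normc (z - w) + normc (w - u).
Proof. by rewrite (le_trans _ (normcD _ _))// addrA subrK. Qed.

Lemma normc_realE (x : R) : normc (x%:C%C : C) = `|x|.
Proof. by rewrite /normc /= expr0n addr0 sqrtr_sqr. Qed.

Lemma ler_Re_normc z : `|complex.Re z| <= normc z.
Proof.
case: z => a b /=; rewrite -sqrtr_sqr ler_sqrt ?addr_ge0 ?sqr_ge0//.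
by rewrite lerDl sqr_ge0.
Qed.

Lemma ler_Im_normc z : `|complex.Im z| <= normc z.
Proof.
case: z => a b /=; rewrite -sqrtr_sqr ler_sqrt ?addr_ge0 ?sqr_ge0//.
by rewrite lerDr sqr_ge0.
Qed.

Lemma normc_le_ReIm z : normc z <= `|complex.Re z| + `|complex.Im z|.
Proof.
case: z => a b /=; rewrite -(ler_pXn2r (n := 2))// ?nnegrE ?sqrtr_ge0 ?addr_ge0//.
rewrite sqr_sqrtr ?addr_ge0 ?sqr_ge0// sqrrD !real_normK ?num_real//.
by rewrite lerD2r lerDl mulrn_wge0// mulr_ge0.
Qed.

Lemma entourage_normc (e : R) : 0 < e ->
  entourage [set p : C * C | normc (p.1 - p.2) < e].
Proof.
move=> e0; rewrite -entourage_ballE; exists (e%:C%C) => /=; first by rewrite ltcR.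
by move=> [x y] /=; rewrite /ball /= normc_norm ltcR.
Qed.

(** The uniform structure of the complex numbers is generated by balls whose
    radii are complex numbers, positive for the partial order: such a radius
    is real, so only its real part matters. *)
Lemma entourage_normcP (E : set (C * C)) : entourage E ->
  exists2 e : R, 0 < e & forall x y, normc (x - y) < e -> E (x, y).
Proof.
rewrite -entourage_ballE => -[e /= e0 eE].
exists (complex.Re e); first by move: e0; rewrite ltcE => /andP[].
move=> x y xy; apply: eE; rewrite /= /ball /= normc_norm ltcE /=.
by move: e0; rewrite ltcE /= => /andP[-> _].
Qed.

Lemma nbhs_normcP z (A : set C) : nbhs z A <->
  exists2 e : R, 0 < e & forall w, normc (z - w) < e -> A w.
Proof.
split=> [|[e e0 eA]].
  rewrite -nbhs_entourageE => -[E entE EA].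
  have [e e0 eE] := entourage_normcP entE.
  by exists e => // w zw; apply: EA; apply/xsectionP/eE.
rewrite -nbhs_entourageE; exists [set p : C * C | normc (p.1 - p.2) < e].
  exact: entourage_normc.
by move=> w /xsectionP /=; exact: eA.
Qed.

Lemma cvg_normcP (T : Type) (F : set_system T) (FF : Filter F) (f : T -> C) z :
  f @ F --> z <-> forall e : R, 0 < e -> \forall x \near F, normc (z - f x) < e.
Proof.
split=> [h e e0|h A /nbhs_normcP[e e0 eA]].
  have : nbhs z [set w | normc (z - w) < e] by apply/nbhs_normcP; exists e.
  by move/h.
by apply: filterS (h e e0) => x; exact: eA.
Qed.

End Modulus.

(** * Partial derivatives of complex-valued functions *)

Lemma Re_increment (R : realType) (a b l : R[i]) (t : R) :
  complex.Re (a - b - t%:C%C * l) = complex.Re a - complex.Re b - t * complex.Re l.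
Proof. by case: a b l => [? ?] [? ?] [? ?] /=; rewrite mul0r subr0. Qed.

Lemma Im_increment (R : realType) (a b l : R[i]) (t : R) :
  complex.Im (a - b - t%:C%C * l) = complex.Im a - complex.Im b - t * complex.Im l.
Proof. by case: a b l => [? ?] [? ?] [? ?] /=; rewrite mul0r addr0. Qed.

Section Partials.
Context {R : realType} {d : nat}.
Local Notation Rd := 'rV[R]_d.
Local Notation C := (R[i]^o).
Local Notation cre := (@complex.Re R : C -> R).
Local Notation cim := (@complex.Im R : C -> R).
Local Notation e_ i := (delta_mx 0 i : Rd).
Implicit Types (f g : Rd -> C) (x : Rd) (i : 'I_d).

(** Existence and value of a partial derivative in one statement, so that
    differentiation rules compose without separate differentiability side
    conditions. *)
Definition has_partial f x i (l : C) : Prop :=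
  is_derive x (e_ i) (cre \o f) (cre l) /\ is_derive x (e_ i) (cim \o f) (cim l).

Lemma has_partial_cderivable f x i l : has_partial f x i l -> cderivable f x i.
Proof. by case=> [[d1 _] [d2 _]]; exact: (conj d1 d2). Qed.

Lemma has_partial_cpartial f x i l : has_partial f x i l -> cpartial i f x = l.
Proof.
by case: l => a b [[_ e1] [_ e2]]; rewrite /cpartial e1 e2.
Qed.

Lemma cderivable_has_partial f x i : cderivable f x i -> has_partial f x i (cpartial i f x).
Proof. by case=> d1 d2; exact: (conj (DeriveDef d1 erefl) (DeriveDef d2 erefl)). Qed.

(** The first-order expansion avoids division by the increment, hence also the
    exclusion of t = 0; error estimates can then be added and composed. *)
Lemma is_derive_epsP (V : normedModType R) (g : V -> R) (x v : V) (l : R) :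
  is_derive x v g l <-> forall e, 0 < e ->
    \forall t \near (0 : R), `|g (x + t *: v) - g x - t * l| <= e * `|t|.
Proof.
split=> [[dg dgl] e e0|h].
- have : (fun h => h^-1 *: (g (h *: v + x) - g x)) @ 0^' --> l.
    by rewrite -dgl; exact: dg.
  move/cvgr_dist_le => /(_ e e0).
  rewrite /at_right /dnbhs near_withinE => H.
  near=> t.
  have [->|t0] := eqVneq t 0.
    by rewrite scale0r addr0 mul0r subr0 subrr normr0 mulr0.
  have : `|l - t^-1 *: (g (t *: v + x) - g x)| <= e by apply: (near H t).
  have -> : g (x + t *: v) - g x - t * l =
      - (t * (l - t^-1 *: (g (t *: v + x) - g x))).
    by rewrite [x + _]addrC /GRing.scale /= mulrBr mulrA divff// mul1r opprB.
  by move=> H'; rewrite normrN normrM mulrC ler_wpM2r.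
- have cv : (fun h => h^-1 *: (g (h *: v + x) - g x)) @ 0^' --> l.
    apply/cvgrPdist_le => e e0; rewrite /dnbhs near_withinE.
    near=> t => t0; have := near (h e e0) t; move=> /(_ _) Ht.
    have {Ht} : `|g (x + t *: v) - g x - t * l| <= e * `|t| by near: t; exact: h.
    have -> : g (x + t *: v) - g x - t * l =
      - (t * (l - t^-1 *: (g (t *: v + x) - g x))).
      by rewrite [x + _]addrC /GRing.scale /= mulrBr mulrA divff// mul1r opprB.
    by rewrite normrN normrM mulrC ler_pM2r// normr_gt0.
  split; first by apply/cvg_ex; exists l.
  exact/cvg_lim.
Unshelve. all: by end_near. Qed.

Lemma has_partial_eps f x i l : has_partial f x i l -> forall e, 0 < e ->
  \forall t \near (0 : R),
    normc (f (x + t *: e_ i) - f x - t%:C%C * l) <= e * `|t|.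
Proof.
move=> [/is_derive_epsP h1 /is_derive_epsP h2] e e0.
have e20 : 0 < e / 2 by rewrite divr_gt0.
apply: filterS2 (h1 _ e20) (h2 _ e20) => t H1 H2.
rewrite (le_trans (normc_le_ReIm _))//.
by rewrite (splitr e) mulrDl Re_increment Im_increment lerD.
Qed.

Lemma eps_has_partial f x i l : (forall e, 0 < e -> \forall t \near (0 : R),
    normc (f (x + t *: e_ i) - f x - t%:C%C * l) <= e * `|t|) ->
  has_partial f x i l.
Proof.
move=> h; split; apply/is_derive_epsP => e e0; apply: filterS (h e e0) => t;
  apply: le_trans.
- by rewrite (le_trans _ (ler_Re_normc _))// Re_increment.
- by rewrite (le_trans _ (ler_Im_normc _))// Im_increment.
Qed.

Lemma has_partial_near f g x i l : (\forall y \near x, f y = g y) ->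
  has_partial f x i l -> has_partial g x i l.
Proof.
move=> fg [h1 h2]; split.
  by apply: near_eq_is_derive h1; apply: filterS fg => y /= ->.
by apply: near_eq_is_derive h2; apply: filterS fg => y /= ->.
Qed.

Lemma has_partial_cst (c : C) x i : has_partial (fun=> c) x i 0.
Proof. by split; apply: is_derive_cst. Qed.

Lemma has_partialD f g x i l m : has_partial f x i l -> has_partial g x i m ->
  has_partial (fun y => f y + g y) x i (l + m).
Proof.
move=> [f1 f2] [g1 g2]; split.
  rewrite (_ : cre \o _ = (cre \o f) + (cre \o g)).
    by rewrite raddfD; exact: is_deriveD.
  by apply/funext => y /=; rewrite raddfD.
rewrite (_ : cim \o _ = (cim \o f) + (cim \o g)).
  by rewrite raddfD; exact: is_deriveD.
by apply/funext => y /=; rewrite raddfD.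
Qed.

Lemma has_partialM f g x i l m : has_partial f x i l -> has_partial g x i m ->
  has_partial (fun y => f y * g y) x i (l * g x + f x * m).
Proof.
move=> [f1 f2] [g1 g2]; split.
  rewrite (_ : cre \o _ = (cre \o f) * (cre \o g) - (cim \o f) * (cim \o g)).
    apply: is_derive_eq (is_deriveB (is_deriveM f1 g1) (is_deriveM f2 g2)) _.
    rewrite /GRing.scale /=.
    by move: (f x) (g x) l m {f1 f2 g1 g2} => [? ?] [? ?] [? ?] [? ?] /=; ring.
  by apply/funext => y /=; rewrite !fctE/=; case: (f y) (g y) => [? ?] [? ?] /=.
rewrite (_ : cim \o _ = (cre \o f) * (cim \o g) + (cim \o f) * (cre \o g)).
  apply: is_derive_eq (is_deriveD (is_deriveM f1 g2) (is_deriveM f2 g1)) _.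
  rewrite /GRing.scale /=.
  by move: (f x) (g x) l m {f1 f2 g1 g2} => [? ?] [? ?] [? ?] [? ?] /=; ring.
by apply/funext => y /=; rewrite !fctE/=; case: (f y) (g y) => [? ?] [? ?] /=.
Qed.

Lemma line_is_derive (g : Rd -> R) x v l : is_derive x v g l ->
  forall (y : Rd) (s : R), x = y + s *: v ->
  is_derive s (1 : R) (fun s => g (y + s *: v)) l.
Proof.
move=> /is_derive_epsP h y s xE; apply/is_derive_epsP => e e0.
apply: filterS (h e e0) => t; rewrite {1 2}xE.
by rewrite scalerDl addrA (_ : t%:A = t)// [LHS]mulr1.
Qed.

(** The mean value theorem fails for complex values, so it is applied to the
    real and to the imaginary part: this costs the factor 2. *)
Lemma mean_value_bound f (f' : Rd -> C) (l : C) x i (t M : R) :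
  (forall s, `|s| <= `|t| -> has_partial f (x + s *: e_ i) i (f' (x + s *: e_ i))) ->
  (forall s, `|s| <= `|t| -> normc (f' (x + s *: e_ i) - l) <= M) ->
  normc (f (x + t *: e_ i) - f x - t%:C%C * l) <= 2 * M * `|t|.
Proof.
move=> df bf.
have key (p : C -> R) (pB : forall a b : C, p (a - b) = p a - p b)
    (ple : forall z, `|p z| <= normc z) :
    (forall s, `|s| <= `|t| ->
       is_derive (x + s *: e_ i) (e_ i) (p \o f) (p (f' (x + s *: e_ i)))) ->
    `|p (f (x + t *: e_ i)) - p (f x) - t * p l| <= M * `|t|.
  move=> dp.
  pose phi s := p (f (x + s *: e_ i)).
  have dphi s : `|s| <= `|t| -> is_derive s (1 : R) phi (p (f' (x + s *: e_ i))).
    by move=> st; exact: (line_is_derive (dp s st)).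
  have main c : `|c| <= `|t| -> phi t - phi 0 = p (f' (x + c *: e_ i)) * t ->
      `|p (f (x + t *: e_ i)) - p (f x) - t * p l| <= M * `|t|.
    move=> ct; rewrite {1}/phi {1}/phi scale0r addr0 => ->.
    rewrite [t * _]mulrC -mulrBl normrM -pB ler_wpM2r//.
    by rewrite (le_trans (ple _))// bf.
  have [t0|t0] := leP 0 t.
  - have [c||c /andP[c1 c2] E] := @MVT_segment R phi (fun s => p (f' (x + s *: e_ i))) 0 t t0.
    + move=> /itvP cI; apply: dphi; rewrite ger0_norm ?ger0_norm ?cI//.
    + apply: derivable_within_continuous => c /itvP cI.
      have [] // : is_derive c (1 : R) phi (p (f' (x + c *: e_ i))).
      by apply: dphi; rewrite ger0_norm ?ger0_norm ?cI.
    + apply: (main c); first by rewrite ger0_norm ?ger0_norm.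
      by rewrite E subr0.
  - have t0' := ltW t0.
    have [c||c /andP[c1 c2] E] := @MVT_segment R phi (fun s => p (f' (x + s *: e_ i))) t 0 t0'.
    + move=> /itvP cI; apply: dphi; rewrite ler0_norm ?ler0_norm ?lerN2 ?cI//.
    + apply: derivable_within_continuous => c /itvP cI.
      have [] // : is_derive c (1 : R) phi (p (f' (x + c *: e_ i))).
      by apply: dphi; rewrite ler0_norm ?ler0_norm ?lerN2 ?cI.
    + apply: (main c); first by rewrite ler0_norm ?ler0_norm ?lerN2.
      by rewrite -opprB E sub0r mulrN opprK.
rewrite (le_trans (normc_le_ReIm _))//.
rewrite -mulrA mulrDl mul1r lerD//.
- rewrite Re_increment.
  by apply: (key cre) => [a b|z|s /df[]//]; [rewrite raddfB|exact: ler_Re_normc].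
- rewrite Im_increment.
  by apply: (key cim) => [a b|z|s /df[]//]; [rewrite raddfB|exact: ler_Im_normc].
Qed.

End Partials.

(** * Calculus of smooth functions *)

Lemma real_of_Im0 (R : realType) (z : R[i]) :
  complex.Im z = 0 -> z = (complex.Re z)%:C%C.
Proof. by case: z => a b /= ->. Qed.

Section Smooth.
Context {R : realType} {d : nat}.
Local Notation Rd := 'rV[R]_d.
Local Notation C := (R[i]^o).
Local Notation e_ i := (delta_mx 0 i : Rd).
Implicit Types (f g : Rd -> C) (x : Rd) (i : 'I_d) (U : set Rd).

(** Pointwise continuity with a real epsilon; the neighbourhood filter of the
    complex numbers uses complex radii instead. *)
Definition cont_at f x : Prop :=
  forall e : R, 0 < e -> \forall y \near x, normc (f x - f y) < e.

Lemma cont_atP f x : cont_at f x <-> f y @[y --> x] --> f x.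
Proof. exact: iff_sym (cvg_normcP (nbhs_filter x) f (f x)). Qed.

Lemma cont_at_near f g x : (\forall y \near x, f y = g y) -> cont_at f x -> cont_at g x.
Proof.
move=> fg cf e e0; rewrite -(nbhs_singleton fg).
by apply: filterS2 fg (cf e e0) => y ->.
Qed.

Lemma within_cont_atP U f : open U ->
  {within U, continuous f} <-> forall x, U x -> cont_at f x.
Proof.
move=> oU; rewrite continuous_open_subspace//; split=> h x.
  by move=> Ux; apply/cont_atP; apply: h; exact/mem_set.
by move/set_mem => Ux; apply/cont_atP; exact: h.
Qed.

Lemma cont_at_cst (c : C) x : cont_at (fun=> c) x.
Proof.
move=> e e0; near=> y; rewrite subrr normc0//.
Unshelve. all: by end_near. Qed.

Lemma cont_atD f g x : cont_at f x -> cont_at g x -> cont_at (fun y => f y + g y) x.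
Proof. by move=> /cont_atP cf /cont_atP cg; apply/cont_atP; exact: (cvgD cf cg). Qed.

Lemma cont_atM f g x : cont_at f x -> cont_at g x -> cont_at (fun y => f y * g y) x.
Proof. by move=> /cont_atP cf /cont_atP cg; apply/cont_atP; exact: (@cvgM R[i] _ _ _ f g _ _ cf cg). Qed.

Lemma compact_normc_bound (K : set Rd) f : compact K ->
  (forall x, K x -> cont_at f x) -> exists2 M : R, 0 < M & forall x, K x -> normc (f x) <= M.
Proof.
move=> /compact_near_coveringP cK cf.
have [M [_ HM]] : \forall M \near +oo, K `<=` (fun x => normc (f x) <= M).
  apply: cK => x Kx; near=> y M; rewrite /=.
  have fy : normc (f x - f y) < 1.
    by near: y; exact: (cf x Kx).
  rewrite -[f y](subrK (f x)) (le_trans (normcD _ _))//.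
  rewrite normcB (@le_trans _ _ (1 + normc (f x)))// ?lerD2r ?(ltW fy)//.
exists (`|M| + 1) => [|x Kx]; first by rewrite ltr_wpDl.
apply: HM => //; first by rewrite (le_lt_trans (ler_norm _))// ltrDl.
Unshelve. all: by end_near. Qed.

Lemma iter_partial_cat (s t : seq 'I_d) f :
  iter_partial s (iter_partial t f) = iter_partial (s ++ t) f.
Proof. by rewrite /iter_partial foldr_cat. Qed.

Lemma smooth_cont_at U f (s : seq 'I_d) x : open U -> smooth_on U f -> U x ->
  cont_at (iter_partial s f) x.
Proof. by move=> oU sf Ux; have [/(within_cont_atP _ oU)+ _] := sf s; apply. Qed.

Lemma smooth_has_partial U f (s : seq 'I_d) x i : smooth_on U f -> U x ->
  has_partial (iter_partial s f) x i (iter_partial (i :: s) f x).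
Proof. by move=> sf Ux; have [_ /(_ x i Ux)/cderivable_has_partial] := sf s. Qed.

Lemma smooth_iter_partial U f s : smooth_on U f -> smooth_on U (iter_partial s f).
Proof. by move=> sf t; rewrite iter_partial_cat; exact: sf. Qed.

Lemma smooth_partial U f i : smooth_on U f -> smooth_on U (cpartial i f).
Proof. exact: (@smooth_iter_partial U f [:: i]). Qed.

Lemma coind_iter_partial U (oU : open U) (Q : (Rd -> C) -> Prop) :
  (forall f, Q f -> forall i, exists2 g, Q g & forall x, U x -> has_partial f x i (g x)) ->
  forall f s, Q f -> exists2 g, Q g & {in U, iter_partial s f =1 g}.
Proof.
move=> Qd f s Qf; elim: s => [|i s [g Qg fg]]; first by exists f.
have [h Qh gh] := Qd g Qg i; exists h => // x xU /=.
rewrite (eq_cpartial oU i fg xU).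
by apply: has_partial_cpartial; apply: gh; exact: set_mem.
Qed.

(** Smoothness by coinduction: a class of functions that consists of
    continuous functions and is stable under partial derivatives, up to
    equality on U, consists of smooth functions. Each closure property of
    smooth functions is proved by exhibiting such a class. *)
Lemma smooth_coind U (oU : open U) (Q : (Rd -> C) -> Prop) :
  (forall f, Q f -> forall x, U x -> cont_at f x) ->
  (forall f, Q f -> forall i, exists2 g, Q g & forall x, U x -> has_partial f x i (g x)) ->
  forall f, Q f -> smooth_on U f.
Proof.
move=> Qc Qd f Qf s; have [g Qg fg] := coind_iter_partial oU Qd s Qf.
split.
  apply/within_cont_atP => // x Ux; apply: cont_at_near (Qc g Qg x Ux).
  by apply: filterS (near_eq_on oU fg Ux) => y ->.
move=> x i Ux; have [h _ gh] := Qd g Qg i.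
apply: (@has_partial_cderivable _ _ _ _ _ (h x)); apply: has_partial_near (gh x Ux).
by apply: filterS (near_eq_on oU fg Ux) => y ->.
Qed.

Lemma iter_partial_near (f g : Rd -> C) (s : seq 'I_d) x :
  (\forall y \near x, f y = g y) -> iter_partial s f x = iter_partial s g x.
Proof.
rewrite /prop_near1 nbhsE => -[V [oV Vx] fg].
by apply: (eq_iter_partial oV s); [move=> y /set_mem/fg|exact/mem_set].
Qed.

Lemma smooth_local U f : open U ->
  (forall x, U x -> exists g V, [/\ open V, V x, smooth_on V g & {in V, f =1 g}]) ->
  smooth_on U f.
Proof.
move=> oU h s; split.
  apply/within_cont_atP => // x /h[g [V [oV Vx sg fg]]].
  apply: (@cont_at_near (iter_partial s g)); last exact: smooth_cont_at oV sg Vx.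
  have := near_eq_on oV (eq_iter_partial oV s fg) Vx.
  by apply: filterS => y ->.
move=> x i /h[g [V [oV Vx sg fg]]].
apply: (has_partial_cderivable (l := iter_partial (i :: s) g x)).
apply: has_partial_near (smooth_has_partial s i sg Vx).
have := near_eq_on oV (eq_iter_partial oV s fg) Vx.
by apply: filterS => y ->.
Qed.

Lemma smooth_cst U (c : C) : open U -> smooth_on U (fun=> c).
Proof.
move=> oU; apply: (@smooth_coind U oU (fun f => exists c, f = fun=> c)).
- by move=> _ [a ->] x _; exact: cont_at_cst.
- move=> _ [a ->] i; exists (fun=> 0); first by exists 0.
  by move=> x _; exact: has_partial_cst.
- by exists c.
Qed.

(** Sums of products of smooth functions: products alone are not stable under
    partial derivatives, but by the Leibniz rule their sums are. *)
Inductive prod_sums U : (Rd -> C) -> Prop :=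
| prod_sums_mul f g : smooth_on U f -> smooth_on U g ->
    prod_sums U (fun x => f x * g x)
| prod_sums_add f g : prod_sums U f -> prod_sums U g ->
    prod_sums U (fun x => f x + g x).

Lemma smooth_prod_sums U f : open U -> prod_sums U f -> smooth_on U f.
Proof.
move=> oU; apply: (smooth_coind oU).
- move=> h; elim=> [{}f g sf sg|{}f g _ IHf _ IHg] x Ux.
    by apply: cont_atM;
      [exact: (smooth_cont_at [::] oU sf Ux)|exact: (smooth_cont_at [::] oU sg Ux)].
  by apply: cont_atD; [exact: IHf|exact: IHg].
- move=> h; elim=> [{}f g sf sg|{}f g _ IHf _ IHg] i.
    exists (fun x => cpartial i f x * g x + f x * cpartial i g x).
      exact: (prod_sums_add (prod_sums_mul (smooth_partial i sf) sg)
                            (prod_sums_mul sf (smooth_partial i sg))).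
    move=> x Ux; apply: has_partialM;
      [exact: (smooth_has_partial [::] i sf Ux)|exact: (smooth_has_partial [::] i sg Ux)].
  have [f' Qf Hf] := IHf i; have [g' Qg Hg] := IHg i.
  exists (fun x => f' x + g' x); first exact: prod_sums_add.
  by move=> x Ux; apply: has_partialD; [exact: Hf|exact: Hg].
Qed.

Lemma smoothM U f g : open U -> smooth_on U f -> smooth_on U g ->
  smooth_on U (fun x => f x * g x).
Proof. by move=> oU sf sg; apply: smooth_prod_sums => //; exact: prod_sums_mul. Qed.

Lemma smoothD U f g : open U -> smooth_on U f -> smooth_on U g ->
  smooth_on U (fun x => f x + g x).
Proof.
move=> oU sf sg.
rewrite (_ : (fun _ => _) = 1 *: f + g); first exact: smooth_lin.
by apply/funext => x; rewrite !fctE scale1r.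
Qed.

Lemma smooth_prod U (I : Type) (s : seq I) (F : I -> Rd -> C) : open U ->
  (forall j, smooth_on U (F j)) -> smooth_on U (fun x => \prod_(j <- s) F j x).
Proof.
move=> oU h; elim: s => [|j s IH].
  rewrite (_ : (fun _ => _) = fun=> 1); first exact: smooth_cst.
  by apply/funext => y; rewrite big_nil.
rewrite (_ : (fun _ => _) = fun y => F j y * \prod_(j <- s) F j y).
  exact: (@smoothM U (F j) _ oU (h j) IH).
by apply/funext => y; rewrite big_cons.
Qed.

Lemma coord_step x i j (t : R) :
  (x + t *: e_ i) 0 j = x 0 j + t * (i == j)%:R.
Proof. by rewrite !mxE eqxx /= eq_sym. Qed.

Lemma has_partial_coord x i j : has_partial (fun y : Rd => (y 0 j)%:C%C : C) x i ((i == j)%:R).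
Proof.
apply: eps_has_partial => e e0; near=> t; rewrite coord_step.
rewrite (_ : _ - _ - _ = 0) ?normc0 ?mulr_ge0 ?(ltW e0)//.
by rewrite rmorphD rmorphM /= rmorph_nat; ring.
Unshelve. all: by end_near. Qed.

Lemma cont_at_real (h : Rd -> R) x :
  h y @[y --> x] --> h x -> cont_at (fun y => (h y)%:C%C : C) x.
Proof.
move=> ch e e0.
by move/cvgrPdist_lt : ch => /(_ e e0); apply: filterS => y; rewrite -raddfB normc_realE.
Qed.

Lemma cont_at_coord x j : cont_at (fun y : Rd => (y 0 j)%:C%C : C) x.
Proof. by apply: cont_at_real; exact: coord_continuous. Qed.

Lemma smooth_coord U j : open U -> smooth_on U (fun y : Rd => (y 0 j)%:C%C : C).
Proof.
move=> oU; apply: (@smooth_coind U oU (fun f => (exists c, f = fun=> c) \/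
    f = fun y : Rd => (y 0 j)%:C%C)); last by right.
- by move=> _ [[c ->]|->] x _; [exact: cont_at_cst|exact: cont_at_coord].
- move=> _ [[c ->]|->] i.
    by exists (fun=> 0) => [|x _]; [left; exists 0|exact: has_partial_cst].
  exists (fun=> (i == j)%:R) => [|x _]; first by left; eexists.
  exact: has_partial_coord.
Qed.

Lemma has_partial_real (h : Rd -> R) x i l : is_derive x (e_ i) h l ->
  has_partial (fun y => (h y)%:C%C) x i (l%:C%C).
Proof. by move=> dh; split => //=; exact: is_derive_cst. Qed.

Lemma real_has_partial (h : Rd -> R) x i l : has_partial (fun y => (h y)%:C%C) x i l ->
  is_derive x (e_ i) h (complex.Re l) /\ complex.Im l = 0.
Proof.
move=> [h1 h2]; split=> //.
have [_ <-] := h2; exact: (derive_cst (0 : R)).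
Qed.

Lemma is_derive_comp (V : normedModType R) (h : R -> R) (p : V -> R) (x v : V) a b :
  is_derive (p x) (1 : R) h a -> is_derive x v p b ->
  is_derive x v (h \o p) (b * a).
Proof.
move=> /is_derive_epsP dh /is_derive_epsP dp; apply/is_derive_epsP => e e0.
pose k := `|b| + 1; have k0 : 0 < k by rewrite ltr_wpDl.
pose e1 := e / 2 / k; have e10 : 0 < e1 by rewrite !divr_gt0.
pose e2 := e / 2 / (`|a| + 1).
have a0 : 0 < `|a| + 1 by rewrite ltr_wpDl.
have e20 : 0 < e2 by rewrite !divr_gt0.
have [del /= del0 Hdel] := dh e1 e10.
have dk0 : 0 < del / k by rewrite divr_gt0.
near=> t.
have Hp2 : `|p (x + t *: v) - p x - t * b| <= e2 * `|t| by near: t; exact: dp.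
have Hp1 : `|p (x + t *: v) - p x - t * b| <= 1 * `|t| by near: t; exact: dp.
have Hk : `|p (x + t *: v) - p x| <= k * `|t|.
  rewrite -[p _ - p x](subrK (t * b)) (le_trans (ler_normD _ _))//.
  by rewrite addrC normrM mulrC mulrDl lerD// mulrC.
have Hd : `|p (x + t *: v) - p x| < del.
  rewrite (le_lt_trans Hk)// mulrC -ltr_pdivlMr//.
have := Hdel (p (x + t *: v) - p x).
rewrite /ball_ /= sub0r normrN => /(_ Hd).
rewrite [_%:A]mulr1 [p x + _]addrC subrK => Hh.
rewrite (_ : _ - _ - _ = (h (p (x + t *: v)) - h (p x) - (p (x + t *: v) - p x) * a)
  + (p (x + t *: v) - p x - t * b) * a); last by rewrite /=; ring.
rewrite (le_trans (ler_normD _ _))// (splitr e) [leRHS]mulrDl lerD//.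
  rewrite (le_trans Hh)// (le_trans (ler_wpM2l (ltW e10) Hk))//.
  by rewrite mulrA /e1 divfK ?gt_eqF.
rewrite normrM (le_trans (ler_wpM2r (normr_ge0 _) Hp2))//.
rewrite mulrAC ler_wpM2r// /e2 mulrAC ler_pdivrMr// ler_pM2l ?divr_gt0//.
by rewrite lerDl.
Unshelve. all: by end_near. Qed.

(** Sums of products f * (h o p) with h in the class P: this is stable under
    partial derivatives by the chain rule as soon as P is stable under
    derivation. *)
Inductive comp_sums (P : (R -> R) -> Prop) (p : Rd -> R) U : (Rd -> C) -> Prop :=
| comp_sums_mul f h : smooth_on U f -> P h ->
    comp_sums P p U (fun x => f x * (h (p x))%:C%C)
| comp_sums_add f g : comp_sums P p U f -> comp_sums P p U g ->
    comp_sums P p U (fun x => f x + g x).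

(** Iterated derivatives of a one-variable function are described by a class P
    stable under derivation, which spares their explicit form. *)
Lemma smooth_comp (P : (R -> R) -> Prop) (p : Rd -> R) U (h : R -> R) : open U ->
  (forall h, P h -> continuous h) ->
  (forall h, P h -> exists2 h', P h' & forall t, is_derive t (1 : R) h (h' t)) ->
  smooth_on U (fun x => (p x)%:C%C) -> P h ->
  smooth_on U (fun x => (h (p x))%:C%C).
Proof.
move=> oU Pc Pd sp Ph.
(* Continuity of the real function p is read off its complex embedding. *)
have cp x : U x -> p y @[y --> x] --> p x.
  move=> Ux; apply/(@cvgrPdist_lt _ _ _ _ (nbhs_filter x) p (p x)) => e e0.
  apply: filterS (smooth_cont_at [::] oU sp Ux e0) => y.
  have -> : iter_partial [::] (fun x0 => (p x0)%:C%C) x -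
     iter_partial [::] (fun x0 => (p x0)%:C%C) y = (p x - p y)%:C%C.
    by rewrite rmorphB.
  by rewrite normc_realE.
have ch k x : P k -> U x -> cont_at (fun x => (k (p x))%:C%C) x.
  move=> Pk Ux; apply: (@cont_at_real (k \o p)).
  by apply: continuous_comp; [exact: cp|exact: Pc].
rewrite (_ : (fun _ => _) = fun x => 1 * (h (p x))%:C%C); last first.
  by apply/funext => x; rewrite mul1r.
apply: (smooth_coind oU (Q := comp_sums P p U)).
- move=> ?; elim=> [f k sf Pk|f g _ IHf _ IHg] x Ux.
    by apply: cont_atM; [exact: (smooth_cont_at [::] oU sf Ux)|exact: ch].
  by apply: cont_atD; [exact: IHf|exact: IHg].
- move=> ?; elim=> [f k sf Pk|f g _ IHf _ IHg] i.
    have [k' Pk' dk] := Pd k Pk.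
    exists (fun x => cpartial i f x * (k (p x))%:C%C +
       (f x * cpartial i (fun x => (p x)%:C%C) x) * (k' (p x))%:C%C).
      exact: (comp_sums_add (comp_sums_mul _ (smooth_partial i sf) Pk)
        (comp_sums_mul _ (smoothM oU sf (smooth_partial i sp)) Pk')).
    move=> x Ux; rewrite -mulrA; apply: has_partialM.
      exact: (smooth_has_partial [::] i sf Ux).
    have [dp p0] := real_has_partial (smooth_has_partial [::] i sp Ux).
    rewrite (_ : _ * _ = (complex.Re (cpartial i (fun x => (p x)%:C%C) x) * k' (p x))%:C%C).
      by apply: has_partial_real; apply: is_derive_comp.
    by rewrite rmorphM; congr (_ * _); exact: (real_of_Im0 p0).
  have [f' Qf Hf] := IHf i; have [g' Qg Hg] := IHg i.
  exists (fun x => f' x + g' x); first exact: comp_sums_add.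
  by move=> x Ux; apply: has_partialD; [exact: Hf|exact: Hg].
- apply: comp_sums_mul => //; exact: smooth_cst.
Qed.

End Smooth.

(** * Substitutions that move one coordinate at a time *)

Section Substitution.
Context {R : realType} {m n : nat}.
Local Notation C := (R[i]^o).
Variables (U' : set 'rV[R]_m) (U : set 'rV[R]_n) (oU' : open U') (oU : open U).
Variables (phi : 'rV[R]_m -> 'rV[R]_n) (k : 'I_m -> 'I_n) (q : 'I_m -> 'rV[R]_m -> R).
Hypothesis phi_step : forall z i t,
  phi (z + t *: delta_mx 0 i) = phi z + (t * q i z) *: delta_mx 0 (k i).
Hypothesis q_smooth : forall i, smooth_on U' (fun z => (q i z)%:C%C : C).
Hypothesis phiU : forall z, U' z -> U (phi z).
Hypothesis phi_cont : forall z, U' z -> phi y @[y --> z] --> phi z.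

Lemma has_partial_subst (f : 'rV[R]_n -> C) z i l : has_partial f (phi z) (k i) l ->
  has_partial (f \o phi) z i ((q i z)%:C%C * l).
Proof.
move=> /has_partial_eps df; apply: eps_has_partial => e e0.
pose M := `|q i z| + 1; have M0 : 0 < M by rewrite ltr_wpDl.
have eM : 0 < e / M by rewrite divr_gt0.
have [del /= del0 Hdel] := df _ eM.
have dM : 0 < del / M by rewrite divr_gt0.
near=> t; rewrite /= phi_step mulrA -rmorphM.
have tq : `|t * q i z| <= M * `|t|.
  by rewrite normrM mulrC ler_wpM2r// lerDl.
rewrite (le_trans (Hdel (t * q i z) _))//.
  rewrite /ball_ /= sub0r normrN (le_lt_trans tq)// mulrC -ltr_pdivlMr//.
by rewrite (le_trans (ler_wpM2l (ltW eM) tq))// mulrA divfK ?gt_eqF.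
Unshelve. all: by end_near. Qed.

Lemma cont_at_subst (f : 'rV[R]_n -> C) z : U' z -> cont_at f (phi z) ->
  cont_at (f \o phi) z.
Proof. by move=> Uz cf e e0; exact: (phi_cont Uz (cf e e0)). Qed.

(** The value along phi of the linear differential operator with coefficients
    p.1 and multi-indices p.2; a list of such pairs is a formal description of
    the iterated derivatives of c * (f o phi) that does not depend on f. *)
Definition eval_dop (L : seq (('rV[R]_m -> C) * seq 'I_n)) (f : 'rV[R]_n -> C) :
    'rV[R]_m -> C :=
  fun z => \sum_(p <- L) p.1 z * iter_partial p.2 f (phi z).

Definition smooth_dop (L : seq (('rV[R]_m -> C) * seq 'I_n)) :=
  forall p, List.In p L -> smooth_on U' p.1.

(** Chain rule for maps phi that send a move along one coordinate to a move
    along one coordinate: the i-th derivative of a * (D f o phi) has two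
    terms, one of which differentiates a while the other one adds a k i-th
    derivative to D and the factor q i to a. *)
Lemma dop_partial (L : seq (('rV[R]_m -> C) * seq 'I_n)) i : smooth_dop L ->
  exists2 L', smooth_dop L' & forall f, smooth_on U f -> forall z, U' z ->
    has_partial (eval_dop L f) z i (eval_dop L' f z).
Proof.
elim: L => [|[a r] L IH] sL.
  exists [::] => // f sf z Uz; rewrite /eval_dop big_nil.
  rewrite (_ : (fun _ => _) = fun=> 0); first exact: has_partial_cst.
  by apply/funext => y; rewrite big_nil.
have [L' sL' HL'] := IH (fun p Lp => sL p (or_intror Lp)).
have sa : smooth_on U' a := sL (a, r) (or_introl erefl).
exists ((cpartial i a, r) :: ((fun z => a z * (q i z)%:C%C), k i :: r) :: L').
  move=> p [<-|[<-|Lp]] /=; [exact: smooth_partial| |exact: sL'].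
  exact: (smoothM oU' sa (q_smooth i)).
move=> f sf z Uz; rewrite /eval_dop !big_cons /=.
rewrite (_ : (fun _ => _) = fun y => a y * (iter_partial r f \o phi) y + eval_dop L f y).
  rewrite addrA; apply: has_partialD; last exact: HL'.
  rewrite -[in X in _ + X]mulrA; apply: has_partialM.
    exact: (smooth_has_partial [::] i sa Uz).
  apply: has_partial_subst; exact: (smooth_has_partial r (k i) sf (phiU Uz)).
by apply/funext => y; rewrite big_cons.
Qed.

Lemma cont_at_eval_dop L f z : smooth_dop L -> smooth_on U f -> U' z ->
  cont_at (eval_dop L f) z.
Proof.
move=> sL sf Uz; elim: L sL => [|[a r] L IH] sL.
  rewrite (_ : eval_dop _ _ = fun=> 0); first exact: cont_at_cst.
  by apply/funext => y; rewrite /eval_dop big_nil.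
rewrite (_ : eval_dop _ _ = fun y => a y * (iter_partial r f \o phi) y + eval_dop L f y).
  apply: cont_atD; last by apply: IH => p Lp; exact: sL (or_intror Lp).
  apply: cont_atM; first exact: (smooth_cont_at [::] oU' (sL _ (or_introl erefl)) Uz).
  apply: cont_at_subst => //; exact: smooth_cont_at oU sf (phiU Uz).
by apply/funext => y; rewrite /eval_dop big_cons.
Qed.

(** The operator depends on c, phi and w but not on f. This uniformity is what
    gives continuity estimates. *)
Lemma subst_dop (c : 'rV[R]_m -> C) (w : seq 'I_m) : smooth_on U' c ->
  exists2 L, smooth_dop L & forall f, smooth_on U f ->
    {in U', iter_partial w (fun z => c z * f (phi z)) =1 eval_dop L f}.
Proof.
move=> sc; elim: w => [|i w [L sL HL]].
  exists [:: (c, [::])]; first by move=> p [<-|[]].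
  by move=> f sf z _ /=; rewrite /eval_dop big_seq1.
have [L' sL' HL'] := dop_partial i sL; exists L' => // f sf z Uz /=.
rewrite (eq_cpartial oU' i (HL f sf) Uz).
apply: has_partial_cpartial; apply: HL' => //; exact: set_mem.
Qed.

Lemma smooth_subst (c : 'rV[R]_m -> C) f : smooth_on U' c -> smooth_on U f ->
  smooth_on U' (fun z => c z * f (phi z)).
Proof.
move=> sc sf.
rewrite (_ : (fun _ => _) = eval_dop [:: (c, [::])] f); last first.
  by apply/funext => z; rewrite /eval_dop big_seq1.
apply: (smooth_coind oU' (Q := fun g => exists2 L, smooth_dop L & g = eval_dop L f)).
- by move=> _ [L sL ->] z; exact: cont_at_eval_dop.
- move=> _ [L sL ->] i; have [L' sL' HL'] := dop_partial i sL.
  by exists (eval_dop L' f) => [|z]; [exists L'|exact: HL'].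
- by exists [:: (c, [::])] => // p [<-|[]].
Qed.

Lemma eval_dop_bound L (K : set 'rV[R]_m) : smooth_dop L -> compact K -> K `<=` U' ->
  exists2 M : R, 0 < M & forall f z e, K z ->
    (forall p, p \in map snd L -> normc (iter_partial p f (phi z)) <= e) ->
    0 <= e -> normc (eval_dop L f z) <= M * e.
Proof.
move=> + cK KU; elim: L => [|[a r] L IH] sL.
  by exists 1 => // f z e Kz _ e0; rewrite /eval_dop big_nil normc0 mul1r.
have [M M0 HM] := IH (fun p Lp => sL p (or_intror Lp)).
have [N N0 HN] : exists2 N : R, 0 < N & forall z, K z -> normc (a z) <= N.
  apply: compact_normc_bound => // z /KU Uz.
  exact: (smooth_cont_at [::] oU' (sL _ (or_introl erefl)) Uz).
exists (N + M) => [|f z e Kz He e0]; first by rewrite addr_gt0.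
rewrite /eval_dop big_cons (le_trans (normcD _ _))// mulrDl lerD//.
  rewrite normcM ler_pM ?normc_ge0//; first exact: HN.
  by apply: He; rewrite inE eqxx.
by apply: HM => // p Lp; apply: He; rewrite inE Lp orbT.
Qed.

(** Continuity of f |-> c * (f o phi) in terms of seminorms: the coefficients
    of the operators of the preceding lemma are bounded on K. *)
Lemma subst_seminorms (c : 'rV[R]_m -> C) (ws : seq (seq 'I_m)) (K : set 'rV[R]_m) :
  smooth_on U' c -> compact K -> K `<=` U' ->
  exists (vs : seq (seq 'I_n)) (M : R), 0 < M /\ forall f e, smooth_on U f -> 0 <= e ->
    (forall p z, p \in vs -> K z -> normc (iter_partial p f (phi z)) <= e) ->
    forall w z, w \in ws -> K z ->
      normc (iter_partial w (fun z => c z * f (phi z)) z) <= M * e.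
Proof.
move=> sc cK KU; elim: ws => [|w ws [vs [M [M0 HM]]]]; first by exists [::], 1.
have [L sL HL] := subst_dop w sc.
have [N N0 HN] := eval_dop_bound sL cK KU.
exists (map snd L ++ vs), (N + M); split=> [|f e sf e0 Hf w' z]; first by rewrite addr_gt0.
rewrite inE => /orP[/eqP ->|w'ws] Kz.
  rewrite HL ?mem_set//; last exact: KU.
  rewrite (@le_trans _ _ (N * e))//; last by rewrite ler_wpM2r// lerDl ltW.
  by apply: HN => // p pL; apply: Hf => //; rewrite mem_cat pL.
rewrite (@le_trans _ _ (M * e))//; last by rewrite ler_wpM2r// lerDr ltW.
by apply: HM => // p y pvs Ky; apply: Hf => //; rewrite mem_cat pvs orbT.
Qed.

End Substitution.

(** * Seminorms of spaces of smooth functions, and transposes *)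

Lemma linear_at0 (K : pzRingType) (E F : lmodType K) (A : E -> F) : linear A -> A 0 = 0.
Proof. by move=> lA; have := lA (-1) 0 0; rewrite scaler0 addr0 scaleN1r addNr. Qed.

Section CinfTopology.
Context {R : realType} {d : nat}.
Local Notation Rd := 'rV[R]_d.
Local Notation C := (R[i]^o).
Variables (U : set Rd) (oU : open U).
Implicit Types (f g : Cinf oU) (ws : seq (seq 'I_d)) (K : set Rd).

Lemma Cinf_smooth f : smooth_on U f.
Proof. by case: f => f /= /set_mem[]. Qed.

Lemma Cinf_restrict f : f \_ U = (f : Rd -> C).
Proof. by case: f => f /= /set_mem[]. Qed.

Lemma Cinf_out f x : ~ U x -> (f : Rd -> C) x = 0.
Proof. by move=> Ux; rewrite -Cinf_restrict /patch memNset. Qed.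

Lemma CinfP f g : (forall x, U x -> f x = g x) -> f = g.
Proof.
move=> fg; apply: val_inj => /=; apply/funext => x.
by have [/fg//|Ux] := pselect (U x); rewrite !Cinf_out.
Qed.

Lemma iter_partial_linP s (a : R[i]) f g x : U x ->
  iter_partial s (a *: f + g : Cinf oU) x =
  a * iter_partial s f x + iter_partial s g x.
Proof.
move=> /mem_set xU.
exact: (iter_partial_lin oU a s (Cinf_smooth f) (Cinf_smooth g) xU).
Qed.

Lemma iter_partial0 s x : U x -> iter_partial s (0 : Cinf oU) x = 0.
Proof.
move=> Ux; have := iter_partial_linP s (-1) 0 0 Ux.
by rewrite scaler0 addr0 mulN1r addNr.
Qed.

(** Together with the next lemma, this replaces the initial topology along all
    derivatives by seminorms: this half is the continuity of the seminorms. *)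
Lemma near_seminorms f ws K (e : R) : compact K -> K `<=` U -> 0 < e ->
  \forall g \near f, forall s t, s \in ws -> K t ->
    normc (iter_partial s f t - iter_partial s (g : Cinf oU) t) < e.
Proof.
move=> cK KU e0; elim: ws => [|w ws IH]; first by apply: filterE => g s t; rewrite in_nil.
have h : \forall g \near f, forall t, K t ->
    normc (iter_partial w f t - iter_partial w (g : Cinf oU) t) < e.
  apply: (@jet_continuous R d U oU w f _ (fam_nbhs (iter_partial w f)
    (entourage_normc e0) (conj cK KU : compacts_in U K))).
apply: filterS2 h IH => g hg IHg s t; rewrite inE => /orP[/eqP ->|sw] Kt.
  exact: hg.
exact: IHg.
Qed.

Lemma nbhs_seminorms f (V : set (Cinf oU)) : nbhs f V ->
  exists ws K (e : R), [/\ compact K, K `<=` U, 0 < e & forall g,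
    (forall s t, s \in ws -> K t -> normc (iter_partial s f t - iter_partial s g t) < e) ->
    V g].
Proof.
(* The seminorm neighbourhoods of f form a filter finer than the neighbourhood
   filter of the jet of f in the product topology, which can be checked one
   coordinate at a time. *)
pose basic ws K (e : R) : set (seq 'I_d -> Rd -> C) :=
  [set j | forall s t, s \in ws -> K t -> normc (iter_partial s f t - j s t) < e].
pose F : set_system (seq 'I_d -> Rd -> C) := [set P | exists ws K (e : R),
  [/\ compact K, K `<=` U, 0 < e & basic ws K e `<=` P]].
have FF : Filter F.
  split.
  - by exists [::], set0, 1; split => //; exact: compact0.
  - move=> P Q [ws [K [e [cK KU e0 H]]]] [ws' [K' [e' [cK' KU' e0' H']]]].
    exists (ws ++ ws'), (K `|` K'), (Order.min e e'); split.
    + exact: compactU.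
    + by move=> x [/KU|/KU'].
    + by rewrite lt_min e0.
    + move=> j hj; split.
        apply: H => s t sw Kt.
        have := hj s t; rewrite mem_cat sw => /(_ erefl (or_introl Kt)).
        by rewrite lt_min => /andP[].
      apply: H' => s t sw Kt.
      have := hj s t; rewrite mem_cat sw orbT => /(_ erefl (or_intror Kt)).
      by rewrite lt_min => /andP[].
  - move=> P Q PQ [ws [K [e [cK KU e0 H]]]].
    by exists ws, K, e; split => // j /H/PQ.
have Fcvg : F --> (jet f : prod_topology (fun _ : seq 'I_d =>
    {family compacts_in U, Rd -> C})).
  apply/(@cvg_sup (prod_topology (fun _ : seq 'I_d =>
    {family compacts_in U, Rd -> C})) (seq 'I_d)) => i.
  move=> A /= [_ [[B Bop <-] Bfs sBfA]].
  apply: filterS sBfA _.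
  have : ((fun j : seq 'I_d -> Rd -> C => j i) @ F) -->
      (jet f i : {family compacts_in U, Rd -> C}).
    apply/fam_cvgP => K [cK KU] P /uniform_nbhs[E [/entourage_normcP[e e0 eE] EP]].
    exists [:: i], K, e; split=> // j hj; apply: EP => t Kt.
    by apply: eE; apply: hj; rewrite ?inE.
  move=> /(_ B); apply; exact: open_nbhs_nbhs.
move=> /= [_ [[B Bop <-] Bfs sBfA]].
have [ws [K [e [cK KU e0 H]]]] : F B by apply: Fcvg; exact: open_nbhs_nbhs.
by exists ws, K, e; split => // g hg; apply: sBfA; exact: H.
Qed.

Section Dual.
Variable u : dual (Cinf oU).

Lemma dual_lin : linear u.
Proof. by case: u => v /= /set_mem[]. Qed.

Lemma dual0 : u 0 = 0.
Proof. exact: linear_at0 dual_lin. Qed.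

Lemma dual_continuous : continuous u.
Proof. by case: u => v /= /set_mem[]. Qed.

(** A continuous functional is bounded on a seminorm neighbourhood of 0, and
    homogeneity turns this into a linear estimate. The estimate is stated with
    an arbitrary upper bound e of the seminorms, so that no supremum has to
    exist. *)
Lemma dual_seminorm_bound : exists ws K (M : R), [/\ compact K, K `<=` U, 0 < M &
  forall g (e : R), 0 <= e ->
    (forall s t, s \in ws -> K t -> normc (iter_partial s g t) <= e) ->
    normc (u g) <= M * e].
Proof.
have : nbhs (0 : Cinf oU) [set g | normc (u 0 - u g) < 1].
  apply: (@dual_continuous 0 [set w | normc (u 0 - w) < 1]).
  by apply/nbhs_normcP; exists 1.
move=> /nbhs_seminorms[ws [K [e [cK KU e0 H]]]].
have main g (r : R) : 0 < r ->
    (forall s t, s \in ws -> K t -> normc (iter_partial s g t) <= r) ->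
    normc (u g) <= 2 / e * r.
  move=> r0 Hg; pose a : R := e / 2 / r.
  have a0 : 0 < a by rewrite !divr_gt0.
  have Ha : normc (u 0 - u (a%:C%C *: g + 0)) < 1.
    apply: H => s t sw Kt; rewrite iter_partial_linP; last exact: KU.
    rewrite (iter_partial0 s (KU _ Kt)) addr0 sub0r normcNE normcM normc_realE gtr0_norm//.
    rewrite (le_lt_trans (ler_wpM2l (ltW a0) (Hg s t sw Kt)))//.
    by rewrite /a divfK ?gt_eqF// gtr_pMr// invf_lt1// ltr1n.
  move: Ha; rewrite dual0 sub0r normcNE dual_lin dual0.
  have -> : normc (a%:C%C *: u g + 0) = a * normc (u g).
    by rewrite addr0 /GRing.scale /= normcM normc_realE gtr0_norm.
  move=> Ha; rewrite -(ler_pM2l a0) mulrA.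
  by rewrite (_ : a * (2 / e) * r = 1) ?ltW// /a; field; rewrite !gt_eqF.
exists ws, K, (2 / e); split; rewrite ?divr_gt0// => g r.
rewrite le_eqVlt => /orP[/eqP <- Hg|]; last exact: main.
(* When e = 0 no rescaling is possible; the bound for all positive values is
   used instead. *)
rewrite mulr0; apply/ler_addgt0Pr => s s0; rewrite add0r.
rewrite -[leRHS](_ : 2 / e * (s * (e / 2)) = s); last by field; rewrite gt_eqF.
have se0 : 0 < s * (e / 2) by rewrite mulr_gt0// divr_gt0.
by apply: main => // w t ws' Kt; rewrite (le_trans (Hg w t ws' Kt))// ltW.
Qed.

End Dual.

End CinfTopology.

Section Operators.
Context {R : realType} {m n : nat}.
Local Notation C := (R[i]^o).
Variables (U : set 'rV[R]_m) (oU : open U) (V : set 'rV[R]_n) (oV : open V).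

(** Continuity of a linear map at f follows from the estimate applied to
    differences g - f. *)
Lemma lincont_seminorms (A : Cinf oU -> Cinf oV) : linear A ->
  (forall w (K : set 'rV[R]_n), compact K -> K `<=` V ->
    exists (ws : seq (seq 'I_m)) (L : set 'rV[R]_m) (M : R), [/\ compact L, L `<=` U, 0 < M &
    forall (g : Cinf oU) (e : R), 0 <= e ->
      (forall s t, s \in ws -> L t -> normc (iter_partial s g t) <= e) ->
      forall t, K t -> normc (iter_partial w (A g) t) <= M * e]) ->
  A \in lincont (Cinf oU) (Cinf oV).
Proof.
move=> lA H; apply/mem_set; split => //.
apply/continuous_comp_initial; apply: prod_continuous => w.
apply: family_continuous => f K E [cK KV] /entourage_normcP[e e0 eE].
have [ws [L [M [cL LU M0 HL]]]] := H w K cK KV.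
pose r := e / 2 / M; have r0 : 0 < r by rewrite !divr_gt0.
apply: filterS (near_seminorms f ws cL LU r0) => g fg t Kt.
apply: eE; rewrite /jet normcB.
have -> : iter_partial w (A g) t - iter_partial w (A f) t =
    iter_partial w (A ((-1) *: f + g)) t.
  rewrite lA (@iter_partial_linP R n V oV); last exact: KV.
  by rewrite mulN1r addrC.
apply: (@le_lt_trans _ _ (M * r)).
  apply: HL => //; first exact: ltW.
  move=> s x sw Lx; rewrite (@iter_partial_linP R m U oU); last exact: LU.
  by rewrite mulN1r addrC normcB; exact/ltW/fg.
by rewrite /r mulrC divfK ?gt_eqF// gtr_pMr// invf_lt1// ltr1n.
Qed.

End Operators.

Section StrongDual.
Context {K : numFieldType}.
Implicit Types E F : preTopologicalLmodType K.

(** This is what makes transposes strongly continuous: uniform convergence on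
    a bounded set B of the transposed functionals is uniform convergence on
    the image of B. *)
Lemma bounded_image E F (A : E -> F) (B : set E) : A \in lincont E F ->
  tvs_bounded B -> tvs_bounded (A @` B).
Proof.
move=> /set_mem[lA cA] bB V nV.
have A0 := linear_at0 lA.
have nAV : nbhs 0 (A @^-1` V) by apply: cA; rewrite A0.
have [r r0 Hr] := bB _ nAV; exists r => // l rl _ [x Bx <-].
have [v Vv <-] := Hr l rl x Bx; exists (A v) => //.
by have := lA l v 0; rewrite !addr0 A0 addr0.
Qed.

Lemma transpose_lincont E F (A : E -> F) (hA : A \in lincont E F) :
  transpose hA \in lincont (dual F) (dual E).
Proof.
apply/mem_set; split; first by move=> a u v; apply: val_inj.
apply/continuous_comp_initial => u.
apply/(@fam_cvgP _ _ _ _ _ (fmap_filter _ (nbhs_filter u))) => B bB P.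
move=> /uniform_nbhs[W [entW WP]].
have h : nbhs u [set v : dual F | forall y, (A @` B) y -> W (u y, v y)].
  have ci : continuous (@dual_fun K F : dual F -> {family @tvs_bounded K F, F -> K^o}).
    exact: initial_continuous.
  apply: (ci u _ (fam_nbhs (dual_fun u) entW (bounded_image hA bB))).
apply: filterS h => v hv; apply: WP => y By /=; apply: hv; by exists y.
Qed.

End StrongDual.

Section Lincont.
Context {K : numFieldType}.
Implicit Types E F G : preTopologicalLmodType K.

Lemma lincont_comp E F G (A : E -> F) (B : F -> G) :
  A \in lincont E F -> B \in lincont F G -> B \o A \in lincont E G.
Proof.
move=> /set_mem[lA cA] /set_mem[lB cB]; apply/mem_set; split.
  by move=> a x y /=; rewrite lA lB.
by move=> x; apply: continuous_comp; [exact: cA|exact: cB].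
Qed.

End Lincont.

(** * Measures and bounded families of smooth functions *)

Section Measures.
Context {R : realType} {d : nat}.
Local Notation Rd := 'rV[R]_d.
Local Notation C := (R[i]^o).
Variables (U : set Rd) (oU : open U).

Lemma Cinf_cont_pred (f : Cinf oU) : (f : Rd -> C) \in cont_pred U.
Proof.
apply/mem_set; split; last exact: Cinf_restrict.
by have [] := Cinf_smooth f [::].
Qed.

Definition Cinf_C0 (f : Cinf oU) : C0 oU := MkC0 oU (Cinf_cont_pred f).

Lemma Cinf_C0_lincont : Cinf_C0 \in lincont (Cinf oU) (C0 oU).
Proof.
apply/mem_set; split; first by move=> a f g; apply: val_inj.
apply/continuous_comp_initial; apply: family_continuous => f L E [cL LU].
move=> /entourage_normcP[e e0 eE].
apply: filterS (near_seminorms f [:: [::]] cL LU e0) => g fg t Lt.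
by apply: eE; apply: (fg [::] t); rewrite ?inE.
Qed.

(** The inclusion of measures in distributions is the transpose of the
    inclusion of smooth functions in continuous functions, so it is continuous
    for the strong topologies. *)
Lemma emb_distr_C0 (mu : dual (C0 oU)) :
  emb_distr oU (transpose Cinf_C0_lincont mu) =1 emb_measure oU mu.
Proof.
by move=> f /=; congr (dual_fun mu _); apply: val_inj.
Qed.

Lemma near_C0 (f : C0 oU) (L : set Rd) (e : R) : compact L -> L `<=` U -> 0 < e ->
  \forall g \near f, forall t, L t -> normc ((f : Rd -> C) t - (g : C0 oU) t) < e.
Proof.
move=> cL LU e0.
have ci : continuous (@C0_fun R d U oU : C0 oU -> {family compacts_in U, Rd -> C}).
  exact: initial_continuous.
exact: (ci f _ (fam_nbhs (C0_fun f) (entourage_normc e0) (conj cL LU : compacts_in U L))).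
Qed.

Lemma dirac_lincont (x : Rd) (Ux : U x) :
  (fun f : C0 oU => (f : Rd -> C) x) \in lincont (C0 oU) (R[i] : numFieldType)^o.
Proof.
apply/mem_set; split; first by move=> a f g.
move=> f; apply/(cvg_normcP (nbhs_filter f)) => e e0.
have xU : [set x] `<=` U by move=> _ ->.
by apply: filterS (near_C0 f (@compact_set1 _ x) xU e0) => g; apply.
Qed.

Definition dirac_C0 (x : Rd) (Ux : U x) : dual (C0 oU) := Dual (dirac_lincont Ux).

(** The functions of modulus less than 1 on L form a neighbourhood of 0, which
    absorbs B. *)
Lemma tvs_bounded_C0 (B : set (C0 oU)) (L : set Rd) : compact L -> L `<=` U ->
  tvs_bounded B -> exists2 M : R, 0 < M & forall g t, B g -> L t -> normc (g t) <= M.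
Proof.
move=> cL LU bB.
have [r r0 Hr] := bB _ (near_C0 0 cL LU ltr01).
(* A positive complex number is real. *)
have rE : r = (complex.Re r)%:C%C.
  by apply: real_of_Im0; move: r0; rewrite ltcE => /andP[/eqP].
have r0' : 0 < complex.Re r by move: r0; rewrite rE ltcR.
exists (complex.Re r) => // g t Bg Lt.
have [v Hv <-] : [set r *: v | v in
    [set g0 : C0 oU | forall t, L t -> normc (((0 : C0 oU) : Rd -> C) t - g0 t) < 1]] g.
  by apply: (Hr r) => //; rewrite gtr0_norm.
rewrite /= {1}rE normcM normc_realE gtr0_norm// -[leRHS]mulr1 ler_pM2l// ltW//.
by have := Hv t Lt; rewrite sub0r normcNE.
Qed.

Lemma Cinf_bound (g : Cinf oU) (ws : seq (seq 'I_d)) (L : set Rd) :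
  compact L -> L `<=` U ->
  exists2 M : R, 0 < M & forall s t, s \in ws -> L t -> normc (iter_partial s g t) <= M.
Proof.
move=> cL LU; elim: ws => [|w ws [M M0 HM]]; first by exists 1.
have [N N0 HN] : exists2 N : R, 0 < N & forall t, L t -> normc (iter_partial w g t) <= N.
  by apply: compact_normc_bound => // t /LU; apply: smooth_cont_at => //; exact: Cinf_smooth.
exists (M + N) => [|s t]; first by rewrite addr_gt0.
rewrite inE => /orP[/eqP -> /HN|sw /(HM s t sw)] /le_trans; apply.
  by rewrite lerDr ltW.
by rewrite lerDl ltW.
Qed.

(** Every seminorm involves a compact set L, near which only finitely many of
    the functions are nonzero. *)
Lemma bounded_locally_null (g : nat -> Cinf oU) :
  (forall L : set Rd, compact L -> L `<=` U -> exists n0, forall n, (n0 <= n)%N ->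
     forall x, L x -> \forall y \near x, (g n : Rd -> C) y = 0) ->
  tvs_bounded (range g).
Proof.
move=> H V /nbhs_seminorms[ws [L [e [cL LU e0 HV]]]].
have [n0 Hn0] := H L cL LU.
have z0 s t : L t -> iter_partial s (0 : Cinf oU) t = 0.
  by move=> /LU; exact: iter_partial0.
have [M M0 HM] : exists2 M : R, 0 < M & forall n s t, s \in ws -> L t ->
    normc (iter_partial s (g n) t) <= M.
  have [M M0 HM] : exists2 M : R, 0 < M & forall n s t, (n < n0)%N -> s \in ws -> L t ->
      normc (iter_partial s (g n) t) <= M.
    elim: n0 {Hn0} => [|n0 [M M0 HM]]; first by exists 1.
    have [N N0 HN] := Cinf_bound (g n0) ws cL LU.
    exists (M + N) => [|n s t]; first by rewrite addr_gt0.
    rewrite ltnS leq_eqVlt => /orP[/eqP ->|nn0] sw Lt.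
      by rewrite (le_trans (HN s t sw Lt))// lerDr ltW.
    by rewrite (le_trans (HM n s t nn0 sw Lt))// lerDl ltW.
  exists M => // n s t sw Lt; have [nn0|nn0] := ltnP n n0; first exact: HM.
  (* Vanishing near t, and not just at t, is needed for the derivatives. *)
  rewrite (@iter_partial_near _ _ _ (0 : Cinf oU)); last exact: (Hn0 n nn0 t Lt).
  by rewrite z0// normc0 ltW.
pose r := M / e + 1; have r0 : 0 < r by rewrite addr_gt0// divr_gt0.
exists (r%:C%C) => [|l rl]; first by rewrite ltcR.
have {}rl : r <= normc l by rewrite -lecR -normc_norm.
have l0 : l != 0.
  by apply: contraTneq rl => ->; rewrite normc0 -ltNge.
move=> _ [n _ <-]; exists (l^-1 *: g n); last by rewrite scalerA divff// scale1r.
apply: HV => s t sw Lt; rewrite z0// sub0r normcNE.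
rewrite -[_ *: g n]addr0 iter_partial_linP; last exact: LU.
rewrite z0// addr0 normcM normcV mulrC ltr_pdivrMr ?(lt_le_trans r0)//.
rewrite (le_lt_trans (HM n s t sw Lt))// (lt_le_trans _ (ler_wpM2l (ltW e0) rl))//.
by rewrite /r mulrDr mulr1 mulrC divfK ?gt_eqF// ltrDl.
Qed.

End Measures.

(** * Coordinatewise multiplication *)

Lemma normc_nat (R : realType) n : normc (n%:R : R[i]) = n%:R.
Proof. by rewrite -(rmorph_nat (real_complex R)) normc_realE ger0_norm. Qed.

Section Hadamard.
Context {R : realType} {d : nat}.
Local Notation Rd := 'rV[R]_d.
Local Notation C := (R[i]^o).

Lemma hadamardE (x y : Rd) i : hadamard x y 0 i = x 0 i * y 0 i.
Proof. by rewrite /hadamard mxE. Qed.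

Lemma hadamardC (x y : Rd) : hadamard x y = hadamard y x.
Proof. by apply/rowP => i; rewrite !hadamardE mulrC. Qed.

Lemma to_CinfE (g : Rd -> C) : smooth_on setT g -> (to_Cinf g : Rd -> C) = g.
Proof.
move=> sg; rewrite /to_Cinf insubdK//; apply/mem_set; split=> //.
by apply/funext => x; rewrite /patch mem_set.
Qed.

(** Multiplication by a is diagonal, so it moves one coordinate at a time and
    falls under the substitution rule. *)
Lemma hadamard_step (a z : Rd) i t :
  hadamard a (z + t *: delta_mx 0 i) =
  hadamard a z + (t * a 0 i) *: delta_mx 0 i.
Proof.
apply/rowP => j; rewrite hadamardE !mxE eqxx /=.
by have [->|] := eqVneq j i; rewrite ?mulr1 ?mulr0 ?addr0//; ring.
Qed.

Lemma cvg_rV (T : Type) (F : set_system T) (FF : Filter F) (f : T -> Rd) (l : Rd) :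
  (forall i, (f x) 0 i @[x --> F] --> l 0 i) -> f @ F --> l.
Proof.
move=> h; apply/(@cvg_ballP R) => e e0.
have : \forall x \near F, forall i, `|l 0 i - f x 0 i| < e.
  have := @filter_forall T 'I_d (fun i x => `|l 0 i - f x 0 i| < e) F FF.
  apply => i.
  exact: ((@cvgrPdist_lt _ _ _ F FF (fun x => f x 0 i) (l 0 i)).1 (h i) e e0).
apply: filterS => x hx; split => // i j; rewrite ord1; exact: hx.
Qed.

Lemma hadamard_cvg (T : Type) (F : set_system T) (FF : Filter F) (f g : T -> Rd) (a b : Rd) :
  f @ F --> a -> g @ F --> b -> hadamard (f x) (g x) @[x --> F] --> hadamard a b.
Proof.
move=> fa gb; apply: cvg_rV => i.
rewrite hadamardE (_ : (fun x => _) = (fun x => f x 0 i * g x 0 i)); last first.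
  by apply/funext => x; rewrite hadamardE.
have fi : f x 0 i @[x --> F] --> a 0 i.
  apply: (@cvg_comp _ _ _ f (fun y : Rd => y 0 i) _ (nbhs a)) => //.
  exact: (@coord_continuous R 1 d 0 i a).
have gi : g x 0 i @[x --> F] --> b 0 i.
  apply: (@cvg_comp _ _ _ g (fun y : Rd => y 0 i) _ (nbhs b)) => //.
  exact: (@coord_continuous R 1 d 0 i b).
exact: (cvgM fi gi).
Qed.

Lemma hadamard_continuous (a : Rd) : continuous (hadamard a).
Proof. by move=> z; apply: (@hadamard_cvg _ (nbhs z)) => //; exact: cvg_cst. Qed.

Lemma smooth_hadamard (U : set Rd) (a : Rd) (f : Rd -> C) : open U ->
  smooth_on U f -> smooth_on (hadamard a @^-1` U) (f \o hadamard a).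
Proof.
move=> oU sf.
have oU' : open (hadamard a @^-1` U).
  by apply: open_comp => // z _; exact: hadamard_continuous.
rewrite (_ : f \o _ = fun z => 1 * f (hadamard a z)); last first.
  by apply/funext => z; rewrite mul1r.
apply: (smooth_subst oU' oU (hadamard_step a)) => //.
- by move=> i; exact: smooth_cst.
- by move=> z _; exact: hadamard_continuous.
- exact: smooth_cst.
Qed.

Lemma smoothT_hadamard (a : Rd) (f : Rd -> C) :
  smooth_on setT f -> smooth_on setT (f \o hadamard a).
Proof. by move=> sf; exact: (@smooth_hadamard setT a f openT sf). Qed.

Lemma coord_le_norm (v : Rd) i : `|v 0 i| <= `|v|.
Proof.
rewrite [leRHS]mx_normrE; apply/bigmax_geP; right => /=; by exists (0, i).
Qed.

Lemma norm_lt_coord (v : Rd) (e : R) : 0 < e -> (forall i, `|v 0 i| < e) -> `|v| < e.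
Proof.
by move=> e0 h; rewrite [ltLHS]mx_normrE; apply/bigmax_ltP; split=> // -[i j] _; rewrite ord1.
Qed.

Lemma compact_box (x : Rd) (r : R) : compact [set y : Rd | forall i, `|y 0 i - x 0 i| <= r].
Proof.
have -> : [set y : Rd | forall i, `|y 0 i - x 0 i| <= r] =
    [set v : Rd | forall i, `[x 0 i - r, x 0 i + r]%classic (v ord0 i)].
  by apply/seteqP; split=> y h i; have := h i; rewrite /= in_itv /= -ler_distl.
apply: (@rV_compact R d (fun i => `[x 0 i - r, x 0 i + r]%classic)) => i.
exact: segment_compact.
Qed.

Lemma compact_far_from (L : set Rd) (p : Rd) : compact L -> ~ L p ->
  exists2 r : R, 0 < r & forall x y, L x -> `|p - y| < r -> `|x - y| >= r.
Proof.
move=> cL Lp; have cl : closed L by apply: compact_closed => //; exact: norm_hausdorff.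
have : nbhs p (~` L) by apply: open_nbhs_nbhs; split=> //; exact: closed_openC.
move=> /nbhs_ballP[e /= e0 He]; exists (e / 2) => [|x y Lx py]; first by rewrite divr_gt0.
rewrite leNgt; apply/negP => xy; apply: (He x) => //.
rewrite -ball_normE /ball_ /= (splitr e) -[p - x](subrKA y).
by rewrite (le_lt_trans (ler_normD _ _))// ltrD// distrC.
Qed.

Lemma distr_suppP (T : dual (Cinf (@openT Rd))) (eta : Rd) (W : set Rd) :
  distr_supp T eta -> open W -> W eta ->
  exists2 f : Cinf (@openT Rd), forall y, ~ W y -> (f : Rd -> C) y = 0 & T f != 0.
Proof.
move=> sT oW Weta; apply: contrapT => h; apply: sT; exists W => //; split => // f cf fW.
apply/eqP; apply: contrapT => /negP Tf; apply: h; exists f => // y Wy.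
apply/eqP; apply: contrapT => /negP fy; apply: Wy; apply: fW.
by apply: subset_closure.
Qed.

Lemma emb_measure_dirac (U : set Rd) (oU : open U) (x : Rd) (Ux : U x)
    (f : Cinf (@openT Rd)) :
  emb_measure oU (dirac_C0 oU Ux) f = (f : Rd -> C) x.
Proof.
have -> : emb_measure oU (dirac_C0 oU Ux) f = ((f : Rd -> C) \_ U) x by [].
by rewrite /patch mem_set.
Qed.

Lemma mconv_dirac (U : set Rd) (oU : open U) (T : dual (Cinf (@openT Rd))) (x : Rd)
    (Ux : U x) (f : Cinf (@openT Rd)) :
  mconv T (emb_measure oU (dirac_C0 oU Ux)) f = T (to_Cinf (f \o hadamard x)).
Proof.
have h z : emb_measure oU (dirac_C0 oU Ux) (to_Cinf (fun y => f (hadamard z y))) =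
    f (hadamard x z).
  have sz := smoothT_hadamard z (Cinf_smooth f).
  by rewrite emb_measure_dirac (congr1 (fun g => g x) (to_CinfE sz)) hadamardC.
by rewrite /mconv; congr (dual_fun T (to_Cinf _)); exact/funext.
Qed.

End Hadamard.

(** * Necessity of the support condition *)

Section Necessity.
Context {R : realType} {d : nat} (Omega' Omega : set 'rV[R]_d).
Hypotheses (oOmega' : open Omega') (oOmega : open Omega).
Variable T : dual (Cinf (@openT 'rV[R]_d)).
Local Notation Rd := 'rV[R]_d.
Local Notation C := (R[i]^o).

(** Point masses at points of a compact set form an equicontinuous, hence
    strongly bounded, set of measures. *)
Lemma cvg0_scaled_dirac (L : set Rd) (x : nat -> Rd) (hx : forall n, Omega' (x n)) :
  compact L -> L `<=` Omega' -> (forall n, L (x n)) ->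
  ((n.+1%:R^-1 : R[i]) *: dirac_C0 oOmega' (hx n)) @[n --> \oo] -->
  (0 : dual (C0 oOmega')).
Proof.
move=> cL LO Lx.
pose X : Type := dual (C0 oOmega').
pose u n : X := (n.+1%:R^-1 : R[i]) *: dirac_C0 oOmega' (hx n).
have : (fun n => dual_fun (u n)) @ \oo -->
    (dual_fun (0 : dual (C0 oOmega')) :
      {family @tvs_bounded R[i] (C0 oOmega'), C0 oOmega' -> (R[i] : numFieldType)^o}).
  apply/fam_cvgP => B bB P /uniform_nbhs[W [/entourage_normcP[e e0 eW] WP]].
  have [M M0 HM] := tvs_bounded_C0 cL LO bB.
  have : \forall n \near \oo, M / e < n.+1%:R.
    near=> n; rewrite (@lt_le_trans _ _ n%:R)// ?ler_nat//.
    by near: n; exact: nbhs_infty_gtr.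
  apply: filterS => n Hn; apply: WP => g Bg; apply: eW.
  rewrite (_ : dual_fun 0 g = 0)// sub0r normcNE.
  rewrite (_ : dual_fun (u n) g = n.+1%:R^-1 * g (x n))//.
  rewrite normcM normcV normc_nat mulrC ltr_pdivrMr// mulrC -ltr_pdivrMr//.
  by rewrite (le_lt_trans _ Hn)// ler_pM2r ?invr_gt0//; exact: HM.
move=> h A /= [_ [[B oB <-] B0 BA]].
by apply: filterS BA _; apply: h; exact: open_nbhs_nbhs.
Unshelve. all: by end_near. Qed.

(** The images of point masses scaled to 0 would be 1 on suitable elements of
    a bounded set of functions. *)
Lemma support_of_conv :
  conv_in_L (emb_measure oOmega') (emb_distr oOmega) T ->
  distr_supp T `<=` dilation_set Omega' Omega.
Proof.
move=> [N /set_mem[lN cN] HN] eta Teta _ [x Ox <-].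
apply: contrapT => px; set p := hadamard eta x in px.
have /nbhs_ballP[r /= r0 Hr] : nbhs x Omega' by apply: open_nbhs_nbhs.
(* The approximating points must stay in a compact subset of Omega' for the
   scaled point masses to tend to 0. *)
pose K := [set y : Rd | forall i, `|y 0 i - x 0 i| <= r / 2].
have KO : K `<=` Omega'.
  move=> y Ky; apply: Hr; split => // i j; rewrite ord1 -ball_normE /ball_ /= distrC.
  by rewrite (le_lt_trans (Ky j))// ltr_pdivrMr// ltr_pMr// ltr1n.
pose h n : R := r / 2 / n.+1%:R.
have h0 n : 0 < h n by rewrite !divr_gt0.
have hr n : h n <= r / 2.
  by rewrite ler_pdivrMr// ler_peMr ?ler1n// divr_ge0// ltW.
(* Replacing the zero coordinates of x by small nonzero ones makes the
   dilation by x_n invertible. *)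
pose xn n : Rd := \row_i (if x 0 i == 0 then h n else x 0 i).
have xn_neq0 n i : xn n 0 i != 0.
  by rewrite mxE; have [_|//] := eqVneq (x 0 i) 0; rewrite gt_eqF.
have xnB n i : `|xn n 0 i - x 0 i| <= h n.
  rewrite mxE; have [->|_] := eqVneq (x 0 i) 0; last by rewrite subrr normr0 ltW.
  by rewrite subr0 gtr0_norm.
have Kxn n : K (xn n) by move=> i; exact: le_trans (xnB n i) (hr n).
have Oxn n : Omega' (xn n) := KO _ (Kxn n).
have cK : compact K by exact: compact_box.
pose W n := ball eta (n.+1%:R^-1 : R).
(* Normalised to n + 1 so as to compensate for the factor 1 / (n + 1) of the
   scaled point mass. *)
have ex_f n : exists f : Cinf (@openT Rd),
    (forall y, ~ W n y -> (f : Rd -> C) y = 0) /\ T f = n.+1%:R.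
  have [||f f0 Tf] := distr_suppP Teta (W := W n).
  - exact: ball_open.
  - by apply: ballxx; rewrite invr_gt0.
  exists ((n.+1%:R / T f) *: f + 0); split.
    by move=> y /f0 fy; rewrite addr0 /= fctE fy scaler0.
  have -> : T ((n.+1%:R / T f) *: f + 0) = (n.+1%:R / T f) *: T f + T 0.
    exact: dual_lin.
  by rewrite dual0 addr0 /GRing.scale /= divfK.
have [phi Hphi] := choice ex_f.
pose inv n : Rd := \row_i (xn n 0 i)^-1.
pose psi n : Cinf (@openT Rd) := to_Cinf (phi n \o hadamard (inv n)).
have psiE n : (psi n : Rd -> C) = phi n \o hadamard (inv n).
  by apply: to_CinfE; apply: smoothT_hadamard; exact: Cinf_smooth.
have psi_xn n : T (to_Cinf (psi n \o hadamard (xn n))) = n.+1%:R.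
  have <- : phi n = to_Cinf (psi n \o hadamard (xn n)).
    apply: val_inj; rewrite /= to_CinfE; last first.
      by apply: smoothT_hadamard; exact: Cinf_smooth.
    rewrite psiE; apply/funext => y /=; congr (Cinf_fun (phi n) _).
    by apply/rowP => i; rewrite !hadamardE !mxE mulKf//; have := xn_neq0 n i; rewrite mxE.
  by have [_ ->] := Hphi n.
pose B : set (Cinf oOmega) := range (fun n => restrict_Cinf oOmega (psi n)).
(* For large n the function psi_n lives within rho of p = eta x, and points
   that close to p are at distance at least rho from L. *)
have bB : tvs_bounded B.
  apply: bounded_locally_null => L cL LO.
  have [rho rho0 Hrho] := compact_far_from cL (fun Lp : L p => px (LO p Lp)).
  (* If y / x_n is within 1 / (n + 1) of eta, then y is within D / (n + 1) of
     eta x: the two terms of D bound the effect of moving x to x_n and of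
     moving eta to y / x_n. *)
  pose D := `|eta| * (r / 2) + (`|x| + r / 2).
  have : \forall n \near \oo, D / rho < n%:R by exact: nbhs_infty_gtr.
  move=> [n0 _ Hn0]; exists n0 => n nn0 y0 Ly0.
  have Dn : D / n.+1%:R < rho.
    rewrite ltr_pdivrMr// mulrC -ltr_pdivrMr// (lt_le_trans (Hn0 n nn0))//.
    by rewrite ler_nat.
  apply/nbhs_ballP; exists rho => //= y.
  rewrite -ball_normE /ball_ /= => y0y.
  rewrite /patch; case: ifP => // _; rewrite psiE /=.
  have [-> //] := Hphi n; rewrite /W -ball_normE /ball_ /= => Wy.
  suff py : `|p - y| < rho by have := Hrho y0 y Ly0 py; rewrite leNgt y0y.
  apply: norm_lt_coord => // i; rewrite !mxE; apply: le_lt_trans Dn.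
  have xy : `|eta 0 i - (xn n 0 i)^-1 * y 0 i| <= n.+1%:R^-1.
    have := le_lt_trans (coord_le_norm _ i) Wy.
    by rewrite !mxE => /ltW.
  have -> : eta 0 i * x 0 i - y 0 i = eta 0 i * (x 0 i - xn n 0 i) +
      xn n 0 i * (eta 0 i - (xn n 0 i)^-1 * y 0 i).
    by field; exact: xn_neq0.
  rewrite (le_trans (ler_normD _ _))// !normrM mulrDl lerD//.
    rewrite -mulrA ler_pM// ?coord_le_norm// distrC; exact: xnB.
  rewrite ler_pM//.
  rewrite -[xn n 0 i](subrK (x 0 i)) (le_trans (ler_normD _ _))// addrC lerD//.
    exact: coord_le_norm.
  exact: Kxn.
pose w n : dual (Cinf oOmega) := N ((n.+1%:R^-1 : R[i]) *: dirac_C0 oOmega' (Oxn n)).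
have N0 := linear_at0 lN.
have w0 : w n @[n --> \oo] --> (0 : dual (Cinf oOmega)).
  rewrite -N0.
  apply: (@cvg_comp _ _ _ (fun n => (n.+1%:R^-1 : R[i]) *: dirac_C0 oOmega' (Oxn n))
     N _ (nbhs (0 : dual (C0 oOmega')))); last exact: cN.
  exact: cvg0_scaled_dirac cK KO Kxn.
have wpsi n : w n (restrict_Cinf oOmega (psi n)) = 1.
  have -> : w n = (n.+1%:R^-1 : R[i]) *: N (dirac_C0 oOmega' (Oxn n)).
    by rewrite /w -[_ *: dirac_C0 _ _]addr0 lN N0 addr0.
  have -> : ((n.+1%:R^-1 : R[i]) *: N (dirac_C0 oOmega' (Oxn n)))
      (restrict_Cinf oOmega (psi n)) =
      n.+1%:R^-1 * emb_distr oOmega (N (dirac_C0 oOmega' (Oxn n))) (psi n) by [].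
  by rewrite HN mconv_dirac psi_xn mulVf// pnatr_eq0.
have cd : continuous (@dual_fun R[i] (Cinf oOmega) : dual (Cinf oOmega) ->
    {family @tvs_bounded R[i] (Cinf oOmega), Cinf oOmega -> (R[i] : numFieldType)^o}).
  exact: initial_continuous.
have := w0 _ (cd 0 _ (fam_nbhs (dual_fun 0) (entourage_normc ltr01) bB)).
move=> [n0 _ /(_ n0 (leqnn n0))] /=.
move=> /(_ (restrict_Cinf oOmega (psi n0))).
move=> H.
have : normc ((0 : C) - w n0 (restrict_Cinf oOmega (psi n0))) < 1.
  by apply: H; exists n0.
by rewrite wpsi sub0r normcNE normc1 ltxx.
Qed.

End Necessity.

(** * Smooth cutoff functions *)

Section SmoothStep.
Context {R : realType}.
Implicit Types (t : R) (k : nat).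

(** The functions t^(-k) exp(-1/t), extended by 0. Allowing all the powers k
    makes the family stable under derivation up to linear combinations. *)
Definition flat k t : R := if 0 < t then t^-1 ^+ k * expR (- t^-1) else 0.

Lemma flat_gt0 k t : 0 < t -> 0 < flat k t.
Proof. by move=> t0; rewrite /flat t0 mulr_gt0 ?exprn_gt0 ?invr_gt0 ?expR_gt0. Qed.

Lemma flat_le0 k t : t <= 0 -> flat k t = 0.
Proof. by move=> t0; rewrite /flat ltNge t0. Qed.

Lemma flat_ge0 k t : 0 <= flat k t.
Proof. by have [/(flat_le0 k)->//|/(flat_gt0 k)/ltW] := leP t 0. Qed.

(** The exponential series dominates its term of order k + 2, which beats
    t^(-k) by the factor t^2; this gives the derivative 0 at the origin. *)
Lemma flat_bound k t : `|flat k t| <= (k.+2)`!%:R * t ^+ 2.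
Proof.
rewrite ger0_norm ?flat_ge0//; have [t0|t0] := leP t 0.
  by rewrite flat_le0// mulr_ge0 ?sqr_ge0.
have t10 : 0 <= t^-1 by rewrite invr_ge0 ltW.
rewrite /flat t0 expRN exprVn -invfM -[leRHS]invrK lef_pV2 ?posrE; last 2 first.
- by rewrite mulr_gt0 ?exprn_gt0 ?expR_gt0.
- by rewrite invr_gt0 mulr_gt0 ?exprn_gt0.
have := expR_ge1Dxn k.+1 t10.
have le1 (a : R) : a <= 1 + a by rewrite lerDr.
move=> /(le_trans (le1 _)) H.
have tk : 0 < t ^+ k by rewrite exprn_gt0.
apply: le_trans (ler_wpM2l (ltW tk) H).
rewrite exprVn -addn2 exprD le_eqVlt; apply/orP; left; apply/eqP.
have : (k + 2)`!%:R != 0 :> R by rewrite pnatr_eq0 -lt0n fact_gt0.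
move: (_%:R) (t ^+ k) tk => D a a0 D0.
by field; rewrite D0 !gt_eqF.
Qed.

Definition flat' k t : R := - k%:R * flat k.+1 t + flat k.+2 t.

Lemma is_derive_flat k t : is_derive t (1 : R) (flat k) (flat' k t).
Proof.
have [t0|t0|t0] := ltgtP t 0.
- rewrite /flat' !flat_le0 ?(ltW t0)// mulr0 addr0.
  have h : is_derive t (1 : R) (cst (0 : R)) 0 := is_derive_cst (0 : R) t 1.
  apply: near_eq_is_derive h.
  by near=> s; rewrite flat_le0// ltW//; near: s; exact: lt_nbhsl.
- have tn0 : t != 0 by rewrite gt_eqF.
  have h : is_derive t (1 : R) (fun s => s^-1 ^+ k * expR (- s^-1)) (flat' k t).
    have dV : is_derive t (1 : R) (fun s : R => s^-1) (- t^-1 ^+ 2).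
      apply: is_derive_eq (is_deriveV tn0 (is_derive_id t 1)) _.
      by rewrite /GRing.scale /= mulr1 exprVn.
    have dX : is_derive t (1 : R) (fun s : R => s^-1 ^+ k)
        ((k%:R * t^-1 ^+ k.-1) * - t^-1 ^+ 2).
      have := @is_deriveX R R^o (fun s : R => s^-1) k t 1 _ dV.
      by congr is_derive; apply/funext => s; elim: (k) => [|n IH]; rewrite ?expr0// !exprS -IH.
    have dE : is_derive t (1 : R) (expR \o (fun s : R => - s^-1)) (t^-1 ^+ 2 * expR (- t^-1)).
      rewrite -[_ ^+ 2]opprK.
      exact: (@is_derive_comp R R expR (fun s : R => - s^-1) t 1 _ _
        (is_derive_expR (- t^-1)) (is_deriveN dV)).
    apply: is_derive_eq (is_deriveM dX dE) _.
    rewrite /GRing.scale /= /flat' /flat t0.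
    case: (k) => [|k'] /=; rewrite ?expr0 ?mulr0n ?exprS /=; ring.
  apply: near_eq_is_derive h.
  by near=> s; rewrite /flat ifT//; near: s; exact: lt_nbhsr.
- rewrite t0 /flat' !flat_le0// mulr0 addr0.
  apply/is_derive_epsP => e e0; pose D : R := (k.+2)`!%:R.
  have D0 : 0 < D by rewrite ltr0n fact_gt0.
  have eD : 0 < e / D by rewrite divr_gt0.
  near=> s; rewrite [s%:A]mulr1 add0r [flat k 0]flat_le0// mulr0 !subr0.
  rewrite (le_trans (flat_bound k s))// -real_normK ?num_real// expr2 mulrA.
  rewrite ler_wpM2r// -/D mulrC -ler_pdivlMr//.
Unshelve. all: by end_near. Qed.

Definition step_den t : R := flat 0 t + flat 0 (1 - t).

Lemma step_den_gt0 t : 0 < step_den t.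
Proof.
have [t0|t0] := ltP 0 t; first by rewrite ltr_wpDr ?flat_ge0 ?flat_gt0.
by rewrite ltr_wpDl ?flat_ge0// flat_gt0// subr_gt0 (le_lt_trans t0).
Qed.

(** An algebra of functions that contains the quotient defining the smooth
    step and is closed under derivation; only flat t, its reflection flat (1 -
    t) and the inverse of the denominator need to be generators. *)
Inductive step_alg : (R -> R) -> Prop :=
| step_alg_flat k : step_alg (flat k)
| step_alg_flat_rev k : step_alg (fun t => flat k (1 - t))
| step_alg_inv : step_alg (fun t => (step_den t)^-1)
| step_alg_cst c : step_alg (fun=> c)
| step_alg_add f g : step_alg f -> step_alg g -> step_alg (fun t => f t + g t)
| step_alg_mul f g : step_alg f -> step_alg g -> step_alg (fun t => f t * g t).

Lemma step_alg_flat' k : step_alg (flat' k).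
Proof.
exact: (step_alg_add (step_alg_mul (step_alg_cst _) (step_alg_flat k.+1)) (step_alg_flat k.+2)).
Qed.

Lemma step_alg_flat'_rev k : step_alg (fun t => - flat' k (1 - t)).
Proof.
rewrite (_ : (fun _ => _) = fun t => -1 * (- k%:R * flat k.+1 (1 - t) + flat k.+2 (1 - t))).
  exact: (step_alg_mul (step_alg_cst _) (step_alg_add (step_alg_mul (step_alg_cst _)
    (step_alg_flat_rev k.+1)) (step_alg_flat_rev k.+2))).
by apply/funext => t; rewrite mulN1r.
Qed.

Lemma is_derive_flat_rev k t :
  is_derive t (1 : R) (fun t => flat k (1 - t)) (- flat' k (1 - t)).
Proof.
have d1 : is_derive t (1 : R) (fun s : R => 1 - s) (-1).
  by apply: is_derive_eq (is_deriveB (is_derive_cst (1 : R) t 1) (is_derive_id t 1)) _; rewrite sub0r.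
have d2 : is_derive t (1 : R) (flat k \o (fun s : R => 1 - s)) (-1 * flat' k (1 - t)).
  exact: (@is_derive_comp R R (flat k) (fun s : R => 1 - s) t 1 _ _
    (is_derive_flat k (1 - t)) d1).
by rewrite mulN1r in d2.
Qed.

Lemma step_alg_derive f : step_alg f ->
  exists2 f', step_alg f' & forall t, is_derive t (1 : R) f (f' t).
Proof.
elim=> [k|k||c|{}f g sf [f' sf' df] sg [g' sg' dg]|{}f g sf [f' sf' df] sg [g' sg' dg]].
- by exists (flat' k); [exact: step_alg_flat'|exact: is_derive_flat].
- by exists (fun t => - flat' k (1 - t)); [exact: step_alg_flat'_rev|exact: is_derive_flat_rev].
- exists (fun t => (-1 * (flat' 0 t + - flat' 0 (1 - t))) * ((step_den t)^-1 * (step_den t)^-1)).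
    exact: (step_alg_mul (step_alg_mul (step_alg_cst _) (step_alg_add (step_alg_flat' 0)
       (step_alg_flat'_rev 0))) (step_alg_mul step_alg_inv step_alg_inv)).
  move=> t; have dd := is_deriveD (is_derive_flat 0 t) (is_derive_flat_rev 0 t).
  have n0 : step_den t != 0 by rewrite gt_eqF ?step_den_gt0.
  apply: is_derive_eq (is_deriveV n0 dd) _.
  by rewrite /GRing.scale /= -exprVn expr2 mulN1r mulrC mulrN mulNr.
- by exists (fun=> 0) => [|t]; [exact: step_alg_cst|exact: is_derive_cst].
- by exists (fun t => f' t + g' t) => [|t]; [exact: step_alg_add|exact: is_deriveD].
- exists (fun t => f t * g' t + g t * f' t) => [|t]; last exact: is_deriveM.
  exact: (step_alg_add (step_alg_mul sf sg') (step_alg_mul sg sf')).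
Qed.

Lemma step_alg_continuous f : step_alg f -> continuous f.
Proof.
move=> /step_alg_derive[f' _ df] t; apply: differentiable_continuous.
by apply/derivable1_diffP; have [] := df t.
Qed.

Definition smooth_step t : R := flat 0 t * (step_den t)^-1.

Lemma step_alg_smooth_step : step_alg smooth_step.
Proof. exact: (step_alg_mul (step_alg_flat 0) step_alg_inv). Qed.

Lemma smooth_step_le0 t : t <= 0 -> smooth_step t = 0.
Proof. by move=> t0; rewrite /smooth_step flat_le0// mul0r. Qed.

Lemma smooth_step_ge1 t : 1 <= t -> smooth_step t = 1.
Proof.
move=> t1; have d0 := step_den_gt0 t; rewrite /smooth_step /step_den in d0 *.
by rewrite [flat 0 (1 - t)]flat_le0 ?subr_le0// addr0 in d0 *; rewrite mulfV// gt_eqF.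
Qed.

End SmoothStep.

Section Plateau.
Context {R : realType} {d : nat}.
Local Notation Rd := 'rV[R]_d.
Local Notation C := (R[i]^o).

(** A bump on the box of radius r around c. The square inside the step makes
    the argument a smooth function of x: it is at least 1 for |x_i - c_i| <=
    r, and at most 0 for |x_i - c_i| >= 2 r, as 2 - 2^2 < 0. *)
Definition plateau (c : Rd) (r : R) (x : Rd) : C :=
  \prod_(i < d) (smooth_step (2 - ((x 0 i - c 0 i) / r) ^+ 2))%:C%C.

Lemma smooth_plateau c r : smooth_on setT (plateau c r).
Proof.
apply: (@smooth_prod _ _ setT _ _ _ openT) => i.
apply: (@smooth_comp _ _ step_alg (fun x : Rd => 2 - ((x 0 i - c 0 i) / r) ^+ 2) _ _ openT).
- exact: step_alg_continuous.
- exact: step_alg_derive.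
- have sa : smooth_on setT (fun x : Rd => ((x 0 i)%:C%C + (- c 0 i)%:C%C) * (r^-1)%:C%C : C).
    apply: smoothM (smooth_cst _ _) => //; try exact: openT.
    by apply: smoothD (smooth_cst _ _); try exact: openT; exact: smooth_coord openT.
  have := smoothD openT (smooth_cst (2%:C%C : C) openT)
    (smoothM openT (smooth_cst ((-1)%:C%C : C) openT) (smoothM openT sa sa)).
  congr smooth_on; apply/funext => x.
  by rewrite -!(rmorphM, rmorphD) /= mulN1r expr2.
- exact: step_alg_smooth_step.
Qed.

Lemma plateau1 (c : Rd) (r : R) (x : Rd) : 0 < r -> (forall i, `|x 0 i - c 0 i| <= r) -> plateau c r x = 1.
Proof.
move=> r0 h; rewrite /plateau big1// => i _; rewrite smooth_step_ge1//.
rewrite lerBrDr -lerBrDl (_ : 2 - 1 = 1 :> R); last by ring.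
by rewrite -real_normK ?num_real// exprn_ile1// normrM normfV (gtr0_norm r0) ler_pdivrMr// mul1r.
Qed.

Lemma plateau0 (c : Rd) (r : R) (x : Rd) : 0 < r -> ~ (forall i, `|x 0 i - c 0 i| <= 2 * r) ->
  plateau c r x = 0.
Proof.
move=> r0 /existsNP[i /negP]; rewrite -ltNge => h.
rewrite /plateau (bigD1 i)//= smooth_step_le0 ?mul0r// subr_le0.
rewrite -[leRHS]real_normK ?num_real// normrM normfV (gtr0_norm r0).
apply: (@le_trans _ _ (2 ^+ 2)); first by rewrite -natrX ler_nat.
by rewrite lerXn2r ?nnegrE// ?divr_ge0// ?(ltW r0)// ler_pdivlMr// ltW.
Qed.

Lemma ball_coord (c x : Rd) (r : R) : ball c r x -> forall i, `|x 0 i - c 0 i| <= r.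
Proof.
rewrite -ball_normE /ball_ /= => cx i; have := le_lt_trans (coord_le_norm (c - x) i) cx.
by rewrite !mxE distrC => /ltW.
Qed.

Lemma box_ball (c x : Rd) (r s : R) : 0 < s -> r < s -> (forall i, `|x 0 i - c 0 i| <= r) -> ball c s x.
Proof.
move=> s0 rs h; rewrite -ball_normE /ball_ /= distrC; apply: norm_lt_coord => // i.
by rewrite !mxE (le_lt_trans (h i)).
Qed.

End Plateau.

Section Cutoff.
Context {R : realType} {d : nat}.
Local Notation Rd := 'rV[R]_d.
Local Notation C := (R[i]^o).

Lemma compact_ball_cover (K : set Rd) (r : Rd -> R) : compact K ->
  (forall x, K x -> 0 < r x) ->
  exists cs : seq Rd, (forall c, c \in cs -> K c) /\
    (forall x, K x -> exists2 c, c \in cs & ball c (r c) x).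
Proof.
move=> cK r0.
have : cover_compact K by rewrite -compact_cover.
move=> /(_ _ K (fun c => ball c (r c))) [].
- by move=> c Kc; exact: ball_open.
- by move=> x Kx; exists x => //; apply: ballxx; exact: r0.
move=> D DK KD; exists (finmap.enum_fset D); split=> [c cD|x /KD[c cD cx]].
  by apply: set_mem; exact: DK.
by exists c.
Qed.

Lemma open_box (O : set Rd) (x : Rd) : open O -> O x ->
  exists2 r : R, 0 < r & [set y : Rd | forall i, `|y 0 i - x 0 i| <= 2 * r] `<=` O.
Proof.
move=> oO Ox; have /nbhs_ballP[e /= e0 He] : nbhs x O by apply: open_nbhs_nbhs.
exists (e / 3) => [|y Hy]; first by rewrite divr_gt0.
by apply: He; apply: box_ball Hy => //; lra.
Qed.

Lemma smooth_onem (f : Rd -> C) : smooth_on setT f ->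
  smooth_on setT (fun x => 1 + (-1) * f x).
Proof.
by move=> sf; exact: (smoothD openT (smooth_cst 1 openT) (smoothM openT (smooth_cst (-1) openT) sf)).
Qed.

(** Finitely many plateaus cover K; one minus the product of their complements
    is 1 where some plateau is 1, and 0 where all of them are 0. *)
Lemma cutoff (K O : set Rd) : compact K -> open O -> K `<=` O ->
  exists chi : Rd -> C, [/\ smooth_on setT chi,
    exists2 L : set Rd, compact L /\ L `<=` O & forall x, ~ L x -> chi x = 0 &
    exists2 O' : set Rd, open O' /\ K `<=` O' & forall x, O' x -> chi x = 1].
Proof.
move=> cK oO KO.
(* The radius at x is chosen so that the support of the plateau around x,
   which has twice this radius, stays in O. *)
have ex_r (x : Rd) : exists r : R, K x -> 0 < r /\
    [set y : Rd | forall i, `|y 0 i - x 0 i| <= 2 * r] `<=` O.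
  have [Kx|nK] := pselect (K x); last by exists 1.
  by have [r r0 rO] := open_box oO (KO x Kx); exists r.
have [r Hr] := choice ex_r.
have [cs [csK Kcs]] := compact_ball_cover cK (fun x Kx => (Hr x Kx).1).
pose h (s : seq Rd) x : C := \prod_(c <- s) (1 + (-1) * plateau c (r c) x).
exists (fun x => 1 + (-1) * h cs x); split.
- apply: smooth_onem; apply: (@smooth_prod _ _ setT _ _ _ openT) => c.
  exact/smooth_onem/smooth_plateau.
- exists (\big[setU/set0]_(c <- cs | c \in cs)
      [set y : Rd | forall i, `|y 0 i - c 0 i| <= 2 * r c]).
    split; first by apply: bigsetU_compact => c _; exact: compact_box.
    rewrite -bigcup_seq_cond => x [c /= /andP[_ cc] cx].
    by have [_] := Hr c (csK c cc); apply.
  move=> x Lx; suff -> : h cs x = 1 by rewrite mulr1 subrr.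
  rewrite /h big_seq; apply: big1 => c cc; rewrite plateau0 ?mulr0 ?addr0//.
    by have [] := Hr c (csK c cc).
  move=> cx; apply: Lx; rewrite -bigcup_seq_cond; exists c => //=; by rewrite cc.
- exists (\bigcup_(c in [set c | c \in cs]) ball c (r c)).
    split; last by move=> x /Kcs[c cc cx]; exists c.
    by apply: bigcup_open => c _; exact: ball_open.
  move=> x [c /= cc cx]; suff -> : h cs x = 0 by rewrite mulr0 addr0.
  rewrite /h (big_rem c)//= plateau1 ?mulr1 ?subrr ?mul0r//.
    by have [] := Hr c (csK c cc).
  exact: ball_coord.
Qed.

(** * Compactness and locality of the support of a distribution *)

Section Support.
Variable T : dual (Cinf (@openT Rd)).

(** A continuous functional is controlled by derivatives on some compact set
    K, and these are zero when the function vanishes near K. *)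
Lemma vanish_seminorm : exists2 K : set Rd, compact K &
  forall g : Cinf (@openT Rd),
    (forall x, K x -> \forall y \near x, (g : Rd -> C) y = 0) -> T g = 0.
Proof.
have [ws [K [M [cK _ M0 HM]]]] := dual_seminorm_bound T.
exists K => // g Hg; apply: eq0_normc; apply/eqP.
rewrite eq_le normc_ge0 andbT -[leRHS](mulr0 M).
apply: HM => // s t sw Kt.
have z0 := iter_partial0 (@openT Rd) s (I : setT t).
by rewrite (@iter_partial_near _ _ g (0 : Cinf (@openT Rd)))// ?z0 ?normc0//; exact: Hg.
Qed.

Lemma closed_distr_supp : closed (distr_supp T).
Proof. by apply: open_closedC; apply: bigcup_open => W []. Qed.

Lemma compact_distr_supp : compact (distr_supp T).
Proof.
have [K cK HK] := vanish_seminorm.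
apply: (subclosed_compact closed_distr_supp cK) => x sx.
apply: contrapT => Kx; apply: sx; exists (~` K) => //; split.
  by apply: closed_openC; apply: compact_closed => //; exact: norm_hausdorff.
move=> f _ fK; apply: HK => y Ky.
have : nbhs y (~` tsupport f).
  apply: open_nbhs_nbhs; split; first by apply: closed_openC; exact: closed_closure.
  by move=> /fK; apply.
apply: filterS => z fz; apply/eqP; apply: contrapT => /negP nz.
by apply: fz; exact: subset_closure.
Qed.

Lemma to_Cinf_lin (a : C) (f g : Rd -> C) : smooth_on setT f -> smooth_on setT g ->
  T (to_Cinf (fun x => a * f x + g x)) = a * T (to_Cinf f) + T (to_Cinf g).
Proof.
move=> sf sg.
have sfg := smoothD openT (smoothM openT (smooth_cst a openT) sf) sg.
have -> : to_Cinf (fun x => a * f x + g x) = a *: to_Cinf f + to_Cinf g.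
  apply: val_inj; apply: etrans (to_CinfE sfg) _.
  apply/funext => x.
  have -> : \val (a *: to_Cinf f + to_Cinf g) x =
    a * (to_Cinf f : Rd -> C) x + (to_Cinf g : Rd -> C) x by [].
  by rewrite (to_CinfE sf) (to_CinfE sg).
exact: dual_lin.
Qed.

Lemma to_CinfB (f g : Rd -> C) : smooth_on setT f -> smooth_on setT g ->
  T (to_Cinf (fun x => f x + (-1) * g x)) = T (to_Cinf f) - T (to_Cinf g).
Proof.
move=> sf sg; have := to_Cinf_lin (-1) sg sf; rewrite mulN1r [RHS]addrC => <-.
by congr (dual_fun T (to_Cinf _)); apply/funext => x; rewrite addrC.
Qed.

(** The definition of the support only concerns test functions supported in
    one open set on which T vanishes. A partition-of-unity argument globalises
    it: a compact K that controls T is covered by finitely many balls, on each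
    of which either g vanishes or T does. Multiplying g by the complement of a
    plateau on a ball of the second kind does not change T g, since the part
    cut off is supported where T vanishes. After all the multiplications the
    function vanishes near K. *)
Lemma dual_local (g : Cinf (@openT Rd)) :
  (forall x, distr_supp T x -> \forall y \near x, (g : Rd -> C) y = 0) -> T g = 0.
Proof.
move=> Hg; have [K cK HK] := vanish_seminorm.
(* The radius at x is chosen according to which case holds: g vanishes near x,
   or x is outside the support. *)
pose good (x : Rd) (r : R) := 0 < r /\
  ((forall y, ball x r y -> (g : Rd -> C) y = 0) \/
   exists W : set Rd, [/\ open W, vanishes_on T W &
     [set y : Rd | forall i, `|y 0 i - x 0 i| <= 2 * r] `<=` W]).
have ex_r (x : Rd) : exists r : R, good x r.
  have [sx|] := pselect (distr_supp T x).
    have /nbhs_ballP[r /= r0 Hr] := Hg x sx.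
    by exists r; split => //; left.
  move=> /contrapT[W [oW vW] Wx].
  by have [r r0 rO] := open_box oW Wx; exists r; split => //; right; exists W.
have [r Hr] := choice ex_r.
have [cs [_ Kcs]] := compact_ball_cover cK (fun x _ => (Hr x).1).
have main (s : seq Rd) : exists h : Rd -> C, [/\ smooth_on setT h,
    T (to_Cinf (fun x => g x * h x)) = T g &
    forall c x, c \in s -> ball c (r c) x -> g x * h x = 0].
  elim: s => [|c s [h [sh Th gh]]].
    exists (fun=> 1); split => //; first exact: smooth_cst openT.
    congr (dual_fun T _); apply: val_inj; rewrite /= to_CinfE.
      by apply/funext => x; rewrite mulr1.
    exact: (smoothM openT (Cinf_smooth g) (smooth_cst 1 openT)).
  have [rc [gc|[W [oW vW Wc]]]] := Hr c.
    exists h; split => // c' x; rewrite inE => /orP[/eqP ->|cs'] cx; last exact: (gh c').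
    by rewrite gc ?mul0r.
  have sp := smooth_plateau c (r c).
  exists (fun x => h x * (1 + (-1) * plateau c (r c) x)); split.
  - exact: (smoothM openT sh (smooth_onem sp)).
  - rewrite -Th (_ : (fun x => g x * _) = fun x => g x * h x + (-1) * (g x * h x * plateau c (r c) x)).
      have sgh := smoothM openT (Cinf_smooth g) sh.
      have sghp := smoothM openT sgh sp.
      pose F := [set y : Rd | forall i, `|y 0 i - c 0 i| <= 2 * r c].
      have cF : compact F by exact: compact_box.
      have sF : tsupport (to_Cinf (fun x => g x * h x * plateau c (r c) x)) `<=` F.
        rewrite [X in _ `<=` X](closure_id F).1; last first.
          by apply: compact_closed => //; exact: norm_hausdorff.
        apply: closureS => x; rewrite to_CinfE//= => /eqP nz.
        by apply: contrapT => Fx; apply: nz; rewrite plateau0 ?mulr0.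
      rewrite to_CinfB// (vW (to_Cinf (fun x => g x * h x * plateau c (r c) x))) ?subr0//.
        by apply: subclosed_compact cF sF; exact: closed_closure.
      exact: subset_trans sF Wc.
    by apply/funext => x; ring.
  - move=> c' x; rewrite inE => /orP[/eqP ->|cs'] cx.
      by rewrite plateau1 ?mulr1 ?subrr ?mulr0//; exact: ball_coord.
    by rewrite mulrA (gh c')// mul0r.
have [h [sh <- gh]] := main cs.
apply: HK => x Kx; rewrite to_CinfE; last exact: (smoothM openT (Cinf_smooth g) sh).
have [c cc cx] := Kcs x Kx.
have : nbhs x (ball c (r c)) by apply: open_nbhs_nbhs; split => //; exact: ball_open.
by apply: filterS => y; exact: gh.
Qed.

End Support.

End Cutoff.

(** * Symmetry of partial derivatives *)

Section Schwarz.
Context {R : realType} {d : nat}.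
Local Notation Rd := 'rV[R]_d.
Local Notation C := (R[i]^o).
Local Notation e_ i := (delta_mx 0 i : Rd).

Lemma norm_delta (i : 'I_d) (t : R) : `|t *: e_ i| <= `|t|.
Proof.
rewrite normrZ -[leRHS]mulr1 ler_wpM2l// [leLHS]mx_normrE.
apply/bigmax_leP; split => // -[a b] _ /=.
by rewrite mxE ger0_norm ?ler0n// lern1 leq_b1.
Qed.

Lemma cont_at_ball (g : Rd -> C) x (e : R) : cont_at g x -> 0 < e ->
  exists2 del : R, 0 < del & forall v, `|v| <= del -> normc (g (x + v) - g x) <= e.
Proof.
move=> cg e0; have /nbhs_ballP[r /= r0 Hr] := cg e e0.
exists (r / 2) => [|v vr]; first by rewrite divr_gt0.
rewrite normcB; apply: ltW; apply: Hr; rewrite -ball_normE /ball_ /=.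
by rewrite opprD addNKr normrN (le_lt_trans vr)// ltr_pdivrMr// ltr_pMr// ltr1n.
Qed.

(** The second difference of f is the increment along e_i of z |-> f(z + t
    e_j) - f(z); two applications of the mean value bound compare it with t^2
    times the mixed derivative. The left-hand side is symmetric in i and j up
    to the order of the two differences. *)
Lemma second_difference (f : Rd -> C) (i j : 'I_d) x (e : R) : smooth_on setT f -> 0 < e ->
  exists2 del : R, 0 < del & forall t : R, `|t| <= del ->
    normc (f (x + t *: e_ i + t *: e_ j) - f (x + t *: e_ i) - (f (x + t *: e_ j) - f x)
           - t%:C%C * (t%:C%C * cpartial j (cpartial i f) x)) <= e * `|t| ^+ 2.
Proof.
move=> sf e0; set l := cpartial j _ x.
have e4 : 0 < e / 4 by rewrite divr_gt0.
have [del del0 Hdel] := cont_at_ball (smooth_cont_at [:: j; i] openT sf (I : setT x)) e4.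
exists (del / 2) => [|t tdel]; first by rewrite divr_gt0.
pose g z := f (z + t *: e_ j) + (-1) * f z.
pose g' z := cpartial i f (z + t *: e_ j) + (-1) * cpartial i f z.
have dg z : has_partial g z i (g' z).
  apply: has_partialD.
    have := smooth_has_partial [::] i sf (I : setT (z + t *: e_ j)).
    move=> /has_partial_eps H; apply: eps_has_partial => r r0; apply: filterS (H r r0) => s.
    by rewrite [z + s *: _ + _]addrAC.
  rewrite -[(-1) * cpartial i f z]add0r -[X in X + _](mul0r (f z)).
  apply: has_partialM; first exact: has_partial_cst.
  exact: (smooth_has_partial [::] i sf (I : setT z)).
have g'B s : `|s| <= `|t| ->
    normc (g' (x + s *: e_ i) - t%:C%C * l) <= 2 * (e / 4) * `|t|.
  move=> st; rewrite /g' mulN1r.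
  apply: (mean_value_bound (f' := cpartial j (cpartial i f))) => r rt.
    exact: (smooth_has_partial [:: i] j sf I).
  rewrite -addrA; apply: Hdel; rewrite (le_trans (ler_normD _ _))//.
  rewrite (splitr del) lerD// (le_trans (norm_delta _ _))// (le_trans _ tdel)//.
have := mean_value_bound (fun s _ => dg (x + s *: e_ i)) g'B.
rewrite /g !mulN1r => H.
have -> : e * `|t| ^+ 2 = 2 * (2 * (e / 4) * `|t|) * `|t| by field.
by apply: le_trans H.
Qed.

(** Both mixed derivatives approximate the same second difference. *)
Lemma partial_comm (f : Rd -> C) (i j : 'I_d) : smooth_on setT f ->
  cpartial i (cpartial j f) = cpartial j (cpartial i f).
Proof.
move=> sf; apply/funext => x; apply/eqP; rewrite -subr_eq0; apply/eqP/eq0_normc.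
apply/eqP; rewrite eq_le normc_ge0 andbT; apply/ler_addgt0Pr => e e0; rewrite add0r.
have e2 : 0 < e / 2 by rewrite divr_gt0.
have [d1 d10 H1] := second_difference i j x sf e2.
have [d2 d20 H2] := second_difference j i x sf e2.
set l1 := cpartial j _ x in H1 *; set l2 := cpartial i _ x in H2 *.
pose t := Num.min d1 d2; have t0 : 0 < t by rewrite lt_min d10.
have t1 : `|t| <= d1 by rewrite gtr0_norm// ge_min lexx.
have t2 : `|t| <= d2 by rewrite gtr0_norm// ge_min lexx orbT.
have tt : 0 < `|t| ^+ 2 by rewrite exprn_gt0// normr_gt0 gt_eqF.
rewrite -(ler_pM2r tt) {1}[e]splitr mulrDl.
apply: le_trans (lerD (H1 t t1) (H2 t t2)).
have tri (a b u v w : C) : u = w - a -> v = w - b -> normc (b - a) <= normc u + normc v.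
  move=> -> ->; rewrite (_ : b - a = (w - a) + - (w - b)); last by ring.
  by rewrite -(normcNE (w - b)); exact: normcD.
have -> : normc (l2 - l1) * `|t| ^+ 2 = normc (t%:C%C * (t%:C%C * l2) - t%:C%C * (t%:C%C * l1)).
  by rewrite -!mulrBr !normcM normc_realE expr2 mulrC mulrA.
apply: (tri _ _ _ _ (f (x + t *: e_ i + t *: e_ j) - f (x + t *: e_ i) - (f (x + t *: e_ j) - f x))) => //.
by rewrite (addrAC x); congr (_ - _); ring.
Qed.

Lemma partial_iter (f : Rd -> C) (i : 'I_d) (s : seq 'I_d) : smooth_on setT f ->
  cpartial i (iter_partial s f) = iter_partial s (cpartial i f).
Proof.
move=> sf; elim: s => //= j s IH.
by rewrite (partial_comm i j (smooth_iter_partial s sf)) IH.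
Qed.

(** Iterated derivatives are indexed by sequences; by symmetry only the
    multiplicities matter, so that the derivatives in one variable can be
    moved to the front. *)
Lemma iter_partial_perm (f : Rd -> C) (s t : seq 'I_d) : smooth_on setT f ->
  perm_eq s t -> iter_partial s f = iter_partial t f.
Proof.
move=> sf; elim: s t => [|i s IH] t st; first by move: st; rewrite perm_sym => /perm_nilP ->.
have it : i \in t by rewrite -(perm_mem st) inE eqxx.
have [t1 [t2 tE]] : exists t1 t2, t = t1 ++ i :: t2.
  by case/splitPr: it => p1 p2; exists p1, p2.
subst t.
have st' : perm_eq s (t1 ++ t2).
  by rewrite -(perm_cons i) (perm_trans st)// -[_ :: t2]cat1s -[i :: _]cat1s perm_catCA.
rewrite -[LHS]/(cpartial i (iter_partial s f)) (IH _ st').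
rewrite -!iter_partial_cat (partial_iter i t1 (smooth_iter_partial t2 sf)).
by [].
Qed.

End Schwarz.

(** * A distribution applied to one of two variables *)

Section Slices.
Context {R : realType} {d : nat}.
Local Notation Rd := 'rV[R]_d.
Local Notation R2d := 'rV[R]_(d + d).
Local Notation C := (R[i]^o).

Lemma row_mx_cvg (T : Type) (F : set_system T) (FF : Filter F) (f g : T -> Rd) (a b : Rd) :
  f @ F --> a -> g @ F --> b -> row_mx (f x) (g x) @[x --> F] --> (row_mx a b : R2d).
Proof.
move=> fa gb; apply: cvg_rV => i.
case: (split_ordP i) => j ->.
  rewrite row_mxEl (_ : (fun x => _) = (fun x => f x 0 j)); last first.
    by apply/funext => x; rewrite row_mxEl.
  apply: (@cvg_comp _ _ _ f (fun y : Rd => y 0 j) _ (nbhs a)) => //.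
  exact: (@coord_continuous R 1 d 0 j a).
rewrite row_mxEr (_ : (fun x => _) = (fun x => g x 0 j)); last first.
  by apply/funext => x; rewrite row_mxEr.
apply: (@cvg_comp _ _ _ g (fun y : Rd => y 0 j) _ (nbhs b)) => //.
exact: (@coord_continuous R 1 d 0 j b).
Qed.

Lemma row_mx_stepl (x y : Rd) i t :
  row_mx (x + t *: delta_mx 0 i) y =
  row_mx x y + (t * 1) *: (delta_mx 0 (lshift d i) : R2d).
Proof.
apply/rowP => k; case: (split_ordP k) => j ->.
  by rewrite [LHS]row_mxEl [RHS]mxE row_mxEl !mxE eq_lshift mulr1.
by rewrite [LHS]row_mxEr [RHS]mxE row_mxEr !mxE eq_rlshift mulr0 addr0.
Qed.

Lemma row_mx_stepr (x y : Rd) i t :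
  row_mx x (y + t *: delta_mx 0 i) =
  row_mx x y + (t * 1) *: (delta_mx 0 (rshift d i) : R2d).
Proof.
apply/rowP => k; case: (split_ordP k) => j ->.
  by rewrite [LHS]row_mxEl [RHS]mxE row_mxEl !mxE eq_lrshift mulr0 addr0.
by rewrite [LHS]row_mxEr [RHS]mxE row_mxEr !mxE eq_rshift mulr1.
Qed.

Variable F : R2d -> C.
Hypothesis sF : smooth_on setT F.

Definition slice (y : Rd) : Rd -> C := fun eta => F (row_mx eta y).

Lemma row_mx_continuousl (y : Rd) : continuous (fun eta : Rd => row_mx eta y : R2d).
Proof. by move=> z; apply: (@row_mx_cvg _ (nbhs z)) => //; exact: cvg_cst. Qed.

Lemma smooth_slice (y : Rd) : smooth_on setT (slice y).
Proof.
rewrite (_ : slice y = fun z => 1 * F (row_mx z y)); last first.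
  by apply/funext => z; rewrite mul1r.
apply: (smooth_subst openT openT (k := fun i => lshift d i) (q := fun _ _ => 1)) => //.
- by move=> z i t; exact: row_mx_stepl.
- by move=> i; exact: smooth_cst openT.
- by move=> z _; exact: row_mx_continuousl.
- exact: smooth_cst openT.
Qed.
End Slices.

Section PartialApply.
Context {R : realType} {d : nat}.
Local Notation Rd := 'rV[R]_d.
Local Notation R2d := 'rV[R]_(d + d).
Local Notation C := (R[i]^o).
Implicit Types F : R2d -> C.

Lemma slice_partial F (y : Rd) (s : seq 'I_d) : smooth_on setT F ->
  iter_partial s (slice F y) = slice (iter_partial (map (lshift d) s) F) y.
Proof.
move=> sF; elim: s => //= i s ->; apply/funext => eta.
apply: has_partial_cpartial.
have h := smooth_has_partial (map (lshift d) s) (lshift d i) sF (I : setT (row_mx eta y)).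
have := @has_partial_subst R d (d + d) (fun z => row_mx z y) (lshift d) (fun _ _ => 1)
  (fun z i t => row_mx_stepl z y i t) _ eta i _ h.
by rewrite mul1r.
Qed.

Lemma uniform_slice (g : R2d -> C) (K : set Rd) (y0 : Rd) (e : R) : compact K -> 0 < e ->
  (forall z, cont_at g z) ->
  \forall y \near y0, forall eta, K eta -> normc (g (row_mx eta y) - g (row_mx eta y0)) <= e.
Proof.
move=> /compact_near_coveringP cK e0 cg.
have e2 : 0 < e / 2 by rewrite divr_gt0.
have := cK Rd (nbhs y0) (fun y eta => normc (g (row_mx eta y) - g (row_mx eta y0)) <= e)
  (nbhs_filter y0).
apply=> eta Keta.
have h1 : \forall p \near nbhs (eta, y0),
    normc (g (row_mx eta y0) - g (row_mx p.1 p.2)) < e / 2.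
  have cc : (row_mx p.1 p.2 : R2d) @[p --> (eta, y0)] --> (row_mx eta y0 : R2d).
    by apply: (@row_mx_cvg _ _ _ (nbhs (eta, y0))); [exact: cvg_fst|exact: cvg_snd].
  exact: (cc _ (cg (row_mx eta y0) _ e2)).
have h2 : \forall p \near nbhs (eta, y0),
    normc (g (row_mx eta y0) - g (row_mx p.1 y0)) < e / 2.
  have cc : (row_mx p.1 y0 : R2d) @[p --> (eta, y0)] --> (row_mx eta y0 : R2d).
    by apply: (@row_mx_cvg _ _ _ (nbhs (eta, y0))); [exact: cvg_fst|exact: cvg_cst].
  exact: (cc _ (cg (row_mx eta y0) _ e2)).
apply: filterS2 h1 h2 => -[eta' y] /= H1 H2.
rewrite (le_trans (normc_dist _ (g (row_mx eta y0)) _))// (splitr e) lerD ?(ltW H2)//.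
by rewrite normcB ltW.
Qed.

Variable T : dual (Cinf (@openT Rd)).

(** T applied to F(eta, y) as a function of eta, where pairs (eta, y) are row
    vectors of length d + d. *)
Definition partial_apply F (y : Rd) : C := T (to_Cinf (slice F y)).

Lemma iter_partial_comb (a : C) (s : seq 'I_d) (f g : Rd -> C) :
  smooth_on setT f -> smooth_on setT g ->
  iter_partial s (fun x => a * f x + g x) = fun x => a * iter_partial s f x + iter_partial s g x.
Proof.
move=> sf sg; apply/funext => x.
exact: (iter_partial_lin openT a s sf sg (mem_set (I : setT x))).
Qed.

(** The seminorm bound for T, phrased for plain smooth functions so that it
    applies to difference quotients under T. *)
Lemma dual_bound : exists (ws : seq (seq 'I_d)) (K : set Rd) (M : R),
  [/\ compact K, 0 < M & forall (g : Rd -> C) (e : R), smooth_on setT g -> 0 <= e ->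
    (forall s t, s \in ws -> K t -> normc (iter_partial s g t) <= e) ->
    normc (T (to_Cinf g)) <= M * e].
Proof.
have [ws [K [M [cK _ M0 HM]]]] := dual_seminorm_bound T.
by exists ws, K, M; split => // g e sg e0 Hg; apply: HM => // s t; rewrite to_CinfE//; exact: Hg.
Qed.

(** By compactness finitely many derivatives of F(eta, y) in eta converge
    uniformly for eta in K as y tends to y0, so the continuity of T applies. *)
Lemma cont_at_partial_apply F y0 : smooth_on setT F -> cont_at (partial_apply F) y0.
Proof.
move=> sF e e0; have [ws [K [M [cK M0 HM]]]] := dual_bound.
pose r := e / 2 / M; have r0 : 0 < r by rewrite !divr_gt0.
have : \forall y \near y0, forall s eta, s \in ws -> K eta ->
    normc (iter_partial (map (lshift d) s) F (row_mx eta y) -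
           iter_partial (map (lshift d) s) F (row_mx eta y0)) <= r.
  elim: (ws) => [|w l IH]; first by apply: filterE => y s eta; rewrite in_nil.
  have h := uniform_slice y0 cK r0 (fun z => smooth_cont_at (map (lshift d) w) openT sF (I : setT z)).
  apply: filterS2 h IH => y hy IHy s eta; rewrite inE => /orP[/eqP ->|]; first exact: hy.
  exact: IHy.
apply: filterS => y Hy; rewrite /partial_apply normcB.
have sy := smooth_slice sF y; have sy0 := smooth_slice sF y0.
have -> : T (to_Cinf (slice F y)) - T (to_Cinf (slice F y0)) =
   T (to_Cinf (fun x => (-1) * slice F y0 x + slice F y x)).
  by rewrite (to_Cinf_lin T (-1) sy0 sy) mulN1r addrC.
apply: (@le_lt_trans _ _ (M * r)); last first.
  by rewrite /r mulrC divfK ?gt_eqF// gtr_pMr// invf_lt1// ltr1n.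
apply: HM (ltW r0) _.
  exact: (smoothD openT (smoothM openT (smooth_cst (-1) openT) sy0) sy).
move=> s t sws Kt.
rewrite (iter_partial_comb (-1) s sy0 sy) !slice_partial// mulN1r addrC.
exact: Hy.
Qed.

(** Differentiation under T: the first-order remainder of F in y is small,
    together with its derivatives in eta, uniformly on a compact set. Applied
    to the eta-derivatives of F, the mean value bound reduces this to the
    uniform continuity of one further derivative; this exchange of eta- and
    y-derivatives uses their symmetry. *)
Lemma has_partial_partial_apply F y0 i : smooth_on setT F ->
  has_partial (partial_apply F) y0 i (partial_apply (cpartial (rshift d i) F) y0).
Proof.
move=> sF; have [ws [K [M [cK M0 HM]]]] := dual_bound.
apply: eps_has_partial => e e0.
pose r := e / 2 / M; have r0 : 0 < r by rewrite !divr_gt0.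
have : \forall y \near y0, forall s eta, s \in ws -> K eta ->
    normc (iter_partial (rshift d i :: map (lshift d) s) F (row_mx eta y) -
           iter_partial (rshift d i :: map (lshift d) s) F (row_mx eta y0)) <= r.
  elim: (ws) => [|w l IH]; first by apply: filterE => y s eta; rewrite in_nil.
  have h := uniform_slice y0 cK r0 (fun z =>
    smooth_cont_at (rshift d i :: map (lshift d) w) openT sF (I : setT z)).
  apply: filterS2 h IH => y hy IHy s eta; rewrite inE => /orP[/eqP ->|]; first exact: hy.
  exact: IHy.
move=> /nbhs_ballP[del del0 Hdel].
have {}del0 : 0 < del := del0.
near=> t.
have td : `|t| < del by [].
have sy := smooth_slice sF (y0 + t *: delta_mx 0 i); have sy0 := smooth_slice sF y0.
have sy1 := smooth_slice (smooth_partial (rshift d i) sF) y0.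
have s01 := smoothD openT (smoothM openT (smooth_cst (-1) openT) sy0) sy.
have -> : partial_apply F (y0 + t *: delta_mx 0 i) - partial_apply F y0 -
    t%:C%C * partial_apply (cpartial (rshift d i) F) y0 =
    T (to_Cinf (fun x => (- t%:C%C) * slice (cpartial (rshift d i) F) y0 x +
      ((-1) * slice F y0 x + slice F (y0 + t *: delta_mx 0 i) x))).
  rewrite (to_Cinf_lin T (- t%:C%C) sy1 s01) (to_Cinf_lin T (-1) sy0 sy) mulN1r mulNr.
  by rewrite [RHS]addrC; congr (_ - _); rewrite addrC.
have -> : e * `|t| = M * (2 * r * `|t|) by rewrite /r; field; rewrite gt_eqF.
apply: HM.
- exact: (smoothD openT (smoothM openT (smooth_cst _ openT) sy1) s01).
- by rewrite mulr_ge0// mulr_ge0// ltW.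
move=> s eta sws Keta.
rewrite (iter_partial_comb _ s sy1 s01) (iter_partial_comb (-1) s sy0 sy) !slice_partial//; last first.
  exact: smooth_partial.
rewrite mulNr mulN1r addrC [- _ + _]addrC /slice row_mx_stepr mulr1.
have ps := partial_iter (rshift d i) (map (lshift d) s) sF.
have -> : iter_partial (map (lshift d) s) (cpartial (rshift d i) F) =
  iter_partial (rshift d i :: map (lshift d) s) F by rewrite -ps.
apply: (@mean_value_bound _ _ _ (iter_partial (rshift d i :: map (lshift d) s) F)) => u ut.
  exact: (smooth_has_partial (map (lshift d) s) (rshift d i) sF I).
have -> : row_mx eta y0 + u *: delta_mx 0 (rshift d i) = row_mx eta (y0 + u *: delta_mx 0 i) :> R2d.
  by rewrite row_mx_stepr mulr1.
apply: Hdel => //; rewrite -ball_normE /ball_ /= opprD addNKr normrN.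
by rewrite (le_lt_trans (norm_delta _ _))// (le_lt_trans ut).
Unshelve. all: by end_near. Qed.

Lemma smooth_partial_apply F : smooth_on setT F -> smooth_on setT (partial_apply F).
Proof.
move=> sF; apply: (smooth_coind openT (Q := fun g => exists2 F, smooth_on setT F & g = partial_apply F)).
- by move=> _ [G sG ->] x _; exact: cont_at_partial_apply.
- move=> _ [G sG ->] i; exists (partial_apply (cpartial (rshift d i) G)).
    by exists (cpartial (rshift d i) G); [exact: (smooth_partial _ sG)|].
  by move=> x _; exact: has_partial_partial_apply.
- by exists F.
Qed.

Lemma partial_apply_partial F (s : seq 'I_d) : smooth_on setT F ->
  iter_partial s (partial_apply F) = partial_apply (iter_partial (map (@rshift d d) s) F).
Proof.
move=> sF; elim: s => //= i s ->; apply/funext => y; apply: has_partial_cpartial.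
exact: has_partial_partial_apply (smooth_iter_partial _ sF).
Qed.

(** Estimates for T_eta F(eta, y) that are uniform in F: a derivative in y
    passes to F, and T costs finitely many derivatives in eta. *)
Lemma partial_apply_bound : exists (ws : seq (seq 'I_d)) (K : set Rd) (M : R),
  [/\ compact K, 0 < M & forall F (e : R) (w : seq 'I_d) (y : Rd), smooth_on setT F -> 0 <= e ->
    (forall s eta, s \in ws -> K eta ->
      normc (iter_partial (map (lshift d) s ++ map (@rshift d d) w) F (row_mx eta y)) <= e) ->
    normc (iter_partial w (partial_apply F) y) <= M * e].
Proof.
have [ws [K [M [cK M0 HM]]]] := dual_bound.
exists ws, K, M; split => // F e w y sF e0 H.
rewrite partial_apply_partial//; apply: HM => //.
  exact: smooth_slice (smooth_iter_partial _ sF) y.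
move=> s t sws Kt; rewrite slice_partial ?iter_partial_cat; first exact: H.
exact: smooth_iter_partial.
Qed.

End PartialApply.

(** * Averaging dilations against a distribution *)

Section MultiplicativeOperator.
Context {R : realType} {d : nat}.
Local Notation Rd := 'rV[R]_d.
Local Notation R2d := 'rV[R]_(d + d).
Local Notation C := (R[i]^o).

(** Multiplication as a map of both factors. In each of the 2 d coordinates
    separately it is affine, with a slope given by the other factor, so it
    falls under the substitution rule. *)
Definition hadamard2 (z : R2d) : Rd := hadamard (lsubmx z) (rsubmx z).

Definition had_index (i : 'I_(d + d)) : 'I_d :=
  match fintype.split i with inl j => j | inr j => j end.

Definition had_coef (i : 'I_(d + d)) (z : R2d) : R :=
  match fintype.split i with inl j => z 0 (rshift d j) | inr j => z 0 (lshift d j) end.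

Lemma hadamard2E z i : hadamard2 z 0 i = z 0 (lshift d i) * z 0 (rshift d i).
Proof. by rewrite hadamardE !mxE. Qed.

Lemma hadamard2_step z i t :
  hadamard2 (z + t *: delta_mx 0 i) =
  hadamard2 z + (t * had_coef i z) *: delta_mx 0 (had_index i).
Proof.
apply/rowP => j; rewrite [RHS]mxE !hadamard2E !mxE /had_coef /had_index.
case: (split_ordP i) => k ->.
  rewrite eq_lshift eq_rlshift mulr0 addr0 /=.
  by have [->|_] := eqVneq j k; rewrite /=; ring.
rewrite eq_rshift eq_lrshift mulr0 addr0 /=.
by have [->|_] := eqVneq j k; rewrite /=; ring.
Qed.

Lemma hadamard2_continuous : continuous hadamard2.
Proof.
move=> z; apply: (@hadamard_cvg R d R2d (nbhs z) _ lsubmx rsubmx).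
  apply: (@cvg_rV R d R2d (nbhs z)) => i.
  rewrite mxE (_ : (fun x => _) = (fun x : R2d => x 0 (lshift d i))).
    exact: (@coord_continuous R 1 (d + d) 0 _ z).
  by apply/funext => x; rewrite mxE.
apply: (@cvg_rV R d R2d (nbhs z)) => i.
rewrite mxE (_ : (fun x => _) = (fun x : R2d => x 0 (rshift d i))).
  exact: (@coord_continuous R 1 (d + d) 0 _ z).
by apply/funext => x; rewrite mxE.
Qed.

Lemma smooth_had_coef i : smooth_on setT (fun z => (had_coef i z)%:C%C : C).
Proof.
by rewrite /had_coef; case: fintype.split => j; exact: smooth_coord openT.
Qed.

Lemma smooth_hadamard2 (f : Rd -> C) : smooth_on setT f -> smooth_on setT (fun z => 1 * f (hadamard2 z)).
Proof.
move=> sf; apply: (smooth_subst openT openT hadamard2_step smooth_had_coef) => //.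
- by move=> z _; exact: hadamard2_continuous.
- exact: smooth_cst openT.
Qed.

Variable T : dual (Cinf (@openT Rd)).

(** T_eta f(eta y), the function whose pairing with S is the convolution of T
    and S at f. *)
Definition mult_op_fun (f : Rd -> C) (y : Rd) : C :=
  T (to_Cinf (fun eta => f (hadamard eta y))).

(** The factor 1 puts the composition in the shape c * (f o phi) of the
    substitution rule. *)
Lemma mult_op_partial_apply (f : Rd -> C) :
  mult_op_fun f = partial_apply T (fun z => 1 * f (hadamard2 z)).
Proof.
apply/funext => y; congr (dual_fun T (to_Cinf _)); apply/funext => eta.
by rewrite /slice mul1r /hadamard2 row_mxKl row_mxKr.
Qed.

Lemma smooth_mult_op (f : Cinf (@openT Rd)) : smooth_on setT (mult_op_fun f).
Proof.
rewrite mult_op_partial_apply; apply: smooth_partial_apply.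
exact: smooth_hadamard2 (Cinf_smooth f).
Qed.

Definition mult_op (f : Cinf (@openT Rd)) : Cinf (@openT Rd) := to_Cinf (mult_op_fun f).

Lemma mult_opE f : (mult_op f : Rd -> C) = mult_op_fun f.
Proof. exact: to_CinfE (smooth_mult_op f). Qed.

Lemma mult_op_linear : linear mult_op.
Proof.
move=> a f g; apply: CinfP => y _; rewrite mult_opE.
have -> : (a *: mult_op f + mult_op g : Cinf (@openT Rd)) y =
   a * (mult_op f : Rd -> C) y + (mult_op g : Rd -> C) y by [].
rewrite !mult_opE /mult_op_fun.
have sf := smoothT_hadamard y (Cinf_smooth f); have sg := smoothT_hadamard y (Cinf_smooth g).
rewrite -(to_Cinf_lin _ a); last 2 first.
- by move: sf; congr smooth_on; apply/funext => z /=; rewrite hadamardC.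
- by move: sg; congr smooth_on; apply/funext => z /=; rewrite hadamardC.
by [].
Qed.

(** Stated apart from the continuity of the operator because a bound by
    derivatives on one compact set of the whole space is what localises to
    Omega later. *)
Lemma mult_op_seminorm (w : seq 'I_d) (K : set Rd) : compact K ->
  exists (vs : seq (seq 'I_d)) (L : set Rd) (M : R), [/\ compact L, 0 < M &
    forall (f : Cinf (@openT Rd)) (e : R), 0 <= e ->
      (forall s t, s \in vs -> L t -> normc (iter_partial s f t) <= e) ->
      forall t, K t -> normc (iter_partial w (mult_op f) t) <= M * e].
Proof.
move=> cK; have [ws [H [N [cH N0 HN]]]] := partial_apply_bound T.
pose P : set R2d := (fun p : Rd * Rd => row_mx p.1 p.2) @` (H `*` K).
have cP : compact P.
  apply: continuous_compact; last exact: compact_setX.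
  apply: continuous_subspaceT => p.
  by apply: (@row_mx_cvg _ _ _ (nbhs p)); [exact: cvg_fst|exact: cvg_snd].
have hT (z : R2d) : [set: R2d] z -> [set: Rd] (hadamard2 z) by [].
have PT : P `<=` [set: R2d] by [].
have [vs [M [M0 HM]]] := subst_seminorms openT hadamard2_step smooth_had_coef
   hT (map (fun s => map (lshift d) s ++ map (@rshift d d) w) ws)
   (smooth_cst (1 : C) openT) cP PT.
exists vs, (hadamard2 @` P), (N * M); split; rewrite ?mulr_gt0//.
  by apply: continuous_compact => //; exact: continuous_subspaceT hadamard2_continuous.
move=> f e e0 Hf t Kt; rewrite mult_opE mult_op_partial_apply -mulrA.
apply: HN.
- exact: smooth_hadamard2 (Cinf_smooth f).
- by rewrite mulr_ge0// ltW.
move=> s eta sws Heta; apply: HM => //.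
- exact: Cinf_smooth.
- by move=> p z pvs Pz; apply: Hf => //; exists z.
- by apply/mapP; exists s.
- by exists (eta, t).
Qed.

Lemma mult_op_lincont : mult_op \in lincont (Cinf (@openT Rd)) (Cinf (@openT Rd)).
Proof.
apply: lincont_seminorms; first exact: mult_op_linear.
move=> w K cK _; have [vs [L [M [cL M0 H]]]] := mult_op_seminorm w cK.
by exists vs, L, M.
Qed.

End MultiplicativeOperator.

(** * Bernstein approximation together with all derivatives *)

Section UniformContinuity.
Context {R : realType} {d : nat}.
Local Notation Rd := 'rV[R]_d.
Local Notation C := (R[i]^o).

Definition box (A : R) : set Rd := [set x | forall i, `|x 0 i| <= A].

Lemma compact_sup_box (A : R) : compact (box A).
Proof.
rewrite (_ : box A = [set y : Rd | forall i, `|y 0 i - (0 : Rd) 0 i| <= A]).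
  by exact: compact_box.
by apply/seteqP; split => y h i; have := h i; rewrite mxE subr0.
Qed.

Lemma compact_sub_box (K : set Rd) : compact K -> exists2 A : R, 0 < A & K `<=` box A.
Proof.
move=> /compact_bounded[M [_ HM]]; exists (`|M| + 1) => [|x Kx i]; first by rewrite ltr_wpDl.
rewrite (le_trans (coord_le_norm x i))//; apply: HM => //.
by rewrite (le_lt_trans (ler_norm _))// ltrDl.
Qed.

(** The base point ranges over K but the moved point may leave K, since
    difference quotients at boundary points of a box look outside of it. *)
Lemma uniform_continuity (g : Rd -> C) (K : set Rd) (e : R) : compact K ->
  (forall x, cont_at g x) -> 0 < e ->
  exists2 del : R, 0 < del & forall x v, K x -> `|v| <= del -> normc (g (x + v) - g x) <= e.
Proof.
move=> /compact_near_coveringP cK cg e0.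
have e2 : 0 < e / 2 by rewrite divr_gt0.
have H : \forall v \near (0 : Rd), K `<=` (fun x => normc (g (x + v) - g x) <= e).
  apply: (cK Rd (nbhs (0 : Rd)) (fun v x => normc (g (x + v) - g x) <= e) (nbhs_filter _)).
  move=> x Kx.
  have h1 : \forall p \near nbhs (x, (0 : Rd)), normc (g x - g (p.1 + p.2)) < e / 2.
    have cc : p.1 + p.2 @[p --> (x, (0 : Rd))] --> x.
      rewrite -[X in _ --> X]addr0.
      by apply: (@cvgD _ _ _ _ _ fst snd); [exact: cvg_fst|exact: cvg_snd].
    exact: (cc _ (cg x _ e2)).
  have h2 : \forall p \near nbhs (x, (0 : Rd)), normc (g x - g p.1) < e / 2.
    exact: (cvg_fst (cg x _ e2)).
  apply: filterS2 h1 h2 => -[y v] /= H1 H2.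
  rewrite (le_trans (normc_dist _ (g x) _))// (splitr e) lerD ?(ltW H2)//.
  by rewrite normcB ltW.
move: H => /nbhs_ballP[r r0 Hr]; have {}r0 : 0 < r := r0.
exists (r / 2) => [|x v Kx vr]; first by rewrite divr_gt0.
apply: (Hr v) => //; rewrite -ball_normE /ball_ /= sub0r normrN (le_lt_trans vr)//.
by rewrite ltr_pdivrMr// ltr_pMr// ltr1n.
Qed.

End UniformContinuity.

Section Bernstein.
Context {R : realType} {d : nat}.
Local Notation Rd := 'rV[R]_d.
Local Notation C := (R[i]^o).
Variable j : 'I_d.
Local Notation e_ i := (delta_mx 0 i : Rd).
Implicit Types (f g : Rd -> C) (h u A L : R) (n : nat).

Definition translate h f : Rd -> C := fun z => f (z + h *: e_ j).

(** The expectation of f(z + k h e_j) for k binomial with parameters n and u.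
    Defined by conditioning on one trial, so that induction on n replaces
    manipulations of binomial coefficients. *)
Fixpoint binomial_average n h u f (z : Rd) : C :=
  if n is n'.+1 then
    (1 - u)%:C%C * binomial_average n' h u f z + u%:C%C * binomial_average n' h u (translate h f) z
  else f z.

Lemma binomial_average_comb n h u (a : C) f g z :
  binomial_average n h u (fun z => a * f z + g z) z =
  a * binomial_average n h u f z + binomial_average n h u g z.
Proof. by elim: n f g => //= n IH f g; rewrite IH (IH (translate h f)); ring. Qed.

Lemma binomial_average_cst n h u (c : C) z : binomial_average n h u (fun=> c) z = c.
Proof.
elim: n => //= n IH; rewrite /translate IH -mulrDl -rmorphD subrK.
by rewrite mul1r.
Qed.

(** The mean and the variance of the binomial law in one induction: a
    quadratic majorant of f on the nodes gives the expectation of this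
    majorant, the square of the bias plus the variance. Conditioning on one
    trial shifts the centre c by h. *)
Lemma binomial_average_bound n h u f z (a b c : R) : 0 <= u <= 1 ->
  (forall k, (k <= n)%N -> normc (f (z + (k%:R * h) *: e_ j)) <=
     a + b * (z 0 j + k%:R * h - c) ^+ 2) ->
  normc (binomial_average n h u f z) <=
  a + b * ((z 0 j + n%:R * u * h - c) ^+ 2 + n%:R * u * (1 - u) * h ^+ 2).
Proof.
move=> /andP[u0 u1]; elim: n f c => [|n IH] f c Hf.
  have := Hf 0%N (leqnn 0); rewrite !mul0r scale0r addr0 !addr0 => /le_trans; apply.
  by rewrite lexx.
have H1 := IH f c (fun k kn => Hf k (leqW kn)).
have H2 := IH (translate h f) (c - h).
have {H2} H2 : normc (binomial_average n h u (translate h f) z) <=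
  a + b * ((z 0 j + n%:R * u * h - (c - h)) ^+ 2 + n%:R * u * (1 - u) * h ^+ 2).
  apply: H2 => k kn; rewrite /translate -addrA -scalerDl.
  have -> : k%:R * h + h = k.+1%:R * h by rewrite -natr1 mulrDl mul1r.
  apply: le_trans (Hf k.+1 kn) _; rewrite le_eqVlt; apply/orP; left; apply/eqP.
  by rewrite -natr1; ring.
rewrite /= (le_trans (normcD _ _))// !normcM !normc_realE ger0_norm ?subr_ge0// ger0_norm//.
apply: le_trans (lerD (ler_wpM2l _ H1) (ler_wpM2l u0 H2)) _; first by rewrite subr_ge0.
by rewrite le_eqVlt; apply/orP; left; apply/eqP; rewrite -natr1; ring.
Qed.

Definition pin A (x : Rd) : Rd := \row_i (if i == j then - A else x 0 i).

(** The Bernstein polynomial of degree n in the variable j on the interval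
    [-A, -A + L], for nodes of step h: the j-th coordinate is moved to the
    left end -A and the success probability is its relative position in the
    interval. The parameters h and L are kept independent, because the degree
    drops under differentiation while h and L do not change. *)
Definition bernstein n h A L f (x : Rd) : C := binomial_average n h ((x 0 j + A) / L) f (pin A x).

Lemma pin_step A x i t :
  pin A (x + t *: e_ i) = pin A x + (t * (i != j)%:R) *: e_ i.
Proof.
apply/rowP => k; rewrite !mxE eqxx /=.
have [->|kj] := eqVneq k j.
  have [_|_] := eqVneq i j; first by rewrite /= mulr0 mul0r addr0.
  by rewrite /= mulr0 addr0.
have [ki|ki] := eqVneq k i; last by rewrite !mulr0 !addr0.
by rewrite -ki kj !mulr1.
Qed.

Lemma pin_continuous A : continuous (pin A).
Proof.
move=> x; apply: (@cvg_rV R d Rd (nbhs x)) => i; rewrite mxE.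
have [ij|ij] := eqVneq i j.
  rewrite (_ : (fun x => _) = fun=> - A); first exact: cvg_cst.
  by apply/funext => y; rewrite mxE ij eqxx.
rewrite (_ : (fun x => _) = fun y : Rd => y 0 i); first exact: coord_continuous.
by apply/funext => y; rewrite mxE (negbTE ij).
Qed.

Lemma smooth_comp_pin A f : smooth_on setT f -> smooth_on setT (f \o pin A).
Proof.
move=> sf; rewrite (_ : f \o _ = fun z => 1 * f (pin A z)); last first.
  by apply/funext => z; rewrite mul1r.
exact: (smooth_subst openT openT (k := id) (q := fun i _ => (i != j)%:R)
  (fun z i t => pin_step A z i t) (fun i => smooth_cst _ openT) (fun _ _ => I)
  (fun z _ => @pin_continuous A z) (smooth_cst 1 openT) sf).
Qed.

Lemma smooth_translate h f : smooth_on setT f -> smooth_on setT (translate h f).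
Proof.
move=> sf; rewrite (_ : translate h f = fun z => 1 * f (z + h *: e_ j)); last first.
  by apply/funext => z; rewrite mul1r.
have st (z : Rd) (i : 'I_d) (t : R) :
    z + t *: e_ i + h *: e_ j = z + h *: e_ j + (t * 1) *: e_ i.
  by rewrite mulr1 addrAC.
have ct (z : Rd) : setT z -> y + h *: e_ j @[y --> z] --> z + h *: e_ j.
  move=> _; apply: (@cvgD R Rd Rd (nbhs z) _ id (fun=> h *: e_ j) z (h *: e_ j)).
    exact: cvg_id.
  exact: cvg_cst.
exact: (smooth_subst openT openT (k := id) (q := fun i _ => 1)
  st (fun i => smooth_cst _ openT) (fun _ _ => I) ct (smooth_cst 1 openT) sf).
Qed.

Lemma has_partial_translate h f x i l : has_partial f (x + h *: e_ j) i l ->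
  has_partial (translate h f) x i l.
Proof.
move=> /has_partial_eps H; apply: eps_has_partial => e e0; apply: filterS (H e e0) => t.
by rewrite /translate [x + t *: _ + _]addrAC.
Qed.

Lemma translate_partial h f i : smooth_on setT f ->
  cpartial i (translate h f) = translate h (cpartial i f).
Proof.
move=> sf; apply/funext => x; apply/has_partial_cpartial/has_partial_translate.
exact: (smooth_has_partial [::] i sf (I : setT (x + h *: e_ j))).
Qed.

Lemma smooth_weight A L : smooth_on setT (fun x : Rd => ((x 0 j + A) / L)%:C%C : C).
Proof.
have := smoothM openT (smoothD openT (smooth_coord j openT) (smooth_cst (A%:C%C : C) openT))
  (smooth_cst ((L^-1)%:C%C : C) openT).
by congr smooth_on; apply/funext => x; rewrite -rmorphD -rmorphM.
Qed.

Lemma has_partial_weight A L x i :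
  has_partial (fun x : Rd => ((x 0 j + A) / L)%:C%C : C) x i (((i == j)%:R / L)%:C%C).
Proof.
have := has_partialM (has_partialD (has_partial_coord x i j) (has_partial_cst (A%:C%C : C) x i))
  (has_partial_cst ((L^-1)%:C%C : C) x i).
rewrite addr0 mulr0 addr0 [((_ / L)%:C)%C]rmorphM rmorph_nat.
by congr has_partial; apply/funext => y; rewrite -rmorphD -rmorphM.
Qed.

Lemma bernstein_S n h A L f : bernstein n.+1 h A L f = fun x =>
  (1 + (-1) * ((x 0 j + A) / L)%:C%C) * bernstein n h A L f x +
  ((x 0 j + A) / L)%:C%C * bernstein n h A L (translate h f) x.
Proof.
by apply/funext => x; rewrite /bernstein /= rmorphB rmorph1 mulN1r.
Qed.

Lemma smooth_bernstein n h A L f : smooth_on setT f -> smooth_on setT (bernstein n h A L f).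
Proof.
elim: n f => [|n IH] f sf; first exact: smooth_comp_pin.
rewrite bernstein_S; apply: (smoothD openT).
  exact: (smoothM openT (smooth_onem (smooth_weight A L)) (IH f sf)).
exact: (smoothM openT (smooth_weight A L) (IH _ (smooth_translate h sf))).
Qed.

Lemma has_partial_onem f x i l : has_partial f x i l -> has_partial (fun y => 1 + (-1) * f y) x i (- l).
Proof.
move=> df; have := has_partialD (has_partial_cst 1 x i) (has_partialM (has_partial_cst (-1) x i) df).
by rewrite mul0r !add0r mulN1r.
Qed.

(** The polynomial depends on the other variables only through f. *)
Lemma has_partial_bernstein_neq n h A L f x i : i != j -> smooth_on setT f ->
  has_partial (bernstein n h A L f) x i (bernstein n h A L (cpartial i f) x).
Proof.
move=> ij; elim: n f => [|n IH] f sf.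
  have hf := smooth_has_partial [::] i sf (I : setT (pin A x)).
  have := @has_partial_subst R d d (pin A) id (fun i _ => (i != j)%:R)
    (fun z i t => pin_step A z i t) f x i _ hf.
  by rewrite ij mul1r.
have hw := has_partial_weight A L x i.
have := has_partialD (has_partialM (has_partial_onem hw) (IH f sf)) (has_partialM hw (IH _ (smooth_translate h sf))).
rewrite (negbTE ij) mul0r oppr0 !mul0r !add0r translate_partial//.
by rewrite !bernstein_S.
Qed.

Definition increment h f : Rd -> C := fun z => (-1) * f z + translate h f z.

(** The classical rule: the derivative of a Bernstein polynomial is the
    Bernstein polynomial, of degree one less, of the increment of f, up to the
    factor n / L. *)
Lemma has_partial_bernstein_eq n h A L f x : smooth_on setT f ->
  has_partial (bernstein n h A L f) x j ((n%:R / L)%:C%C * bernstein n.-1 h A L (increment h f) x).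
Proof.
elim: n f => [|n IH] f sf.
  have hf := smooth_has_partial [::] j sf (I : setT (pin A x)).
  have := @has_partial_subst R d d (pin A) id (fun i _ => (i != j)%:R)
    (fun z i t => pin_step A z i t) f x j _ hf.
  by rewrite eqxx /= !mul0r.
have hw := has_partial_weight A L x j.
have := has_partialD (has_partialM (has_partial_onem hw) (IH f sf)) (has_partialM hw (IH _ (smooth_translate h sf))).
rewrite -bernstein_S eqxx; congr has_partial.
have dE m : bernstein m h A L (increment h f) x =
    (-1) * bernstein m h A L f x + bernstein m h A L (translate h f) x.
  by rewrite /bernstein -binomial_average_comb.
case: n {IH} => [|n].
  by rewrite /= mul0r !mul0r !mulr0 !addr0 dE; ring.
rewrite [n.+1.-1]/= [n.+2.-1]/=.
have sE : increment h (translate h f) = translate h (increment h f) by [].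
rewrite sE.
have -> : (true%:R / L)%:C%C = (1 / L)%:C%C :> C by [].
have P := dE n.+1; rewrite [in LHS]bernstein_S in P.
rewrite [in RHS]bernstein_S.
have -> : ((n.+2)%:R / L)%:C%C = (1 / L)%:C%C + (n.+1%:R / L)%:C%C :> C.
  by rewrite -rmorphD -mulrDl -[n.+2%:R]natr1 addrC.
rewrite [RHS]mulrDl [X in _ = X + _](congr1 (GRing.mul _) P).
by ring.
Qed.

Lemma has_partial_increment h f f' i : (forall z, has_partial f z i (f' z)) ->
  forall z, has_partial (increment h f) z i (increment h f' z).
Proof.
move=> df z; have := has_partialD (has_partialM (has_partial_cst (-1) z i) (df z))
  (has_partial_translate (df (z + h *: e_ j))).
by rewrite mul0r add0r.
Qed.

(** The increment divided by the step, which tends to the partial derivative;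
    its r-th iterate appears in the r-th derivative of the Bernstein
    polynomial. *)
Definition diffquot h f : Rd -> C := fun z => (h^-1)%:C%C * increment h f z.

Lemma smooth_diffquot h f : smooth_on setT f -> smooth_on setT (diffquot h f).
Proof.
move=> sf; exact: (smoothM openT (smooth_cst _ openT)
  (smoothD openT (smoothM openT (smooth_cst (-1) openT) sf) (smooth_translate h sf))).
Qed.

Lemma smooth_iter_diffquot r h f : smooth_on setT f -> smooth_on setT (iter r (diffquot h) f).
Proof.
move=> sf; elim: r => [//|r IH]; exact: (smooth_diffquot h IH).
Qed.

Lemma has_partial_iter_diffquot r h f i : smooth_on setT f ->
  forall z, has_partial (iter r (diffquot h) f) z i (iter r (diffquot h) (cpartial i f) z).
Proof.
move=> sf; elim: r => [|r IH] z; first exact: (smooth_has_partial [::] i sf (I : setT z)).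
have := has_partialM (has_partial_cst ((h^-1)%:C%C) z i) (has_partial_increment h IH z).
by rewrite mul0r add0r.
Qed.

(** Induction on r: the mean value bound replaces the outermost quotient by a
    derivative. The box is enlarged by 1 at each step because the quotients
    look slightly outside of it. *)
Lemma iter_diffquot_cvg r f A (e : R) : smooth_on setT f -> 0 < e ->
  exists2 del : R, 0 < del & forall h z, 0 < h <= del -> box A z ->
    normc (iter r (diffquot h) f z - iter_partial (nseq r j) f z) <= e.
Proof.
elim: r f A e => [|r IH] f A e sf e0.
  by exists 1 => // h z _ _; rewrite subrr normc0 ltW.
have e4 : 0 < e / 4 by rewrite divr_gt0.
have [d1 d10 H1] := IH _ (A + 1) _ (smooth_partial j sf) e4.
have [d2 d20 H2] := uniform_continuity (@compact_sup_box R d A)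
  (fun x => smooth_cont_at (nseq r.+1 j) openT sf (I : setT x)) e4.
exists (Num.min 1 (Num.min d1 d2)) => [|h z /andP[h0]]; first by rewrite !lt_min ltr01 d10.
rewrite !le_min => /and3P[h1 hd1 hd2] Az.
have nE : iter_partial (nseq r j) (cpartial j f) = iter_partial (nseq r.+1 j) f.
  by rewrite -(partial_iter j (nseq r j) sf).
have B (s : R) : `|s| <= `|h| -> normc (iter r (diffquot h) (cpartial j f) (z + s *: e_ j) -
    iter_partial (nseq r.+1 j) f z) <= e / 2.
  rewrite (gtr0_norm h0) => sh.
  apply: le_trans (normc_dist _ (iter_partial (nseq r.+1 j) f (z + s *: e_ j)) _) _.
  rewrite (_ : e / 2 = e / 4 + e / 4); last by field.
  rewrite lerD//.
    rewrite -nE; apply: H1; first by rewrite h0.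
    move=> i; rewrite coord_step (le_trans (ler_normD _ _))// lerD//.
    rewrite normrM (le_trans _ (le_trans sh h1))// ler_piMr// ger0_norm//.
    by case: (_ == _).
  by apply: H2 => //; rewrite (le_trans (norm_delta _ _))// (le_trans sh).
have := mean_value_bound (fun s _ => has_partial_iter_diffquot r h j sf (z + s *: e_ j)) B.
rewrite iterS; set G := iter r (diffquot h) f.
have -> : diffquot h G z = (h^-1)%:C%C * (G (z + h *: e_ j) - G z).
  by rewrite /diffquot /increment /translate mulN1r addrC.
have hi0 : 0 < h^-1 by rewrite invr_gt0.
rewrite (gtr0_norm h0) => H.
have -> : (h^-1)%:C%C * (G (z + h *: e_ j) - G z) - iter_partial (nseq r.+1 j) f z =
   (h^-1)%:C%C * (G (z + h *: e_ j) - G z - h%:C%C * iter_partial (nseq r.+1 j) f z).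
  have hh : (h^-1)%:C%C * h%:C%C = 1 :> C by rewrite -rmorphM mulVf ?gt_eqF.
  by rewrite [RHS]mulrBr [X in _ = _ - X]mulrA hh mul1r.
rewrite normcM normc_realE gtr0_norm// mulrC ler_pdivrMr// (le_trans H)//.
by rewrite ler_wpM2r ?(ltW h0)// mulrC divfK.
Qed.

Lemma bernstein_partial n h A L f (s : seq 'I_d) : j \notin s -> smooth_on setT f ->
  iter_partial s (bernstein n h A L f) = bernstein n h A L (iter_partial s f).
Proof.
move=> + sf; elim: s => //= i s IH; rewrite inE negb_or => /andP[ij js].
rewrite IH//; apply/funext => x; apply: has_partial_cpartial.
by apply: has_partial_bernstein_neq; rewrite 1?eq_sym//; exact: smooth_iter_partial.
Qed.

(** The product of the factors (n - k) / L gathered by r differentiations,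
    multiplied by h^r since increments are counted as difference quotients.
    For h = L / n it is the product of the 1 - k / n, which tends to 1. *)
Definition bernstein_coef r n h L : R := \prod_(k < r) ((n - k)%:R * h / L).

Lemma bernstein_scale n h A L (a : C) f x :
  bernstein n h A L (fun z => a * f z) x = a * bernstein n h A L f x.
Proof.
rewrite /bernstein; have := binomial_average_comb n h ((x 0 j + A) / L) a f (fun=> 0) (pin A x).
rewrite binomial_average_cst addr0 => <-; congr (binomial_average _ _ _ _ _); apply/funext => z.
by rewrite addr0.
Qed.

Lemma bernstein_nseq r n h A L f : 0 < h -> smooth_on setT f ->
  iter_partial (nseq r j) (bernstein n h A L f) = fun x =>
  (bernstein_coef r n h L)%:C%C * bernstein (n - r) h A L (iter r (diffquot h) f) x.
Proof.
move=> h0 sf; elim: r => [|r IH] /=.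
  by apply/funext => x; rewrite /bernstein_coef big_ord0 mul1r subn0.
rewrite IH; apply/funext => x; apply: has_partial_cpartial.
have := has_partialM (has_partial_cst (bernstein_coef r n h L)%:C%C x j)
  (has_partial_bernstein_eq (n - r) h A L x (smooth_iter_diffquot r h sf)).
congr has_partial; rewrite mul0r add0r subnS.
rewrite -[diffquot h (iter r _ _)]/(fun z => (h^-1)%:C%C * increment h (iter r (diffquot h) f) z).
have E : (bernstein_coef r.+1 n h L)%:C%C * (h^-1)%:C%C =
    (bernstein_coef r n h L)%:C%C * ((n - r)%:R / L)%:C%C :> C.
  rewrite -!rmorphM /bernstein_coef big_ord_recr /=; congr (_%:C%C).
  have -> : (n - r)%:R / L = (n - r)%:R * h / L / h.
    by rewrite [RHS]mulrAC mulfK// gt_eqF.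
  by rewrite -[LHS]mulrA.
by rewrite bernstein_scale [RHS]mulrA E [LHS]mulrA.
Qed.

Lemma small_step L (e : R) : 0 < L -> 0 < e ->
  exists N : nat, forall n, (N <= n)%N -> (0 < n)%N -> L / n%:R <= e.
Proof.
move=> L0 e0; have [N _ HN] : \forall n \near \oo, L / e < n%:R by exact: nbhs_infty_gtr.
exists N => n Nn n0; rewrite ler_pdivrMr ?ltr0n// mulrC -ler_pdivrMr//.
by rewrite ltW//; exact: HN.
Qed.

Lemma bernstein_coef_cvg r L (e : R) : 0 < L -> 0 < e -> exists N : nat, forall n, (N <= n)%N ->
  (0 < n)%N -> `|bernstein_coef r n (L / n%:R) L| <= 1 /\ `|bernstein_coef r n (L / n%:R) L - 1| <= e.
Proof.
move=> L0; have L1 : L != 0 by rewrite gt_eqF.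
elim: r e => [|r IH] e e0.
  by exists 0%N => n _ _; rewrite /bernstein_coef big_ord0 normr1 subrr normr0; split=> //; exact: ltW.
have e2 : 0 < e / 2 by rewrite divr_gt0.
have [N1 H1] := IH _ e2.
have [N2 H2] := small_step (ltr0Sn R r) e2.
exists (maxn r (maxn N1 N2)) => n; rewrite !geq_max => /and3P[rn nN1 nN2] n0.
have [c1 c2] := H1 n nN1 n0; have {}H2 := H2 n nN2 n0.
rewrite /bernstein_coef big_ord_recr /= -/(bernstein_coef r n (L / n%:R) L).
set c := bernstein_coef _ _ _ _ in c1 c2 *.
have n00 : n%:R != 0 :> R by rewrite pnatr_eq0 -lt0n.
have -> : (n - r)%:R * (L / n%:R) / L = 1 - r%:R / n%:R :> R.
  by rewrite natrB//; field; rewrite n00 L1.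
have rn0 : 0 <= r%:R / n%:R :> R by rewrite divr_ge0.
have rn1 : r%:R / n%:R <= 1 :> R by rewrite ler_pdivrMr ?ltr0n// mul1r ler_nat.
split.
  by rewrite normrM -[leRHS]mulr1 ler_pM// ger0_norm ?subr_ge0// lerBlDr lerDl.
rewrite mulrBr mulr1 addrAC (le_trans (ler_normD _ _))// (splitr e) lerD//.
rewrite normrN normrM -[leRHS]mul1r ler_pM// ger0_norm// (le_trans _ H2)//.
by rewrite ler_pM2r ?invr_gt0 ?ltr0n// ler_nat.
Qed.

Lemma node_in_box n h A x k : 0 <= h -> n%:R * h <= A + A ->
  box A x -> (k <= n)%N -> box A (pin A x + (k%:R * h) *: e_ j).
Proof.
move=> h0 nh Ax kn i; rewrite coord_step mxE [j == i]eq_sym.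
have [_|ij] := eqVneq i j; last by rewrite mulr0 addr0; exact: Ax.
rewrite mulr1 ler_norml; apply/andP; split.
  by rewrite lerDl mulr_ge0// ltW.
rewrite addrC lerBlDr (le_trans _ nh)// ler_wpM2r ?ler_nat//.
Qed.

(** Bernstein's argument by Chebyshev's inequality, for an average of order m
    <= n whose nodes are among those of order n. Nodes within del of x
    contribute at most e + e, as g is close to psi and psi is uniformly
    continuous; for the other nodes the trivial bound S + S is at most (S + S)
    (z_j - x_j)^2 / del^2. The quadratic bound then yields the bias, at most
    (n - m) h, and the variance, at most (A + A) h. *)
Lemma bernstein_estimate n m A (psi g : Rd -> C) x (del S e : R) :
  let h := (A + A) / n%:R in
  0 < A -> (0 < n)%N -> (m <= n)%N -> 0 < del -> box A x -> 0 <= e -> 0 <= S ->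
  (forall z v, box A z -> `|v| <= del -> normc (psi (z + v) - psi z) <= e) ->
  (forall z, box A z -> normc (psi z) <= S) ->
  (forall z, box A z -> normc (g z - psi z) <= e) ->
  normc (bernstein m h A (A + A) g x - psi x) <=
  e + e + (S + S) / del ^+ 2 * (((n - m)%:R * h) ^+ 2 + (A + A) * h).
Proof.
move=> h A0 n0 mn del0 Ax e0 S0 Hpsi HS Hg.
have L0 : 0 < A + A by rewrite addr_gt0.
have n00 : 0 < n%:R :> R by rewrite ltr0n.
have h0 : 0 < h by rewrite divr_gt0.
have nh : n%:R * h = A + A by rewrite /h mulrC divfK// gt_eqF.
set u := (x 0 j + A) / (A + A).
have /andP[xA1 xA2] : - A <= x 0 j <= A by rewrite -ler_norml; exact: Ax.
have u01 : 0 <= u <= 1.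
  rewrite divr_ge0 ?(ltW L0)//=; last by rewrite -lerBlDr sub0r.
  by rewrite ler_pdivrMr// mul1r lerD2r.
have uh : n%:R * u * h = x 0 j + A.
  by rewrite mulrAC nh /u mulrC divfK// gt_eqF.
(* Averages preserve constants: the difference is the average of g - psi x. *)
have -> : bernstein m h A (A + A) g x - psi x =
    binomial_average m h u (fun z => 1 * g z + (fun=> - psi x) z) (pin A x).
  by rewrite binomial_average_comb binomial_average_cst mul1r.
clearbody u h.
have SS : 0 <= (S + S) / del ^+ 2 by rewrite divr_ge0 ?addr_ge0 ?sqr_ge0.
apply: le_trans (binomial_average_bound (a := e + e) (b := (S + S) / del ^+ 2) (c := x 0 j) u01 _) _.
- move=> k km; set z := pin A x + _.
  have Az : box A z.
    by apply: (@node_in_box n) => //; rewrite ?(ltW h0) ?nh// (leq_trans km).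
  have zx : z = x + (z 0 j - x 0 j) *: e_ j.
    apply/rowP => i; rewrite [RHS]coord_step [j == i]eq_sym.
    have [->|ij] := eqVneq i j; first by rewrite mulr1; ring.
    by rewrite mulr0 addr0 coord_step mxE (negbTE ij) eq_sym (negbTE ij) mulr0 addr0.
  have zj : pin A x 0 j + k%:R * h = z 0 j by rewrite coord_step eqxx mulr1.
  rewrite zj mul1r (le_trans (normc_dist _ (psi z) _))// -addrA lerD ?Hg//.
  have [close|far] := leP `|z 0 j - x 0 j| del.
    rewrite {1}zx (le_trans (Hpsi x _ Ax _)) ?(le_trans (norm_delta _ _))//.
    by rewrite lerDl mulr_ge0// sqr_ge0.
  apply: le_trans (normcD _ _) _; rewrite normcNE.
  apply: le_trans (lerD (HS z Az) (HS x Ax)) _.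
  apply: (@le_trans _ _ ((S + S) / del ^+ 2 * (z 0 j - x 0 j) ^+ 2)); last by rewrite lerDr.
  rewrite -mulrA -[leLHS]mulr1 ler_wpM2l ?addr_ge0// ler_pdivlMl ?exprn_gt0// mulr1.
  by rewrite -[leRHS]real_normK ?num_real// lerXn2r ?nnegrE ?normr_ge0// ltW.
- rewrite lerD2l ler_wpM2l// lerD//.
  + have -> : pin A x 0 j + m%:R * u * h - x 0 j = - ((n - m)%:R * u * h).
      rewrite mxE eqxx natrB// !mulrBl uh; ring.
    rewrite sqrrN lerXn2r ?nnegrE ?mulr_ge0// ?(ltW h0)//; try by case/andP: u01.
    by rewrite ler_wpM2r ?(ltW h0)// ler_piMr//; case/andP: u01.
  + rewrite -nh expr2 mulrA ler_wpM2r ?(ltW h0)// ler_wpM2r ?(ltW h0)//.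
    case/andP: u01 => u0 u1.
    rewrite -mulrA -[leRHS]mulr1 ler_pM ?ler_nat ?mulr_ge0 ?subr_ge0//.
    by rewrite mulr_ile1 ?subr_ge0// lerBlDr lerDl.
Qed.

(** By symmetry of derivatives write w as r derivatives in the variable j
    followed by derivatives w' in the other variables. The latter go through
    to f, and the former turn f into iterated difference quotients, which
    converge uniformly; the estimate above applies with g these quotients and
    psi their limit. *)
Lemma bernstein_cvg f (w : seq 'I_d) A (e : R) : smooth_on setT f -> 0 < A -> 0 < e ->
  exists N : nat, forall n, (N <= n)%N -> (0 < n)%N -> forall x, box A x ->
    normc (iter_partial w (bernstein n ((A + A) / n%:R) A (A + A) f) x - iter_partial w f x) <= e.
Proof.
move=> sf A0 e0; have L0 : 0 < A + A by rewrite addr_gt0.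
pose r := count_mem j w; pose w' := [seq i <- w | i != j].
have wE : perm_eq w (nseq r j ++ w').
  rewrite -(perm_filterC (pred1 j) w) (_ : [seq x <- w | pred1 j x] = nseq r j) //.
  have /all_pred1P E : all (pred1 j) [seq x <- w | pred1 j x] by exact: filter_all.
  by rewrite {1}E size_filter.
set phi := iter_partial w' f; have sphi : smooth_on setT phi := smooth_iter_partial w' sf.
set psi := iter_partial (nseq r j) phi.
have psiE : iter_partial w f = psi by rewrite (iter_partial_perm sf wE) /psi iter_partial_cat.
have jw' : j \notin w' by rewrite mem_filter /= eqxx.
have cpsi x : cont_at psi x := smooth_cont_at (nseq r j) openT sphi (I : setT x).
have [S S0 HS] := compact_normc_bound (@compact_sup_box R d A) (fun x _ => cpsi x).
(* Five error terms: e + e from the estimate, its quadratic part, the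
   coefficient c in front of the average, and one to spare. *)
have e5 : 0 < e / 5 by rewrite divr_gt0.
have [del del0 Hdel] := uniform_continuity (@compact_sup_box R d A) cpsi e5.
have [eta eta0 Heta] := iter_diffquot_cvg r A sphi e5.
(* For h <= 1 the quadratic part of the estimate is at most D h. *)
pose D := (S + S) / del ^+ 2 * (r%:R ^+ 2 + (A + A)).
have rA : 0 < r%:R ^+ 2 + (A + A) by rewrite ltr_wpDl ?sqr_ge0.
have D0 : 0 < D by rewrite mulr_gt0// divr_gt0 ?addr_gt0 ?exprn_gt0.
have eD : 0 < e / 5 / D by rewrite divr_gt0.
have eS : 0 < e / 5 / S by rewrite divr_gt0.
have [N1 H1] := small_step L0 eta0.
have [N2 H2] := small_step L0 ltr01.
have [N3 H3] := small_step L0 eD.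
have [N4 H4] := bernstein_coef_cvg r L0 eS.
exists (maxn r (maxn (maxn N1 N2) (maxn N3 N4))) => n.
rewrite !geq_max => /andP[rn /andP[/andP[n1 n2] /andP[n3 n4]]] n0 x Ax.
set h := (A + A) / n%:R.
have h0 : 0 < h by rewrite divr_gt0// ltr0n.
have heta : h <= eta := H1 n n1 n0.
have h1 : h <= 1 := H2 n n2 n0.
have hD : h <= e / 5 / D := H3 n n3 n0.
have [c1 c2] := H4 n n4 n0; rewrite -/h in c1 c2.
have sb := smooth_bernstein n h A (A + A) sf.
rewrite psiE (iter_partial_perm sb wE) -iter_partial_cat bernstein_partial// -/phi bernstein_nseq//.
set c := bernstein_coef _ _ _ _ in c1 c2 *.
set B := bernstein _ _ _ _ _ x.
have HB : normc (B - psi x) <= e / 5 + e / 5 + e / 5.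
  have := bernstein_estimate A0 n0 (leq_subr r n) del0 Ax (ltW e5) (ltW S0) Hdel HS
    (fun z Az => Heta h z (introT andP (conj h0 heta)) Az).
  rewrite -/h -/B => /le_trans; apply; rewrite lerD2l subKn//.
  have -> : e / 5 = (S + S) / del ^+ 2 * ((r%:R ^+ 2 + (A + A)) * (e / 5 / D)).
    by rewrite [RHS]mulrA [RHS]mulrC -/D [RHS]divfK// gt_eqF.
  rewrite ler_wpM2l ?divr_ge0 ?addr_ge0 ?sqr_ge0 ?(ltW S0)//.
  rewrite (@le_trans _ _ ((r%:R ^+ 2 + (A + A)) * h))//; last first.
    by rewrite ler_wpM2l ?addr_ge0 ?sqr_ge0 ?(ltW A0).
  rewrite [leRHS]mulrDl lerD// exprMn ler_wpM2l ?sqr_ge0// expr2 ler_piMr// ltW//.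
have -> : c%:C%C * B - psi x = c%:C%C * (B - psi x) + (c - 1)%:C%C * psi x.
  by rewrite rmorphB rmorph1; ring.
rewrite (le_trans (normcD _ _))// !normcM !normc_realE.
have -> : e = (e / 5 + e / 5 + e / 5) + (e / 5 + e / 5) by field.
rewrite lerD//.
  rewrite -[leRHS]mul1r ler_pM ?normc_ge0//.
rewrite (@le_trans _ _ (e / 5)) ?lerDl ?(ltW e5)//.
have S1 : S != 0 by rewrite gt_eqF.
by rewrite -[leRHS](divfK S1) ler_pM ?normc_ge0// HS.
Qed.

End Bernstein.

(** * Interchanging two distributions *)

Section Fubini.
Context {R : realType} {d : nat}.
Local Notation Rd := 'rV[R]_d.
Local Notation C := (R[i]^o).
Local Notation e_ i := (delta_mx 0 i : Rd).
Implicit Types (f g : Rd -> C).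

Definition monomial (al : 'I_d -> nat) (x : Rd) : C := \prod_(i < d) (x 0 i)%:C%C ^+ al i.

(** Independence of the first k variables. The density argument makes a
    function polynomial in the variables 0, ..., k - 1 in turn, and stores
    that part in a monomial factor. *)
Definition dep_from k g := forall x y : Rd,
  (forall i : 'I_d, (k <= i)%N -> x 0 i = y 0 i) -> g x = g y.

Lemma smooth_monomial al : smooth_on setT (monomial al).
Proof.
apply: (@smooth_prod _ _ setT _ _ _ openT) => i.
elim: (al i) => [|n IH]; first exact: smooth_cst openT.
have := smoothM openT (smooth_coord i openT) IH.
by congr smooth_on; apply/funext => x; rewrite exprS.
Qed.

Lemma monomial_hadamard al (x y : Rd) : monomial al (hadamard x y) = monomial al x * monomial al y.
Proof.
rewrite /monomial -big_split /=; apply: eq_bigr => i _.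
by rewrite hadamardE rmorphM exprMn.
Qed.

Lemma monomial_incr al (j : 'I_d) x :
  monomial (fun i => (i == j) + al i)%N x = (x 0 j)%:C%C * monomial al x.
Proof.
rewrite /monomial (bigD1 j)//= [in RHS](bigD1 j)//= eqxx exprS -mulrA; congr (_ * (_ * _)).
by apply: eq_bigr => i /negbTE ->.
Qed.

Lemma monomial0 x : monomial (fun=> 0%N) x = 1.
Proof. by rewrite /monomial big1. Qed.

Lemma smooth_monomialM al g : smooth_on setT g -> smooth_on setT (fun x => monomial al x * g x).
Proof. by move=> sg; exact: (smoothM openT (smooth_monomial al) sg). Qed.

Variable Phi : dual (Cinf (@openT Rd)).
Hypothesis Phi_mono : forall al (c : C), Phi (to_Cinf (fun x => monomial al x * c)) = 0.

(** Expanding one trial of the average writes the polynomial of degree n + 1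
    as a combination of those of degree n with coefficients affine in x_j; the
    factor x_j is absorbed in the monomial. At degree 0 the function no longer
    depends on the variable j. *)
Lemma vanish_monomial_bernstein k (j : 'I_d) n h A L : nat_of_ord j = k ->
  (forall al g, smooth_on setT g -> dep_from k.+1 g ->
    Phi (to_Cinf (fun x => monomial al x * g x)) = 0) ->
  forall al g, smooth_on setT g -> dep_from k g ->
    Phi (to_Cinf (fun x => monomial al x * bernstein j n h A L g x)) = 0.
Proof.
move=> jk IHk; elim: n => [|n IH] al g sg dg.
  suff dp : dep_from k.+1 (g \o pin j A).
    exact: (IHk al _ (smooth_comp_pin j A sg) dp).
  move=> x y xy; apply: dg => i ki; rewrite !mxE.
  have [//|ij] := eqVneq i j; apply: xy; rewrite ltn_neqAle ki andbT -jk.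
  by apply: contra ij => /eqP ji; apply/eqP/val_inj.
have sT := smooth_translate j h sg.
have dT : dep_from k (translate j h g).
  move=> x y xy; apply: dg => i ki; rewrite !coord_step.
  by congr (_ + _); exact: xy.
pose al' i := ((i == j) + al i)%N.
pose G b f := fun x => monomial b x * bernstein j n h A L f x.
have sG b f : smooth_on setT f -> smooth_on setT (G b f).
  by move=> sf; apply: smooth_monomialM; exact: smooth_bernstein.
have sc (a : C) b f (sf : smooth_on setT f) := smoothM openT (smooth_cst a openT) (sG b f sf).
pose p : C := (1 - A / L)%:C%C; pose q : C := (- L^-1)%:C%C.
pose p' : C := (A / L)%:C%C; pose q' : C := (L^-1)%:C%C.
have E : (fun x => monomial al x * bernstein j n.+1 h A L g x) =
    (fun x => p * G al g x + (q * G al' g x + (p' * G al (translate j h g) x +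
      (q' * G al' (translate j h g) x + 0)))).
  apply/funext => x; rewrite bernstein_S /G /al' !monomial_incr /p /q /p' /q'.
  by rewrite !(rmorphM, rmorphB, rmorphD, rmorphN, rmorph1) /=; ring.
have s0 : smooth_on setT (fun _ : Rd => 0 : C) by exact: smooth_cst openT.
have s4 := smoothD openT (sc q' al' _ sT) s0.
have s3 := smoothD openT (sc p' al _ sT) s4.
have s2 := smoothD openT (sc q al' _ sg) s3.
rewrite E (to_Cinf_lin _ p (sG al g sg) s2) (to_Cinf_lin _ q (sG al' g sg) s3).
rewrite (to_Cinf_lin _ p' (sG al _ sT) s4) (to_Cinf_lin _ q' (sG al' _ sT) s0).
rewrite (IH al g sg dg) (IH al' g sg dg) (IH al _ sT dT) (IH al' _ sT dT).
have := Phi_mono (fun=> 0%N) 0; rewrite (_ : (fun x => _ * 0) = fun=> 0); last first.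
  by apply/funext => x; rewrite mulr0.
by move=> ->; rewrite !mulr0 !addr0.
Qed.

(** Continuity of Phi: it is enough to approximate f, in the seminorms that
    control Phi, by functions killed by Phi. *)
Lemma vanish_of_approx f : smooth_on setT f ->
  (forall (ws : seq (seq 'I_d)) (K : set Rd) (e : R), compact K -> 0 < e ->
    exists g, [/\ smooth_on setT g, Phi (to_Cinf g) = 0 &
     forall s t, s \in ws -> K t -> normc (iter_partial s (fun x => (-1) * g x + f x) t) <= e]) ->
  Phi (to_Cinf f) = 0.
Proof.
move=> sf H; have [ws [K [M [cK M0 HM]]]] := dual_bound Phi.
apply: eq0_normc; apply/eqP; rewrite eq_le normc_ge0 andbT.
apply/ler_addgt0Pr => e e0; rewrite add0r.
have eM : 0 < e / M by rewrite divr_gt0.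
have [g [sg Pg Hg]] := H ws K _ cK eM.
have := HM _ _ (smoothD openT (smoothM openT (smooth_cst (-1) openT) sg) sf) (ltW eM) Hg.
rewrite (to_Cinf_lin _ (-1) sg sf) Pg mulr0 add0r => /le_trans; apply.
by rewrite mulrC divfK// gt_eqF.
Qed.

(** Induction on the number m of variables that g may still depend on. A
    function of no variable is a constant; otherwise Bernstein polynomials in
    the first of these variables approximate g. *)
Lemma vanish_monomial_dep_from m k : (k + m = d)%N -> forall al g, smooth_on setT g -> dep_from k g ->
  Phi (to_Cinf (fun x => monomial al x * g x)) = 0.
Proof.
elim: m k => [|m IH] k km al g sg dg.
  rewrite (_ : (fun x => _) = fun x => monomial al x * g 0) ?Phi_mono//.
  apply/funext => x; congr (_ * _); apply: dg => i; rewrite leqNgt.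
  by rewrite addn0 in km; rewrite km ltn_ord.
have kd : (k < d)%N by rewrite -km addnS ltnS leq_addr.
pose j := Ordinal kd.
have IHk := IH k.+1 (etrans (addSnnS k m) km).
apply: vanish_of_approx; first exact: smooth_monomialM.
move=> ws K e cK e0.
have [A A0 KA] := compact_sub_box cK.
have [vs [M [M0 HM]]] := @subst_seminorms R d d setT setT openT id id (fun _ _ => 1)
   (fun z i t => congr1 (fun s => z + s *: e_ i) (esym (mulr1 t)))
   (fun i => smooth_cst _ openT) (fun _ _ => I) (monomial al) ws K (smooth_monomial al) cK (fun _ _ => I).
have eM : 0 < e / M by rewrite divr_gt0.
have [N HN] : exists N : nat, forall n, (N <= n)%N -> (0 < n)%N -> forall p x, p \in vs -> box A x ->
    normc (iter_partial p (bernstein j n ((A + A) / n%:R) A (A + A) g) x - iter_partial p g x) <= e / M.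
  elim: (vs) => [|v l [N HN]]; first by exists 0%N.
  have [N' HN'] := bernstein_cvg j v sg A0 eM.
  exists (maxn N N') => n; rewrite geq_max => /andP[nN nN'] n0 p x.
  by rewrite inE => /orP[/eqP ->|pl] Ax; [exact: HN'|exact: HN].
pose n := maxn N 1.
have n0 : (0 < n)%N by rewrite leq_max orbT.
pose B := bernstein j n ((A + A) / n%:R) A (A + A) g.
have sB : smooth_on setT B by exact: smooth_bernstein.
exists (fun x => monomial al x * B x); split.
- exact: smooth_monomialM.
- exact: (@vanish_monomial_bernstein k j n _ A _ erefl IHk al g sg dg).
move=> s t sws Kt.
have -> : (fun x => -1 * (monomial al x * B x) + monomial al x * g x) =
   (fun x => monomial al x * (-1 * B x + g x)) by apply/funext => x; ring.
rewrite -[leRHS](_ : M * (e / M) = e); last by rewrite mulrC divfK// gt_eqF.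
have sBg := smoothD openT (smoothM openT (smooth_cst (-1) openT) sB) sg.
apply: (HM _ _ sBg (ltW eM) _ s t sws Kt) => p z pvs Kz.
rewrite (iter_partial_comb (-1) p sB sg) mulN1r addrC normcB.
by apply: HN => //; [exact: leq_maxl|exact: KA].
Qed.

(** Density of the polynomials in the space of smooth functions, in dual form:
    a continuous functional that kills them is zero. *)
Lemma vanish_of_monomials (f : Cinf (@openT Rd)) : Phi f = 0.
Proof.
have := @vanish_monomial_dep_from d 0 (add0n d) (fun=> 0%N) f (Cinf_smooth f).
move=> H; rewrite -[RHS]H.
  congr (dual_fun Phi _); apply: val_inj => /=.
  rewrite to_CinfE; first by apply/funext => x; rewrite monomial0 mul1r.
  exact: smooth_monomialM (Cinf_smooth f).
by move=> x y xy; congr (Cinf_fun f _); apply/rowP => i; exact: xy.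
Qed.

End Fubini.

Section FubiniMult.
Context {R : realType} {d : nat}.
Local Notation Rd := 'rV[R]_d.
Local Notation C := (R[i]^o).
Implicit Types T S : dual (Cinf (@openT Rd)).

(** A monomial is multiplicative for the coordinatewise product, so it is an
    eigenvector of the operator attached to S, with the moment of S as
    eigenvalue: both iterated pairings are products of two moments. *)
Lemma mult_op_monomial T S al (c : C) :
  T (mult_op S (to_Cinf (fun x => monomial al x * c))) =
  c * (S (to_Cinf (monomial al)) * T (to_Cinf (monomial al))).
Proof.
have sm := @smooth_monomial R d al.
have sc : smooth_on setT (fun x => monomial al x * c) by exact: (smoothM openT sm (smooth_cst c openT)).
have s0 : smooth_on setT (fun _ : Rd => 0 : C) by exact: smooth_cst openT.
have lin (u : dual (Cinf (@openT Rd))) (a : C) :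
    u (to_Cinf (fun x => a * monomial al x + 0)) = a * u (to_Cinf (monomial al)).
  rewrite (to_Cinf_lin u a sm s0).
  have -> : to_Cinf (fun _ : Rd => 0 : C) = 0.
    by apply: val_inj; apply: etrans (to_CinfE s0) _.
  by rewrite dual0 addr0.
have E : mult_op_fun S (to_Cinf (fun x => monomial al x * c)) =
    fun y => (c * S (to_Cinf (monomial al))) * monomial al y + 0.
  apply/funext => y; rewrite /mult_op_fun (to_CinfE sc).
  have -> : (fun eta => monomial al (hadamard eta y) * c) =
      (fun eta => (c * monomial al y) * monomial al eta + 0).
    by apply/funext => eta; rewrite monomial_hadamard addr0; ring.
  by rewrite lin addr0; ring.
by rewrite /mult_op E lin mulrA.
Qed.

(** The two iterated pairings are continuous functionals of f and agree on
    monomials. *)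
Lemma fubini T S f : T (mult_op S f) = S (mult_op T f).
Proof.
(* Their difference is an element of the dual because both operators are
   continuous. *)
pose u1 : dual (Cinf (@openT Rd)) := transpose (mult_op_lincont S) T.
pose u2 : dual (Cinf (@openT Rd)) := transpose (mult_op_lincont T) S.
pose Phi : dual (Cinf (@openT Rd)) := (-1) *: u2 + u1.
have PhiE g : Phi g = -1 * S (mult_op T g) + T (mult_op S g) by [].
have Pm al (c : C) : Phi (to_Cinf (fun x => monomial al x * c)) = 0.
  by rewrite PhiE !mult_op_monomial; ring.
by apply/eqP; rewrite -subr_eq0 addrC -mulN1r -PhiE (vanish_of_monomials Pm).
Qed.

End FubiniMult.

(** * Averaging dilations of a function defined on Omega only *)

Section LocalOperator.
Context {R : realType} {d : nat}.
Local Notation Rd := 'rV[R]_d.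
Local Notation C := (R[i]^o).
Variables (Omega' Omega : set Rd) (oOmega' : open Omega') (oOmega : open Omega).
Variable T : dual (Cinf (@openT Rd)).
Local Notation H := (distr_supp T).

Section Cut.
Variables (chi : Rd -> C) (L : set Rd).
Hypotheses (schi : smooth_on setT chi) (cL : compact L) (LO : L `<=` Omega).
Hypothesis chi0 : forall x, ~ L x -> chi x = 0.

Definition cut (f : Rd -> C) : Rd -> C := fun x => chi x * f x.

Let oLc : open (~` L).
Proof. by apply: closed_openC; apply: compact_closed => //; exact: norm_hausdorff. Qed.

(** The product is smooth on Omega as a product, and it is zero on the
    complement of L; these two open sets cover the space. *)
Lemma smooth_cut (f : Cinf oOmega) : smooth_on setT (cut f).
Proof.
apply: (smooth_local openT) => x _; have [Ox|nOx] := pselect (Omega x).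
  exists (cut f), Omega; split => //.
  exact: (smoothM oOmega (smooth_sub (@subsetT _ Omega) schi) (Cinf_smooth f)).
exists (fun=> 0), (~` L); split => //.
- by move=> /LO.
- exact: smooth_cst oLc.
- by move=> y /set_mem Ly; rewrite /cut chi0// mul0r.
Qed.

Lemma cut_bound (w : seq 'I_d) : exists (vs : seq (seq 'I_d)) (M : R), 0 < M /\
  forall (f : Cinf oOmega) (e : R), 0 <= e ->
    (forall p t, p \in vs -> L t -> normc (iter_partial p f t) <= e) ->
    forall t, normc (iter_partial w (cut f) t) <= M * e.
Proof.
have step (z : Rd) i t : z + t *: delta_mx 0 i = z + (t * 1) *: delta_mx 0 i by rewrite mulr1.
have sq (i : 'I_d) : smooth_on Omega (fun z => (1 : R)%:C%C : C) by exact: smooth_cst oOmega.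
have [vs [M [M0 HM]]] := @subst_seminorms R d d Omega Omega oOmega id id (fun _ _ => 1)
  step sq (fun z Oz => Oz) chi [:: w] L (smooth_sub (@subsetT _ Omega) schi) cL LO.
exists vs, M; split => // f e e0 Hf t; have [Lt|nLt] := pselect (L t).
  by apply: (HM _ _ (Cinf_smooth f) e0 Hf) => //; rewrite inE.
rewrite (@iter_partial_near _ _ _ (fun=> 0)); last first.
  by apply: filterS (open_nbhs_nbhs (conj oLc nLt)) => x Lx; rewrite /cut chi0// mul0r.
have -> : iter_partial w (fun=> 0 : C) t = 0 by exact: (iter_partial0 (@openT Rd) w (I : setT t)).
by rewrite normc0 mulr_ge0// ltW.
Qed.

End Cut.

Definition is_cutoff (K : set Rd) (chi : Rd -> C) := [/\ smooth_on setT chi,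
    exists2 L : set Rd, compact L /\ L `<=` Omega & forall x, ~ L x -> chi x = 0 &
    exists2 O' : set Rd, open O' /\ K `<=` O' & forall x, O' x -> chi x = 1].

Lemma smooth_cutoff K chi (f : Cinf oOmega) : is_cutoff K chi -> smooth_on setT (cut chi f).
Proof. by move=> [sc [L [cL LO] L0] _]; exact: smooth_cut cL LO L0 f. Qed.

Lemma smooth_orbit (g : Rd -> C) y : smooth_on setT g ->
  smooth_on setT (fun eta => g (hadamard eta y)).
Proof.
move=> /(smoothT_hadamard y); congr smooth_on.
by apply/funext => z /=; rewrite hadamardC.
Qed.

(** T only sees its argument near its support, which dilation by y carries
    into O. *)
Lemma mult_op_local (g h : Rd -> C) (O : set Rd) y :
  smooth_on setT g -> smooth_on setT h -> open O ->
  (forall eta, H eta -> O (hadamard eta y)) ->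
  (forall x, O x -> g x = h x) -> mult_op_fun T g y = mult_op_fun T h y.
Proof.
move=> sg sh oO HO gh; have sgy := smooth_orbit y sg; have shy := smooth_orbit y sh.
apply/eqP; rewrite -subr_eq0; apply/eqP.
rewrite /mult_op_fun -(to_CinfB T sgy shy); apply: dual_local => x /HO Ox.
rewrite (to_CinfE (smoothD openT sgy (smoothM openT (smooth_cst (-1) openT) shy))).
have cy : hadamard z y @[z --> x] --> hadamard x y.
  by apply: (@hadamard_cvg _ _ _ (nbhs x)); [exact: cvg_id|exact: cvg_cst].
have nO : \forall z \near x, O (hadamard z y) by exact: cy _ (open_nbhs_nbhs (conj oO Ox)).
by apply: filterS nO => z Oz; rewrite gh// mulN1r addrN.
Qed.

(** Tube lemma for the compact support of T. *)
Lemma near_orbit_sub (O : set Rd) y : open O -> (forall eta, H eta -> O (hadamard eta y)) ->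
  \forall z \near y, forall eta, H eta -> O (hadamard eta z).
Proof.
move=> oO HO.
have cH : compact H by exact: compact_distr_supp.
move/compact_near_coveringP: cH => cH.
apply: (cH Rd (nbhs y) (fun z eta => O (hadamard eta z)) (nbhs_filter y)) => eta /HO Oey.
have cy : hadamard p.1 p.2 @[p --> (eta, y)] --> hadamard eta y.
  by apply: (@hadamard_cvg _ _ _ (nbhs (eta, y))); [exact: cvg_fst|exact: cvg_snd].
exact: (cy _ (open_nbhs_nbhs (conj oO Oey))).
Qed.

Hypothesis supp_sub : H `<=` dilation_set Omega' Omega.

Lemma cutoff_orbit (K : set Rd) : compact K -> K `<=` Omega' ->
  exists chi, is_cutoff [set hadamard p.1 p.2 | p in H `*` K] chi.
Proof.
move=> cK KO; apply: cutoff => //.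
  have cH : compact H by exact: compact_distr_supp.
  apply: continuous_compact; last exact: compact_setX.
  apply: continuous_subspaceT => p.
  by apply: (@hadamard_cvg _ _ _ (nbhs p)); [exact: cvg_fst|exact: cvg_snd].
by move=> _ [[eta y] [/= He Ky] <-]; apply: (supp_sub He); exists y => //; exact: KO.
Qed.

Variable chi : Rd -> Rd -> C.
Hypothesis chiP : forall y, Omega' y -> is_cutoff [set hadamard eta y | eta in H] (chi y).

(** T_eta f(eta y) for a function f given on Omega. The cutoff may depend on y
    in an arbitrary way, since the value does not depend on its choice. *)
Definition local_mult_fun (f : Rd -> C) (y : Rd) : C :=
  if y \in Omega' then mult_op_fun T (cut (chi y) f) y else 0.

(** Near a point of K the value can be computed with one cutoff for all of K,
    to which the theory on the whole space applies: two cutoffs agree near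
    (supp T) z. *)
Lemma local_mult_fun_near K c (f : Cinf oOmega) y :
  is_cutoff [set hadamard p.1 p.2 | p in H `*` K] c -> K y -> Omega' y ->
  \forall z \near y, local_mult_fun f z = mult_op_fun T (cut c f) z.
Proof.
move=> cc Ky Oy; have scf := smooth_cutoff f cc.
have [_ _ [V1 [oV1 KV1] c1]] := cc.
have HV1 eta : H eta -> V1 (hadamard eta y) by move=> He; apply: KV1; exists (eta, y).
apply: filterS2 (open_nbhs_nbhs (conj oOmega' Oy)) (near_orbit_sub oV1 HV1) => z Oz Hz.
rewrite /local_mult_fun mem_set//; have cz := chiP Oz.
have [_ _ [V2 [oV2 KV2] c2]] := cz.
apply: (@mult_op_local _ _ (V1 `&` V2)) => //.
- exact: smooth_cutoff cz.
- exact: openI.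
- by move=> eta He; split; [exact: Hz|apply: KV2; exists eta].
- by move=> x [x1 x2]; rewrite /cut c1// c2.
Qed.

(** Smoothness is local, and near a point the function comes from an operator
    on the whole space. *)
Lemma smooth_local_mult_fun (f : Cinf oOmega) : local_mult_fun f \in smooth_pred Omega'.
Proof.
apply/mem_set; split; last first.
  by apply/funext => y; rewrite /patch /local_mult_fun; case: (y \in Omega').
apply: smooth_local => // y Oy.
have Ky : [set y] `<=` Omega' by move=> _ ->.
have [c cc] := cutoff_orbit (@compact_set1 _ y) Ky.
have := local_mult_fun_near f cc (erefl y) Oy.
rewrite /prop_near1 nbhsE => -[V [oV Vy] HV].
exists (mult_op_fun T (cut c f)), V; split => //; last by move=> z /set_mem/HV.
have scf := smooth_cutoff f cc.
rewrite -(to_CinfE scf); apply: smooth_sub (smooth_mult_op T (to_Cinf (cut c f))) => //.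
Qed.

Definition local_mult_op (f : Cinf oOmega) : Cinf oOmega' := MkCinf oOmega' (smooth_local_mult_fun f).

Lemma local_mult_op_linear : linear local_mult_op.
Proof.
move=> a f g; apply: CinfP => y Oy.
have cy := chiP Oy.
have -> : (a *: local_mult_op f + local_mult_op g : Cinf oOmega') y =
   a * local_mult_fun f y + local_mult_fun g y by [].
have -> : local_mult_op (a *: f + g) y = local_mult_fun (a *: f + g : Cinf oOmega) y by [].
rewrite /local_mult_fun mem_set//.
rewrite /mult_op_fun -(to_Cinf_lin T a (smooth_orbit y (smooth_cutoff f cy))
  (smooth_orbit y (smooth_cutoff g cy))).
congr (dual_fun T (to_Cinf _)); apply/funext => eta; rewrite /cut.
have -> : (a *: f + g : Cinf oOmega) (hadamard eta y) =
  a * f (hadamard eta y) + g (hadamard eta y) by [].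
by ring.
Qed.

(** On K the derivatives of the image of f are those of the operator on the
    whole space applied to the product of f with a cutoff for K; both steps
    satisfy seminorm estimates. *)
Lemma local_mult_op_lincont : local_mult_op \in lincont (Cinf oOmega) (Cinf oOmega').
Proof.
apply: lincont_seminorms; first exact: local_mult_op_linear.
move=> w K cK KO; have [c cc] := cutoff_orbit cK KO.
have [sc [L [cL LO] L0] _] := cc.
have [ws [L' [N [cL' N0 HN]]]] := mult_op_seminorm T w cK.
have : exists (vs : seq (seq 'I_d)) (M : R), 0 < M /\
  forall (f : Cinf oOmega) (e : R), 0 <= e ->
    (forall p t, p \in vs -> L t -> normc (iter_partial p f t) <= e) ->
    forall s t, s \in ws -> normc (iter_partial s (cut c f) t) <= M * e.
  elim: (ws) => [|s l [vs [M [M0 HM]]]]; first by exists [::], 1; split.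
  have [vs' [M' [M'0 HM']]] := cut_bound sc cL LO L0 s.
  exists (vs' ++ vs), (M' + M); split; first exact: addr_gt0.
  move=> f e e0 Hf s' t; rewrite inE mulrDl => /orP[/eqP ->|s'l].
    apply: ler_wpDr; first by rewrite mulr_ge0// ltW.
    by apply: HM' => // p x pv; apply: Hf; rewrite mem_cat pv.
  apply: ler_wpDl; first by rewrite mulr_ge0// ltW.
  by apply: HM => // p x pv; apply: Hf; rewrite mem_cat pv orbT.
move=> [vs [M [M0 HM]]]; exists vs, L, (N * M); split; rewrite ?mulr_gt0// => f e e0 Hf t Kt.
have -> : iter_partial w (local_mult_op f) t = iter_partial w (mult_op T (to_Cinf (cut c f))) t.
  apply: iter_partial_near; have := local_mult_fun_near f cc Kt (KO _ Kt).
  by rewrite mult_opE (to_CinfE (smooth_cutoff f cc)).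
rewrite -mulrA; apply: HN => //; first by rewrite mulr_ge0// ltW.
move=> s x sw _; rewrite (to_CinfE (smooth_cutoff f cc)); exact: HM.
Qed.

(** For a function given on the whole space the cutoff changes nothing, so the
    operator commutes with restrictions. *)
Lemma local_mult_op_restrict (f : Cinf (@openT Rd)) :
  local_mult_op (restrict_Cinf oOmega f) = restrict_Cinf oOmega' (mult_op T f).
Proof.
apply: CinfP => y Oy.
have -> : local_mult_op (restrict_Cinf oOmega f) y = local_mult_fun (restrict_Cinf oOmega f) y by [].
have -> : restrict_Cinf oOmega' (mult_op T f) y = mult_op T f y.
  by rewrite /= /patch mem_set.
rewrite mult_opE /local_mult_fun mem_set//; have cy := chiP Oy.
have [_ _ [V2 [oV2 KV2] c2]] := cy.
apply: (@mult_op_local _ _ (V2 `&` Omega)) => //.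
- exact: smooth_cutoff cy.
- exact: Cinf_smooth.
- exact: openI.
- move=> eta He; split; first by apply: KV2; exists eta.
  by apply: (supp_sub He); exists y.
- by move=> x [x2 Ox]; rewrite /cut c2// mul1r /= /patch mem_set.
Qed.

(** The transposed operator pairs S with T_eta f(eta y), and the convolution
    pairs T with S_y f(eta y): interchanging the two pairings identifies them. *)
Lemma emb_transpose_local_mult_op (S : dual (Cinf oOmega')) :
  emb_distr oOmega (transpose local_mult_op_lincont S) =1 mconv T (emb_distr oOmega' S).
Proof.
move=> f; have -> : emb_distr oOmega (transpose local_mult_op_lincont S) f =
  S (local_mult_op (restrict_Cinf oOmega f)) by [].
rewrite local_mult_op_restrict.
have -> : S (restrict_Cinf oOmega' (mult_op T f)) = emb_distr oOmega' S (mult_op T f) by [].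
rewrite -fubini /mconv /mult_op /mult_op_fun.
congr (dual_fun T (to_Cinf _)); apply/funext => x.
by congr (dual_fun _ (to_Cinf _)); apply/funext => z; rewrite hadamardC.
Qed.

End LocalOperator.

(** * The equivalence *)

Section Main.
Context {R : realType} {d : nat}.
Local Notation Rd := 'rV[R]_d.
Variables (Omega' Omega : set Rd) (oOmega' : open Omega') (oOmega : open Omega).
Variable T : dual (Cinf (@openT Rd)).

Lemma conv_of_support : distr_supp T `<=` dilation_set Omega' Omega ->
  conv_in_L (emb_distr oOmega') (emb_distr oOmega) T.
Proof.
move=> sTO.
have ex_chi (y : Rd) : exists chi : Rd -> R[i]^o, Omega' y ->
    is_cutoff Omega [set hadamard eta y | eta in distr_supp T] chi.
  have [Oy|] := pselect (Omega' y); last by exists (fun=> 0).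
  have Ky : [set y] `<=` Omega' by move=> _ ->.
  have [c [sc sup [V [oV KV] c1]]] := cutoff_orbit oOmega sTO (@compact_set1 _ y) Ky.
  exists c => _; split => //; exists V => //; split => // _ [eta He <-].
  by apply: KV; exists (eta, y).
have [chi chiP] := choice ex_chi.
exists (transpose (local_mult_op_lincont oOmega' oOmega sTO chiP)); first exact: transpose_lincont.
by move=> S; exact: emb_transpose_local_mult_op.
Qed.

(** Compose with the strongly continuous inclusion of measures in
    distributions. *)
Lemma conv_measure_of_conv : conv_in_L (emb_distr oOmega') (emb_distr oOmega) T ->
  conv_in_L (emb_measure oOmega') (emb_distr oOmega) T.
Proof.
move=> [N hN HN]; exists (N \o transpose (Cinf_C0_lincont oOmega')).
  exact: lincont_comp (transpose_lincont _) hN.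
move=> mu f; rewrite (HN _ f) /mconv; congr (dual_fun T (to_Cinf _)); apply/funext => x.
exact: emb_distr_C0.
Qed.

End Main.
Local Close Scope ring_scope.

Theorem theorem1p5 (R : realType) (d : nat) (Omega' Omega : set 'rV[R]_d)
    (oOmega' : open Omega') (oOmega : open Omega)
    (T : dual (Cinf (@openT 'rV[R]_d))) :
  [<-> conv_in_L (emb_distr oOmega') (emb_distr oOmega) T;
       conv_in_L (emb_measure oOmega') (emb_distr oOmega) T;
       distr_supp T `<=` dilation_set Omega' Omega].
Proof.
tfae.
- exact: conv_measure_of_conv.
- exact: support_of_conv.
- exact: conv_of_support.
Qed.
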